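(* Assume (A1), (A2) and (A3) (see context). For every $\omega,\theta\in\mathbb S^{n-1}$, one has $$\Lambda_\omega^-\cap\Lambda_-\ne\emptyset\quad\text{and}\quad\Lambda_\theta^+\cap\Lambda_+\neq\emptyset .$$
   Context: Let $n\ge 2$, $p(x,\xi)=\frac12|\xi|^2+V(x)$ on $T^*\mathbb R^n$, $H_p=\xi\cdot\partial_x-\nabla V\cdot\partial_\xi$ with flow $\exp(tH_p)$, $\langle x\rangle=(1+|x|^2)^{1/2}$. (A1) $V$ is a real-valued $C^\infty$ function on $\mathbb R^n$ and for some $\rho>1$, $\partial^\alpha V(x)=\mathcal O(\langle x\rangle^{-\rho-|\alpha|})$ for every multi-index $\alpha$. (A2) $V$ has a non-degenerate maximum point at $x=0$, with $E_0=V(0)>0$ and $\nabla^2V(0)=\operatorname{diag}(-\lambda_1^2,\dots,-\lambda_n^2)$, $0<\lambda_1\le\dots\le\lambda_n$. (A3) The trapped set $K(E_0)=\{(x,\xi)\in p^{-1}(E_0):\exp(tH_p)(x,\xi)\not\to\infty$ as $t\to+\infty$ and $\exp(tH_p)(x,\xi)\not\to\infty$ as $t\to-\infty\}$ equals $\{(0,0)\}$. For $\alpha\in\mathbb S^{n-1}$, $z\in\alpha^\perp\simeq\mathbb R^{n-1}$ and $E>0$ there is a unique integral curve $\gamma_\pm(t,z,\alpha,E)=(x_\pm,\xi_\pm)(t,z,\alpha,E)$ of $H_p$ such that $\lim_{t\to\pm\infty}|x_\pm(t,z,\alpha,E)-\sqrt{2E}\,\alpha t-z|=0$ and $\lim_{t\to\pm\infty}|\xi_\pm(t,z,\alpha,E)-\sqrt{2E}\,\alpha|=0$.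 At energy $E=E_0$ set $\Lambda_\omega^-=\{\gamma_-(t,z,\omega,E_0):z\in\omega^\perp,t\in\mathbb R\}$, $\Lambda_\theta^+=\{\gamma_+(t,z,\theta,E_0):z\in\theta^\perp,t\in\mathbb R\}$, and $\Lambda_\pm=\{(x,\xi)\in T^*\mathbb R^n:\exp(tH_p)(x,\xi)\to(0,0)\text{ as }t\to\mp\infty\}$. *)

(* Defs.v *)
From HB Require Import structures.
From mathcomp Require Import all_boot all_order all_algebra.
From mathcomp Require Import all_classical all_reals all_analysis.

Set Implicit Arguments.
Unset Strict Implicit.
Unset Printing Implicit Defensive.
Import Order.TTheory GRing.Theory Num.Theory.
Import numFieldNormedType.Exports.

Local Open Scope classical_set_scope.
Local Open Scope ring_scope.

(* Points of R^n are row vectors. The library norm `|x| on 'rV[R]_n is the sup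
   norm, so the Euclidean structure is introduced here. *)
Definition dot (R : realType) (n : nat) (x y : 'rV[R]_n) : R :=
  \sum_(i < n) x 0 i * y 0 i.

Definition enorm (R : realType) (n : nat) (x : 'rV[R]_n) : R :=
  Num.sqrt (dot x x).

Definition jap (R : realType) (n : nat) (x : 'rV[R]_n) : R :=
  Num.sqrt (1 + enorm x ^+ 2).

Definition unit_sphere (R : realType) (n : nat) : set 'rV[R]_n :=
  [set a | enorm a = 1].

Definition orth (R : realType) (n : nat) (a : 'rV[R]_n) : set 'rV[R]_n :=
  [set z | dot z a = 0].

Definition partial (R : realType) (n : nat) (i : 'I_n) (f : 'rV[R]_n -> R) :
    'rV[R]_n -> R :=
  fun x => 'D_(delta_mx 0 i) f x.

Definition grad (R : realType) (n : nat) (f : 'rV[R]_n -> R) (x : 'rV[R]_n) :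
    'rV[R]_n :=
  \row_(i < n) partial i f x.

Definition hessian (R : realType) (n : nat) (f : 'rV[R]_n -> R)
    (x : 'rV[R]_n) : 'M[R]_n :=
  \matrix_(i < n, j < n) partial i (partial j f) x.

(* C^oo: all iterated partial derivatives, in any order, exist everywhere and
   are continuous. *)
Definition smooth (R : realType) (n : nat) (f : 'rV[R]_n -> R) : Prop :=
  forall s : seq 'I_n,
    continuous (foldr (@partial R n) f s) /\
    forall (i : 'I_n) (x : 'rV[R]_n),
      derivable (foldr (@partial R n) f s) x (delta_mx 0 i).

(* The multi-index derivative, with a fixed order of differentiation, which is
   immaterial for smooth f. *)
Definition mpartial (R : realType) (n : nat) (a : 'I_n -> nat)
    (f : 'rV[R]_n -> R) : 'rV[R]_n -> R :=
  foldr (fun i g => iter (a i) (partial i) g) f (enum 'I_n).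

Definition symbol (R : realType) (n : nat) (V : 'rV[R]_n -> R)
    (p : 'rV[R]_n * 'rV[R]_n) : R :=
  2^-1 * enorm p.2 ^+ 2 + V p.1.

Definition hamiltonian_field (R : realType) (n : nat) (V : 'rV[R]_n -> R)
    (p : 'rV[R]_n * 'rV[R]_n) : 'rV[R]_n * 'rV[R]_n :=
  (p.2, - grad V p.1).

Definition integral_curve (R : realType) (n : nat) (V : 'rV[R]_n -> R)
    (g : R -> 'rV[R]_n * 'rV[R]_n) : Prop :=
  forall t : R, is_derive t (1 : R) g (hamiltonian_field V (g t)).

(* g is the curve t |-> exp(t H_p)(p). For the potentials considered here the
   vector field is globally Lipschitz, so that there is exactly one such g for
   each p. *)
Definition orbit_of (R : realType) (n : nat) (V : 'rV[R]_n -> R)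
    (p : 'rV[R]_n * 'rV[R]_n) (g : R -> 'rV[R]_n * 'rV[R]_n) : Prop :=
  integral_curve V g /\ g 0 = p.

(* The trapped set K(E). Tending to infinity does not depend on the norm. *)
Definition trapped_set (R : realType) (n : nat) (V : 'rV[R]_n -> R) (E : R) :
    set ('rV[R]_n * 'rV[R]_n) :=
  [set p | symbol V p = E /\
    exists g : R -> 'rV[R]_n * 'rV[R]_n,
      [/\ orbit_of V p g,
          ~ (`|g t| @[t --> +oo] --> +oo) &
          ~ (`|g t| @[t --> -oo] --> +oo)]].

Definition assumption_A1 (R : realType) (n : nat) (V : 'rV[R]_n -> R) : Prop :=
  smooth V /\
  exists rho : R, 1 < rho /\
    forall a : 'I_n -> nat, exists C : R, forall x : 'rV[R]_n,
      `|mpartial a V x| <= C * jap x `^ (- rho - (\sum_(i < n) a i)%N%:R).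

(* The maximum is local; the assumption on the trapped set makes it global. *)
Definition assumption_A2 (R : realType) (n : nat) (V : 'rV[R]_n -> R) (E0 : R)
    (lambda : 'I_n -> R) : Prop :=
  [/\ \forall x \near (0 : 'rV[R]_n), V x <= V 0,
      V 0 = E0,
      0 < E0,
      hessian V 0 = diag_mx (\row_(i < n) - lambda i ^+ 2) &
      (forall i : 'I_n, 0 < lambda i) /\
      (forall i j : 'I_n, (i <= j)%N -> lambda i <= lambda j)].

Definition assumption_A3 (R : realType) (n : nat) (V : 'rV[R]_n -> R) (E0 : R) :
    Prop :=
  trapped_set V E0 = [set ((0 : 'rV[R]_n), (0 : 'rV[R]_n))].

(* g is gamma_+(., z, a, E), resp. gamma_-(., z, a, E): the filter F is the
   neighborhood filter of +oo, resp. -oo. *)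
Definition asymptotic_curve (R : realType) (n : nat) (V : 'rV[R]_n -> R)
    (F : set_system R) (z a : 'rV[R]_n) (E : R)
    (g : R -> 'rV[R]_n * 'rV[R]_n) : Prop :=
  [/\ integral_curve V g,
      enorm ((g t).1 - (Num.sqrt (2 * E) * t) *: a - z) @[t --> F]
        --> (0 : R) &
      enorm ((g t).2 - Num.sqrt (2 * E) *: a) @[t --> F] --> (0 : R)].

Definition Lambda_asymptotic (R : realType) (n : nat) (V : 'rV[R]_n -> R)
    (F : set_system R) (a : 'rV[R]_n) (E : R) : set ('rV[R]_n * 'rV[R]_n) :=
  [set p | exists (z : 'rV[R]_n) (g : R -> 'rV[R]_n * 'rV[R]_n) (t : R),
    [/\ orth a z, asymptotic_curve V F z a E g & p = g t]].

(* Lambda_omega^- : the points coming from direction omega as t -> -oo. *)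
Definition Lambda_incoming (R : realType) (n : nat) (V : 'rV[R]_n -> R)
    (E : R) (omega : 'rV[R]_n) : set ('rV[R]_n * 'rV[R]_n) :=
  Lambda_asymptotic V (ninfty_nbhs R) omega E.

(* Lambda_theta^+ : the points leaving in direction theta as t -> +oo. *)
Definition Lambda_outgoing (R : realType) (n : nat) (V : 'rV[R]_n -> R)
    (E : R) (theta : 'rV[R]_n) : set ('rV[R]_n * 'rV[R]_n) :=
  Lambda_asymptotic V (pinfty_nbhs R) theta E.

(* Lambda_- : the points that tend to (0,0) as t -> +oo. *)
Definition Lambda_minus (R : realType) (n : nat) (V : 'rV[R]_n -> R) :
    set ('rV[R]_n * 'rV[R]_n) :=
  [set p | exists g : R -> 'rV[R]_n * 'rV[R]_n, orbit_of V p g /\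
    g t @[t --> +oo] --> ((0 : 'rV[R]_n), (0 : 'rV[R]_n))].

(* Lambda_+ : the points that tend to (0,0) as t -> -oo. *)
Definition Lambda_plus (R : realType) (n : nat) (V : 'rV[R]_n -> R) :
    set ('rV[R]_n * 'rV[R]_n) :=
  [set p | exists g : R -> 'rV[R]_n * 'rV[R]_n, orbit_of V p g /\
    g t @[t --> -oo] --> ((0 : 'rV[R]_n), (0 : 'rV[R]_n))].

(* Main.v *)
(** By time reversal it suffices to find, for a unit vector [om], a trajectory
    of energy [E0] that comes from infinity with direction [om] and tends to
    the origin.

    Two points can be joined by a trajectory of energy [E] as soon as [E - V]
    is bounded below by a positive constant: such a trajectory is a geodesic of
    the Jacobi metric [(E - V) |dx|^2], obtained as a limit of minimisers of a
    discrete action on finite-dimensional path spaces.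

    Joining the origin to a point [x1 <> 0] with [E0 <= V x1] (for a capped
    potential, at energies decreasing to [E0]) would produce in the limit a
    non-trivial bounded orbit of energy [E0], against (A3); hence [V < E0] away
    from the origin, and [- k om] can be joined to the origin at an energy
    slightly above [E0].  Outside a large ball [|x|^2] is strictly convex along
    trajectories, so that these orbits enter the ball once and stay in it
    afterwards, for a time that tends to infinity.  A limit of the orbits, based
    at their entrance point, is bounded in the future, and so tends to the
    origin by (A3); in the past the decay of the force keeps its velocity within
    [O((1 - t)^(- rho))] of [sqrt (2 E0) om], which gives the asymptotics since
    [rho > 1].  *)
Require Import Defs.
From mathcomp Require Import all_boot all_order all_algebra.
From mathcomp Require Import all_classical all_reals all_analysis.
From mathcomp Require Import ring lra.
Import Order.TTheory GRing.Theory Num.Theory.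
Import numFieldNormedType.Exports.
Local Open Scope classical_set_scope.
Local Open Scope ring_scope.

Set Implicit Arguments.
Unset Strict Implicit.
Unset Printing Implicit Defensive.

(** * Calculus on the line *)

Section RealCalculus.
Variable R : realType.
Implicit Types (f g df dg : R -> R) (a b c t : R).

(** The obstacle sits at the energy [E0] itself: there [E0 - V] vanishes at the origin, so the
    Jacobi metric degenerates at the very point to be reached, and an orbit needs infinite time to
    get there. Hence the energies slightly above [E0], where connection times are finite, and the
    compactness arguments as they decrease. Two facts make the limits non-trivial: the base points
    of the orbits lie on a fixed sphere, and [(0, 0)] is an equilibrium, so that by Gronwall the
    time between that sphere and a state at squared distance O(e) from [(0, 0)] tends to infinity.
    For the strict maximum, the orbit ends at a point where [V = E0] and the speed is small: it then
    almost turns back, which keeps the limit bounded in the future as well. The direction [om]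
    survives the limit because the force on the incoming branch is dominated by a power of [1 - t]
    uniformly along the sequence: each velocity stays close to the mean velocity since the start at
    [- k om], which is nearly parallel to [om], and the energy fixes its length. *)

Lemma is_derive1_continuous f t d : is_derive t 1 f d -> {for t, continuous f}.
Proof. by case=> fd _; exact/differentiable_continuous/derivable1_diffP. Qed.

Lemma derive1_within_continuous f df a b :
  (forall t, a <= t <= b -> is_derive t 1 f (df t)) ->
  {within `[a, b], continuous f}.
Proof.
move=> fd; apply: derivable_within_continuous => t.
by rewrite in_itv /= => /fd [].
Qed.

Lemma derive1_le_incr f g df dg a b : a <= b ->
  (forall t, a <= t <= b -> is_derive t 1 f (df t)) ->
  (forall t, a <= t <= b -> is_derive t 1 g (dg t)) ->
  (forall t, a <= t <= b -> df t <= dg t) ->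
  f b - f a <= g b - g a.
Proof.
move=> ab fd gd fg.
have hd t : a <= t <= b -> is_derive t 1 (g - f) (dg t - df t).
  by move=> tab; have ? := fd _ tab; have ? := gd _ tab; exact: is_deriveB.
have hd' t : t \in `]a, b[ -> is_derive t 1 (g - f) (dg t - df t).
  by rewrite in_itv /= => /andP[/ltW at_ /ltW tb]; apply: hd; rewrite at_ tb.
have [c cab E] := MVT_segment ab hd' (derive1_within_continuous hd).
have : 0 <= (g - f) b - (g - f) a.
  rewrite E mulr_ge0 ?subr_ge0//; apply: fg.
  by move: cab; rewrite in_itv.
rewrite -![(g - f) _]/(g _ - f _); lra.
Qed.

Lemma derive1_norm_le_incr f g df dg a b : a <= b ->
  (forall t, a <= t <= b -> is_derive t 1 f (df t)) ->
  (forall t, a <= t <= b -> is_derive t 1 g (dg t)) ->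
  (forall t, a <= t <= b -> `|df t| <= dg t) ->
  `|f b - f a| <= g b - g a.
Proof.
move=> ab fd gd fg; rewrite ler_norml; apply/andP; split; last first.
  apply: (derive1_le_incr ab fd gd) => t /fg; exact: le_trans (ler_norm _).
rewrite lerNl opprB.
have nfd t : a <= t <= b -> is_derive t 1 (- f) (- df t).
  by move=> /fd ?; exact: is_deriveN.
have := derive1_le_incr ab nfd gd.
rewrite -![(- f) _]/(- f _) opprK addrC; apply=> t /fg.
by apply: le_trans; rewrite -normrN ler_norm.
Qed.

Lemma is_derive1_shift f t s d :
  is_derive (t + s) 1 f d -> is_derive t 1 (fun u => f (u + s)) d.
Proof.
move=> fd; have h : is_derive t (1:R) (fun u : R => u + s) 1.
  by apply: is_derive_eq; rewrite addr0.
have := @is_derive1_comp R f (fun u : R => u + s) t d 1 fd h.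
by rewrite mulr1.
Qed.

Lemma is_derive1_opp f t d :
  is_derive (- t) 1 f d -> is_derive t 1 (fun u => f (- u)) (- d).
Proof.
move=> fd; have h : is_derive t (1:R) (fun u : R => - u) (-1).
  exact: is_deriveNid.
have := @is_derive1_comp R f (fun u : R => - u) t d (-1) fd h.
by rewrite mulrN1.
Qed.

Lemma derive1_norm_le_const f df c a b : a <= b ->
  (forall t, a <= t <= b -> is_derive t 1 f (df t)) ->
  (forall t, a <= t <= b -> `|df t| <= c) ->
  `|f b - f a| <= c * (b - a).
Proof.
move=> ab fd fc.
have gd t : a <= t <= b -> is_derive t 1 (fun u : R => c * u) c.
  by move=> _; apply: is_derive_eq; rewrite /GRing.scale /= mulr1.
have := derive1_norm_le_incr ab fd gd fc.
by rewrite -mulrBr.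
Qed.

Lemma is_derive_expRM k t : is_derive t 1 (fun u : R => expR (k * u)) (k * expR (k * t)).
Proof.
have h : is_derive t 1 (fun u : R => k * u) k.
  by apply: is_derive_eq; rewrite /GRing.scale /= mulr1.
have := @is_derive1_comp R expR (fun u : R => k * u) t _ k (is_derive_expR _) h.
by rewrite mulrC.
Qed.

Lemma gronwall f df k a b : a <= b ->
  (forall t, a <= t <= b -> is_derive t 1 f (df t)) ->
  (forall t, a <= t <= b -> df t <= k * f t) ->
  f b <= f a * expR (k * (b - a)).
Proof.
move=> ab fd fk.
have hd t : a <= t <= b -> is_derive t 1 (f * (fun u => expR (- k * u)))
    (expR (- k * t) * df t - k * expR (- k * t) * f t).
  move=> /fd ?; have ? := is_derive_expRM (- k) t.
  by apply: is_derive_eq; rewrite /GRing.scale /=; ring.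
have /(_ (fun=> 0) (fun=> 0)) := derive1_le_incr ab hd.
rewrite subrr => H.
have {H} : (f * (fun u => expR (- k * u))) b - (f * (fun u => expR (- k * u))) a <= 0.
  apply: H => t tab; have := fk _ tab; have := expR_gt0 (- k * t).
  by move: (expR _) => e e0 H; nra.
rewrite subr_le0 -![(f * _) _]/(f _ * expR _) => H.
rewrite -(ler_pM2r (expR_gt0 (- k * b))) -mulrA -expRD.
by rewrite (_ : k * (b - a) + - k * b = - k * a) //; ring.
Qed.

(** Each integration gains a factor [1 / l] for the weight exp(l |t|), on both half-lines at once; a
    large [l] then makes Picard iteration contract on the whole line. *)
Lemma exp_weight_bound f df (c l : R) : 0 < l -> 
  (forall t, is_derive t 1 f (df t)) ->
  (forall t, `|df t| <= c * expR (l * `|t|)) ->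
  forall t, `|f t - f 0| <= c / l * expR (l * `|t|).
Proof.
move=> l0 fd fc t.
have c0 : 0 <= c.
  by have := le_trans (normr_ge0 _) (fc 0); rewrite normr0 mulr0 expR0 mulr1.
have key (h dh : R -> R) : (forall t, is_derive t 1 h (dh t)) ->
    (forall t, 0 <= t -> `|dh t| <= c * expR (l * t)) ->
    forall t, 0 <= t -> `|h t - h 0| <= c / l * expR (l * t).
  move=> hd hc s s0.
  have gd u : 0 <= u <= s -> is_derive u 1 (fun u => c / l * expR (l * u)) (c * expR (l * u)).
    move=> _; have ? := is_derive_expRM l u.
    apply: is_derive_eq; rewrite /GRing.scale /=.
    by field; rewrite gt_eqF.
  have := @derive1_norm_le_incr h _ dh _ 0 s s0 (fun u _ => hd u) gd.
  have hc' u : 0 <= u <= s -> `|dh u| <= c * expR (l * u) by case/andP => /hc.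
  move=> /(_ hc') /le_trans; apply; rewrite gerBl // mulr_ge0 ?expR_ge0 //.
  by rewrite divr_ge0 // ltW.
have [t0|t0] := leP 0 t.
  rewrite (ger0_norm t0); apply: (key f df) => // s s0.
  by have := fc s; rewrite (ger0_norm s0).
have nt0 : 0 <= - t by rewrite oppr_ge0 ltW.
rewrite (ltr0_norm t0).
have := key (fun u => f (- u)) (fun u => - df (- u)) _ _ (- t) nt0.
rewrite opprK oppr0; apply=> [s|s s0]; first exact: is_derive1_opp.
by rewrite normrN; have := fc (- s); rewrite normrN (ger0_norm s0).
Qed.

(** The witness is the supremum of the times up to which [f] stays at most [c]. The value [c] may be
    attained earlier; what matters is that it is not exceeded on the way. *)
Lemma first_hitting f a b c : a <= b -> {within `[a, b], continuous f} ->
  f a <= c -> c <= f b ->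
  exists2 s, a <= s <= b & f s = c /\ forall t, a <= t <= s -> f t <= c.
Proof.
move=> ab fc fac cfb.
pose A := [set t : R | a <= t <= b /\ forall u, a <= u <= t -> f u <= c].
have Aa : A a.
  split; first by rewrite lexx ab.
  by move=> u /andP[au ua]; rewrite (_ : u = a) //; apply/le_anti/andP.
have hA : has_sup A.
  by split; [exists a | exists b => t [/andP[]]].
set s := sup A.
have as_ : a <= s by apply: ub_le_sup => //; case: hA.
have sb : s <= b by apply: ge_sup; [exists a|move=> t [/andP[]]].
have below t : a <= t < s -> f t <= c.
  move=> /andP[at_ ts]; have e0 : 0 < s - t by rewrite subr_gt0.
  have [u [/andP[au ub] uc]] := sup_adherent e0 hA.
  rewrite opprB addrCA subrr addr0 => tu.
  by apply: uc; rewrite at_ ltW.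
have fsc : f s <= c.
  move: as_; rewrite le_eqVlt => /predU1P[<- //|as_].
  rewrite leNgt; apply/negP => cfs.
  have fcs : {within `[a, s], continuous f}.
    by apply: continuous_subspaceW fc => x /=; rewrite !in_itv /= => /andP[-> /le_trans]; apply.
  have fsm : c < (f s + c) / 2 < f s by apply/andP; split; lra.
  have /andP[m1 m2] := fsm.
  have [] := IVT (ltW as_) fcs (v := (f s + c) / 2).
    by rewrite ge_min le_max; rewrite (ltW m2) orbT andbT (le_trans fac (ltW m1)).
  move=> u; rewrite in_itv /= => /andP[au us] fu.
  move: us; rewrite le_eqVlt => /predU1P[us|us]; first by move: m2; rewrite -fu us ltxx.
  by have := below u; rewrite au us fu => /(_ isT); rewrite leNgt m1.
have all_ t : a <= t <= s -> f t <= c.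
  by move=> /andP[at_]; rewrite le_eqVlt => /predU1P[->//|ts]; apply: below; rewrite at_.
exists s; first by rewrite as_.
split => //; apply/le_anti; rewrite fsc /= leNgt; apply/negP => fs.
have sb' : s < b.
  by rewrite lt_neqAle sb andbT; apply/eqP => E; move: fs; rewrite E ltNge cfb.
have fcs : {within `[s, b], continuous f}.
  by apply: continuous_subspaceW fc => x /=; rewrite !in_itv /= => /andP[/(le_trans as_) -> ->].
have [r r0 hr] : exists2 r, s < r <= b & forall t, s <= t <= r -> f t <= c.
  have /(continuous_within_itvP _ sb') [_ + _] := fcs.
  move=> /cvgrPdist_lt /(_ (c - f s)); rewrite subr_gt0 => /(_ fs).
  rewrite /at_right near_withinE => /nbhs_ballP [e /= e0 he].
  pose r := Num.min b (s + e / 2).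
  have sr : s < r by rewrite lt_min sb' /= ltrDl divr_gt0.
  exists r; first by rewrite sr /= ge_min lexx.
  move=> t /andP[]; rewrite le_eqVlt => /predU1P[<- _|st tr]; first exact: ltW.
  have := he t; rewrite /ball /= => /(_ _ st).
  have : `|s - t| < e.
    rewrite distrC ger0_norm ?subr_ge0 ?ltW // ltrBlDl.
    have := le_trans tr (_ : r <= s + e / 2); rewrite ge_min lexx orbT => /(_ isT).
    lra.
  by move=> st_e /(_ st_e); rewrite ltr_norml => /andP[+ _]; lra.
have : A r.
  split; first by case/andP: r0 => /ltW /(le_trans as_) -> ->.
  move=> u /andP[au ur]; have [us|/ltW su] := leP u s; first by apply: all_; rewrite au.
  by apply: hr; rewrite su.
move=> /(ub_le_sup (proj2 hA)); rewrite leNgt -/s; case/andP: r0 => -> //.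
Qed.

(* The maximum of [f] on [[a, b]] cannot be attained before [b], as [f] would be
   strictly convex with a nonnegative derivative there. *)
Lemma convex_growth f df ddf a b : a <= b ->
  (forall t, a <= t <= b -> is_derive t 1 f (df t)) ->
  (forall t, a <= t <= b -> is_derive t 1 df (ddf t)) ->
  (forall t, a <= t <= b -> f a <= f t -> 0 < ddf t) ->
  0 <= df a -> f a <= f b.
Proof.
move=> ab fd dfd pos dfa.
have [s] := EVT_max ab (derive1_within_continuous fd).
rewrite in_itv /= => /andP[as_ sb] smax.
rewrite leNgt; apply/negP => fba.
have fas : f a <= f s by apply: smax; rewrite in_itv /= lexx ab.
have sb' : s < b.
  by rewrite lt_neqAle sb andbT; apply/eqP => E; move: fas; rewrite E leNgt fba.
have sab : a <= s <= b by rewrite as_ sb.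
have dfs : 0 <= df s.
  move: as_; rewrite le_eqVlt => /predU1P[<-//|as_].
  have fds := fd _ sab.
  have D := @derive1_at_max R f a b s (le_trans (ltW as_) sb) _ _ _.
  have : is_derive s 1 f 0.
    apply: D => [t|| t].
    - rewrite in_itv /= => /andP[/ltW a_t /ltW tb].
      by have [] := fd t; rewrite ?a_t.
    - by rewrite in_itv /= as_ sb'.
    - rewrite in_itv /= => /andP[/ltW a_t /ltW tb].
      by apply: smax; rewrite in_itv /= a_t tb.
  by case=> _ E; case: fds => _ <-; rewrite E.
have [r /andP[sr rb] hr] : exists2 r, s < r <= b & forall t, s < t <= r -> 0 < df t.
  have [dd E] := dfd _ sab; have ps := pos _ sab fas.
  have : (h^-1 *: (df (h *: 1 + s) - df s)) @[h --> 0^'] --> ddf s.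
    by rewrite -E; exact: dd.
  move=> /cvgrPdist_lt /(_ _ ps); rewrite /dnbhs near_withinE => /nbhs_ballP [e /= e0 he].
  exists (Num.min b (s + e / 2)).
    by rewrite lt_min sb' /= ltrDl divr_gt0 //= ge_min lexx.
  move=> t /andP[st]; rewrite le_min => /andP[_ te].
  have h0 : 0 < t - s by rewrite subr_gt0.
  have := he (t - s).
  rewrite /ball /= sub0r normrN (gtr0_norm h0) gt_eqF // => /(_ _ isT).
  rewrite /GRing.scale /= mulr1 subrK.
  have -> : t - s < e by lra.
  move=> /(_ isT); rewrite ltr_norml => /andP[_].
  rewrite ltrBlDr ltrDl => H1.
  move: H1; rewrite pmulr_rgt0 ?invr_gt0 //; lra.
have frs : f s < f r.
  have fdr t : s <= t <= r -> is_derive t 1 f (df t).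
    by move=> /andP[st tr]; apply: fd; rewrite (le_trans as_ st) (le_trans tr rb).
  have fdo t : t \in `]s, r[ -> is_derive t 1 f (df t).
    by rewrite in_itv /= => /andP[/ltW st /ltW tr]; apply: fdr; rewrite st tr.
  have [c] := MVT sr fdo (derive1_within_continuous fdr).
  rewrite in_itv /= => /andP[sc cr] E.
  by rewrite -subr_gt0 E mulr_gt0 ?subr_gt0 // hr // sc ltW.
have := smax r; rewrite in_itv /= (le_trans as_ (ltW sr)) rb => /(_ isT).
by rewrite leNgt frs.
Qed.

End RealCalculus.

(** * Row vectors *)

Section RowVectors.
Variables (R : realType) (n : nat).
Implicit Types (x y z : 'rV[R]_n) (c : R).

Lemma coord_le_norm x i : `|x 0 i| <= `|x|.
Proof.
rewrite [leRHS]/Num.Def.normr /= mx_normrE.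
exact: (le_bigmax _ (fun ij : 'I_1 * 'I_n => `|x ij.1 ij.2|) (0, i)).
Qed.

Lemma norm_le_coord x c : 0 <= c -> (forall i, `|x 0 i| <= c) -> `|x| <= c.
Proof.
move=> c0 xc; rewrite [leLHS]/Num.Def.normr /= mx_normrE.
by rewrite bigmax_le // => -[i j] _ /=; rewrite (ord1 i).
Qed.

Lemma dotC x y : dot x y = dot y x.
Proof. by apply: eq_bigr => i _; rewrite mulrC. Qed.

Lemma dotDl x y z : dot (x + y) z = dot x z + dot y z.
Proof. by rewrite -big_split; apply: eq_bigr => i _; rewrite mxE mulrDl. Qed.

Lemma dotZl c x y : dot (c *: x) y = c * dot x y.
Proof. by rewrite mulr_sumr; apply: eq_bigr => i _; rewrite mxE mulrA. Qed.

Lemma dotNl x y : dot (- x) y = - dot x y.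
Proof. by rewrite -scaleN1r dotZl mulN1r. Qed.

Lemma dotBl x y z : dot (x - y) z = dot x z - dot y z.
Proof. by rewrite dotDl dotNl. Qed.

Lemma dotDr x y z : dot z (x + y) = dot z x + dot z y.
Proof. by rewrite !(dotC z) dotDl. Qed.

Lemma dotZr c x y : dot y (c *: x) = c * dot y x.
Proof. by rewrite !(dotC y) dotZl. Qed.

Lemma dotNr x y : dot y (- x) = - dot y x.
Proof. by rewrite !(dotC y) dotNl. Qed.

Lemma dotBr x y z : dot z (x - y) = dot z x - dot z y.
Proof. by rewrite !(dotC z) dotBl. Qed.

Lemma dot0l x : dot 0 x = 0.
Proof. by rewrite -(scale0r 0) dotZl mul0r. Qed.

Lemma dot0r x : dot x 0 = 0.
Proof. by rewrite dotC dot0l. Qed.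

Lemma dotxx_ge0 x : 0 <= dot x x.
Proof. by apply: sumr_ge0 => i _; rewrite -expr2 sqr_ge0. Qed.

Lemma norm_dot_le x y : `|dot x y| <= n%:R * `|x| * `|y|.
Proof.
apply: (le_trans (ler_norm_sum _ _ _)).
rewrite -mulrA mulr_natl -[X in _ *+ X]card_ord -sumr_const ler_sum // => i _.
by rewrite normrM ler_pM ?coord_le_norm.
Qed.

Lemma dotxx_le x : dot x x <= n%:R * `|x| ^+ 2.
Proof. by rewrite expr2 mulrA; apply: le_trans (norm_dot_le x x); exact: ler_norm. Qed.

Lemma coord_sq_le_dot x i : x 0 i ^+ 2 <= dot x x.
Proof.
rewrite /dot (bigD1 i) //= -expr2 lerDl sumr_ge0 // => j _.
by rewrite -expr2 sqr_ge0.
Qed.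

Lemma norm_sq_le_dot x : `|x| ^+ 2 <= dot x x.
Proof.
rewrite -(sqr_sqrtr (dotxx_ge0 x)) ler_sqr ?nnegrE ?sqrtr_ge0 //.
apply: norm_le_coord => [|i]; rewrite ?sqrtr_ge0 //.
by rewrite -sqrtr_sqr ler_wsqrtr // coord_sq_le_dot.
Qed.

Lemma norm_le_dot x c : 0 <= c -> dot x x <= c ^+ 2 -> `|x| <= c.
Proof.
move=> c0 xc; rewrite -ler_sqr ?nnegrE //.
exact: le_trans (norm_sq_le_dot x) xc.
Qed.

Lemma dotxx_eq0 x : dot x x = 0 -> x = 0.
Proof.
move=> x0; apply/eqP; rewrite -normr_le0; apply: norm_le_dot => //.
by rewrite x0 expr0n.
Qed.

Lemma enorm_sqr x : enorm x ^+ 2 = dot x x.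
Proof. by rewrite sqr_sqrtr // dotxx_ge0. Qed.

End RowVectors.

(** The two sequences are approximated along common indices. They are positions and velocities, or,
    with [m = 1], total times and initial velocities. *)
Lemma bounded_cluster (R : realType) m k (u : nat -> 'rV[R]_m)
    (w : nat -> 'rV[R]_k) (M : R) :
  (forall j, `|u j| <= M) -> (forall j, `|w j| <= M) ->
  exists p q, forall (e : R) N, 0 < e ->
    exists j, [/\ (N <= j)%N, `|u j - p| < e & `|w j - q| < e].
Proof.
move=> uM wM.
have cpt d : compact [set x : 'rV[R]_d | `|x| <= M].
  apply: bounded_closed_compact.
    by exists M; split; [exact: num_real | move=> r Mr x /= xM; exact: le_trans xM (ltW Mr)].
  by apply: (@closed_comp _ _ (fun x : 'rV[R]_d => `|x|) [set r : R | r <= M]);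
    [move=> x _; exact: norm_continuous | exact: closed_le].
have /(_ ((fun j => (u j, w j)) @ \oo) _ _) := @compact_setX _ _ _ _ (cpt m) (cpt k).
case.
  by exists 0%N => // j _ /=; split; [exact: uM | exact: wM].
move=> [p q] [_ clu]; exists p, q => e N e0.
have [] := clu [set z | exists2 j, (N <= j)%N & z = (u j, w j)] (ball (p, q) e).
- by exists N => // j /= Nj; exists j.
- exact: nbhsx_ballx.
move=> z [[j Nj ->]] [/= b1 b2]; exists j; split => //.
  by move: b1; rewrite -ball_normE /= distrC.
by move: b2; rewrite -ball_normE /= distrC.
Qed.

(** * Partial derivatives *)

Section PartialDerivatives.
Variables (R : realType) (n : nat).
Implicit Types (f : 'rV[R]_n -> R) (x y w : 'rV[R]_n) (i j : 'I_n) (s : R).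

Let e i : 'rV[R]_n := delta_mx 0 i.

Lemma is_derive_line f x (v : 'rV[R]_n) s d : is_derive (x + s *: v) v f d ->
  is_derive s 1 (fun h : R => f (x + h *: v)) d.
Proof.
move=> [fd fE].
have E : (fun h : R => h^-1 *: ((fun h : R => f (x + h *: v)) (h *: 1 + s) - f (x + s *: v)))
    = (fun h : R => h^-1 *: (f (h *: v + (x + s *: v)) - f (x + s *: v))).
  apply/funext => h; congr (_ *: (f _ - _)).
  by rewrite [h *: 1]mulr1 scalerDl addrCA.
apply: DeriveDef; first by rewrite /derivable E.
by rewrite /derive E.
Qed.

Lemma is_derive_coord_line f x i c s d :
  is_derive (x + (c * s) *: e i) (e i) f d ->
  is_derive s 1 (fun h : R => f (x + (c * h) *: e i)) (c * d).
Proof.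
move=> fd; have h : is_derive s 1 (fun u : R => c * u) c.
  by apply: is_derive_eq; rewrite /GRing.scale /= mulr1.
have := @is_derive1_comp R (fun u : R => f (x + u *: e i)) (fun u : R => c * u) s d c
  (is_derive_line fd) h.
by rewrite [d * c]mulrC.
Qed.

Lemma is_derive_dotr (a w : 'rV[R]_n) i : is_derive w (e i) (dot a) (a 0 i).
Proof.
have E : (fun h : R => h^-1 *: (dot a (h *: e i + w) - dot a w)) @ 0^' --> a 0 i.
  apply: (@cvg_trans _ ((fun=> a 0 i) @ (0 : R)^')); last exact: cvg_cst.
  apply: near_eq_cvg; near=> h.
  rewrite dotDr dotZr addrK /GRing.scale /= mulKf; last by near: h; exact: nbhs_dnbhs_neq.
  rewrite /dot (bigD1 i) //= mxE !eqxx mulr1 big1 ?addr0 // => j ji.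
  by rewrite mxE (negPf ji) andbF mulr0.
apply: DeriveDef; first by apply/cvg_ex; exists (a 0 i).
exact/cvg_lim.
Unshelve. all: by end_near. Qed.

Lemma norm_delta_le i : `|e i| <= 1.
Proof.
apply: norm_le_coord => // k; rewrite mxE eqxx /=.
by case: eqP => _; rewrite ?normr1 ?normr0.
Qed.

(** Only partial derivatives are at hand, so [x] is joined to [y] by a path parallel to the axes.
    Each coordinate on it lies between those of [x] and [y], so the path stays in the sup-norm ball
    where [df] is bounded. *)
Lemma box_lipschitz f (df : 'I_n -> 'rV[R]_n -> R) x y (B : R) :
  (forall w i, is_derive w (e i) f (df i w)) ->
  (forall w i, `|w - x| <= `|y - x| -> `|df i w| <= B) ->
  `|f y - f x| <= B * n%:R * `|y - x|.
Proof.
move=> fd fB.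
(* The vertices of the path: the first [k] coordinates have already been moved to those of [y]. *)
pose z k : 'rV[R]_n := \row_i (if (i < k)%N then y 0 i else x 0 i).
have z0 : z 0%N = x by apply/rowP => i; rewrite mxE.
have zn : z n = y by apply/rowP => i; rewrite mxE ltn_ord.
have -> : f y - f x = \sum_(0 <= k < n) (f (z k.+1) - f (z k)).
  by rewrite telescope_sumr // z0 zn.
rewrite big_mkord; apply: (le_trans (ler_norm_sum _ _ _)).
rewrite mulrAC -[n in n%:R]card_ord mulr_natr -sumr_const ler_sum // => k _.
set c := y 0 k - x 0 k.
have zS : z k.+1 = z k + (c * 1) *: e k.
  apply/rowP => i; rewrite !mxE eqxx /= mulr1.
  have [->|ik] := eqVneq i k; first by rewrite ltnSn ltnn mulr1 /c addrCA subrr addr0.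
  by rewrite mulr0 addr0 ltnS leq_eqVlt (negPf (ik : val i != val k)).
have zk : z k = z k + (c * 0) *: e k by rewrite mulr0 scale0r addr0.
rewrite zS [X in f (z k + _) - f X]zk.
have cle : `|c| <= `|y - x|.
  by rewrite (_ : c = (y - x) 0 k) ?coord_le_norm // !mxE.
have fdc s : 0 <= s <= 1 -> is_derive s 1 (fun h => f (z k + (c * h) *: e k))
  (c * df k (z k + (c * s) *: e k)) by move=> _; exact: is_derive_coord_line.
suff fB' s : 0 <= s <= 1 -> `|c * df k (z k + (c * s) *: e k)| <= B * `|y - x|.
  by have := derive1_norm_le_const ler01 fdc fB'; rewrite subr0 [leRHS]mulr1.
move=> /andP[s0 s1].
rewrite normrM mulrC; apply: ler_pM => //; apply: fB.
apply: norm_le_coord => // i; rewrite !mxE eqxx /=.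
have [->|ik] := eqVneq i k.
  rewrite ltnn mulr1 addrAC subrr add0r normrM (ger0_norm s0).
  by apply: le_trans cle; rewrite ler_piMr.
rewrite mulr0 addr0; case: ifP => _; last by rewrite subrr normr0.
by rewrite (_ : y 0 i - x 0 i = (y - x) 0 i) ?coord_le_norm // !mxE.
Qed.

(** Two applications of the mean value theorem. The left-hand side is symmetric in [i] and [j],
    which is the source of [partialC]. *)
Lemma mixed_difference f x i j s : 0 < s ->
  (forall w, derivable f w (e i)) ->
  (forall w, derivable (partial i f) w (e j)) ->
  exists2 y, `|y - x| <= 2 * s &
    f (x + s *: e i + s *: e j) - f (x + s *: e i) - f (x + s *: e j) + f x =
    s ^+ 2 * partial j (partial i f) y.
Proof.
move=> s0 fi fij.
pose phi := (fun h : R => f (x + s *: e j + h *: e i)) - (fun h : R => f (x + h *: e i)).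
pose dphi h := partial i f (x + s *: e j + h *: e i) - partial i f (x + h *: e i).
have phid t : 0 <= t <= s -> is_derive t 1 phi (dphi t).
  move=> _; apply: is_deriveB; apply: is_derive_line; exact: derivableP.
have phid' t : t \in `]0, s[ -> is_derive t 1 phi (dphi t).
  by rewrite in_itv /= => /andP[/ltW t0 /ltW ts]; apply: phid; rewrite t0 ts.
have [r] := MVT s0 phid' (derive1_within_continuous phid).
rewrite in_itv /= subr0 => /andP[r0 rs] E1.
pose psi h := partial i f (x + r *: e i + h *: e j).
have psid t : 0 <= t <= s ->
    is_derive t 1 psi (partial j (partial i f) (x + r *: e i + t *: e j)).
  by move=> _; apply: is_derive_line; exact: derivableP.
have psid' t : t \in `]0, s[ ->
    is_derive t 1 psi (partial j (partial i f) (x + r *: e i + t *: e j)).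
  by rewrite in_itv /= => /andP[/ltW t0 /ltW ts]; apply: psid; rewrite t0 ts.
have [q] := MVT s0 psid' (derive1_within_continuous psid).
rewrite in_itv /= subr0 => /andP[q0 qs] E2.
exists (x + r *: e i + q *: e j).
  rewrite [_ - x]addrC !addrA addNr add0r; apply: (le_trans (ler_normD _ _)).
  rewrite !normrZ (gtr0_norm r0) (gtr0_norm q0) mulr_natl mulr2n.
  by apply: lerD; apply: (@le_trans _ _ (s * 1)); rewrite ?mulr1 // -[leRHS]mulr1 ler_pM ?norm_delta_le // ltW.
rewrite expr2 -mulrA [s * partial _ _ _]mulrC -E2 mulrC.
have -> : psi s - psi 0 = dphi r.
  by rewrite /psi /dphi scale0r addr0 addrAC.
rewrite -E1 -[phi s]/(_ - _) -[phi 0]/(_ - _) !scale0r !addr0.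
rewrite [x + s *: e i + _]addrAC.
by rewrite opprB addrA [RHS]addrAC.
Qed.

Lemma partialC f x i j :
  (forall w, derivable f w (e i)) -> (forall w, derivable f w (e j)) ->
  (forall w, derivable (partial i f) w (e j)) ->
  (forall w, derivable (partial j f) w (e i)) ->
  {for x, continuous (partial j (partial i f))} ->
  {for x, continuous (partial i (partial j f))} ->
  partial j (partial i f) x = partial i (partial j f) x.
Proof.
move=> fi fj fij fji cij cji; apply/eqP; rewrite -subr_eq0 -normr_le0.
apply/ler_addgt0Pl => d d0; rewrite addr0.
have d20 : 0 < d / 2 by rewrite divr_gt0.
move: cij cji => /cvgrPdist_lt /(_ _ d20) /nbhs_ballP[r1 /= r10 H1].
move=> /cvgrPdist_lt /(_ _ d20) /nbhs_ballP[r2 /= r20 H2].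
pose s := Num.min r1 r2 / 3.
have m0 : 0 < Num.min r1 r2 by rewrite lt_min r10 r20.
have s0 : 0 < s by rewrite divr_gt0.
have lt1 y : `|y - x| <= 2 * s -> `|x - y| < Num.min r1 r2.
  rewrite distrC => /le_lt_trans; apply; rewrite /s.
  by move: (Num.min r1 r2) m0 => m; clear; lra.
have [y1 y1x E1] := mixed_difference x s0 fi fij.
have [y2 y2x E2] := mixed_difference x s0 fj fji.
have E : partial j (partial i f) y1 = partial i (partial j f) y2.
  apply: (@mulfI _ (s ^+ 2)); first by rewrite expf_neq0 // gt_eqF.
  apply: etrans (esym E1) (etrans _ E2); rewrite [x + s *: e i + _]addrAC.
  by congr (_ + _); rewrite -!addrA; congr (_ + _); rewrite addrC.
have /H1 /ltW b1 : ball x r1 y1.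
  by rewrite -ball_normE /=; have := lt1 _ y1x; rewrite lt_min => /andP[].
have /H2 /ltW b2 : ball x r2 y2.
  by rewrite -ball_normE /=; have := lt1 _ y2x; rewrite lt_min => /andP[].
move: b1 b2; rewrite E; move: (partial i (partial j f) y2) (partial j (partial i f) x).
move: (partial i (partial j f) x) => q2 p q1 b1 b2.
clear -b1 b2.
rewrite (_ : q1 - q2 = (q1 - p) - (q2 - p)); last ring.
by apply: (le_trans (ler_normB _ _)); lra.
Qed.

End PartialDerivatives.

(** * Multi-index derivatives of order at most two *)

Section MultiIndex.
Variables (R : realType) (n : nat) (V : 'rV[R]_n -> R).

Let step (a : 'I_n -> nat) := fun i (g : 'rV[R]_n -> R) => iter (a i) (partial i) g.

Lemma foldr_step_id a s f : {in s, forall k, a k = 0%N} -> foldr (step a) f s = f.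
Proof.
elim: s => //= k s IH as0; rewrite {1}/step as0 ?mem_head //= IH // => j js.
by apply: as0; rewrite inE js orbT.
Qed.

Lemma mpartial0 : mpartial (fun _ => 0%N) V = V.
Proof. exact: foldr_step_id. Qed.

Lemma mpartial1 i : mpartial (fun k => (k == i) : nat) V = partial i V.
Proof.
rewrite /mpartial; have : i \in enum 'I_n by rewrite mem_enum.
have := enum_uniq 'I_n; move: (enum 'I_n) => s + /path.splitPr E.
case: E => s1 s2; rewrite cat_uniq /= => /and3P[_ /norP[is1 _] /andP[is2 _]].
rewrite foldr_cat /= (@foldr_step_id _ s2) ?eqxx /=; last first.
  by move=> k ks; case: eqP ks is2 => // -> ->.
rewrite foldr_step_id // => k ks.
by case: eqP ks is1 => // -> ->.
Qed.

(** [mpartial] differentiates in the order of the enumeration, so commutation is called for when [j]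
    comes before [i]. *)
Lemma mpartial2 i j : (forall k l, partial k (partial l V) = partial l (partial k V)) ->
  mpartial (fun k => (k == i) + (k == j))%N V = partial i (partial j V).
Proof.
move=> C; rewrite /mpartial; have : i \in enum 'I_n by rewrite mem_enum.
have := enum_uniq 'I_n.
have jE : j \in enum 'I_n by rewrite mem_enum.
move: (enum 'I_n) jE => s jE + /path.splitPr E.
case: E jE => s1 s2; rewrite mem_cat inE orbCA => jE.
rewrite cat_uniq /= => /and3P[u1 /norP[is1 dis] /andP[is2 u2]].
have [ij|ij] := eqVneq j i.
  subst j.
  rewrite foldr_cat /= (@foldr_step_id _ s2) ?eqxx /=; last first.
    by move=> k ks; case: eqP ks is2 => // -> ->.
  rewrite foldr_step_id // => k ks.
  by case: eqP ks is1 => // -> ->.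
move: jE; rewrite (negPf ij) /= => /orP[] js; move: js.
- move=> js1; case/path.splitPr: js1 u1 is1 dis => s3 s4.
  rewrite cat_uniq /= => /and3P[_ /norP[j3 _] /andP[j4 _]].
  rewrite mem_cat inE !negb_or => /and3P[i3 _ i4] /hasPn dis.
  have j2 : j \notin s2.
    by apply/negP => /dis; rewrite /= mem_cat mem_head orbT.
  rewrite !foldr_cat /= (@foldr_step_id _ s2); last first.
    move=> k ks; case: eqP => [kE|_]; first by rewrite -kE ks in is2.
    by case: eqP => [kE|//]; rewrite -kE ks in j2.
  rewrite (@foldr_step_id _ s4); last first.
    move=> k ks; case: eqP => [kE|_]; first by rewrite -kE ks in i4.
    by case: eqP => [kE|//]; rewrite -kE ks in j4.
  rewrite foldr_step_id; last first.
    move=> k ks; case: eqP => [kE|_]; first by rewrite -kE ks in i3.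
    by case: eqP => [kE|//]; rewrite -kE ks in j3.
  by rewrite !eqxx (negPf ij) eq_sym (negPf ij) /= C.
- move=> js2; case/path.splitPr: js2 u2 is2 dis => s3 s4.
  rewrite cat_uniq /= => /and3P[_ /norP[j3 _] /andP[j4 _]].
  rewrite mem_cat inE !negb_or => /and3P[i3 _ i4] /hasPn dis.
  have j1 : j \notin s1.
    by have := dis j; rewrite mem_cat mem_head orbT => /(_ isT).
  rewrite !foldr_cat /= foldr_cat /= (@foldr_step_id _ s4); last first.
    move=> k ks; case: eqP => [kE|_]; first by rewrite -kE ks in i4.
    by case: eqP => [kE|//]; rewrite -kE ks in j4.
  rewrite (@foldr_step_id _ s3); last first.
    move=> k ks; case: eqP => [kE|_]; first by rewrite -kE ks in i3.
    by case: eqP => [kE|//]; rewrite -kE ks in j3.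
  rewrite foldr_step_id; last first.
    move=> k ks; case: eqP => [kE|_]; first by rewrite -kE ks in is1.
    by case: eqP => [kE|//]; rewrite -kE ks in j1.
  by rewrite !eqxx (negPf ij) eq_sym (negPf ij) /=.
Qed.

End MultiIndex.

(** * Potentials with Lipschitz gradient *)

Section Potentials.
Variables (R : realType) (n : nat).
Implicit Types (f : 'rV[R]_n -> R) (G : 'rV[R]_n -> 'rV[R]_n) (x y : 'rV[R]_n).

(** The Taylor bound identifies [G] as the gradient of [f] without mentioning derivatives. This
    class is stable under [f |-> E - f] and under capping, which does not preserve smoothness. *)
Definition lipschitz_gradient f G (B : R) :=
  0 < B /\ [/\ forall x y, `|G x - G y| <= B * `|x - y|,
      forall x y, `|f y - f x - dot (G x) (y - x)| <= B * `|y - x| ^+ 2,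
      forall x, `|f x| <= B & forall x, `|G x| <= B].

Lemma is_derive1_squeeze0 (r q : R -> R) (t : R) :
  (forall s, `|r s - r t| <= q s) -> q t = 0 -> is_derive t 1 q 0 ->
  is_derive t 1 r 0.
Proof.
move=> rq qt [qd qE].
have qc : (h^-1 *: (q (h *: 1 + t) - q t)) @[h --> 0^'] --> ('D_1 q t : R).
  exact: qd.
rewrite qE in qc.
have rc : (h^-1 *: (r (h *: 1 + t) - r t)) @[h --> 0^'] --> (0 : R).
  apply/cvgrPdist_le => e e0; move/cvgrPdist_le : qc => /(_ _ e0); apply: filterS => h.
  rewrite !sub0r !normrN qt subr0; apply: le_trans.
  rewrite !normrZ ler_wpM2l //; apply: le_trans (rq _) _; exact: ler_norm.
apply: DeriveDef; first by apply/cvg_ex; exists (0 : R).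
exact/cvg_lim.
Qed.

Lemma is_derive_dot (x y : R -> 'rV[R]_n) (dx dy : 'rV[R]_n) (t : R) :
  (forall i, is_derive t 1 (fun s => x s 0 i) (dx 0 i)) ->
  (forall i, is_derive t 1 (fun s => y s 0 i) (dy 0 i)) ->
  is_derive t 1 (fun s => dot (x s) (y s)) (dot dx (y t) + dot (x t) dy).
Proof.
move=> xd yd.
have -> : (fun s => dot (x s) (y s)) = \sum_(i < n) ((fun s => x s 0 i) * (fun s => y s 0 i)).
  by apply/funext => s; rewrite fct_sumE.
have -> : dot dx (y t) + dot (x t) dy =
    \sum_(i < n) (x t 0 i *: dy 0 i + y t 0 i *: dx 0 i).
  by rewrite -big_split; apply: eq_bigr => i _; rewrite /GRing.scale /= addrC [dx 0 i * _]mulrC.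
by apply: is_derive_sum => i; exact: is_deriveM.
Qed.

(** Chain rule from the Taylor bound: the remainder is dominated by
    [B * dot (x s - x t) (x s - x t)], whose derivative at [s = t] vanishes. *)
Lemma is_derive_potential f G (B : R) (x : R -> 'rV[R]_n) (dx : 'rV[R]_n) (t : R) :
  lipschitz_gradient f G B ->
  (forall i, is_derive t 1 (fun s => x s 0 i) (dx 0 i)) ->
  is_derive t 1 (fun s => f (x s)) (dot (G (x t)) dx).
Proof.
move=> [B0 [_ fG _ _]] xd.
have dd : is_derive t 1 (fun s => dot (G (x t)) (x s)) (dot (G (x t)) dx).
  have := @is_derive_dot (fun=> G (x t)) x 0 dx t _ xd.
  by rewrite dot0l add0r; apply => i; rewrite mxE; exact: is_derive_cst.
have sub i : is_derive t 1 (fun s => (x s - x t) 0 i) (dx 0 i).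
  have -> : (fun s => (x s - x t) 0 i) = (fun s => x s 0 i) - cst (x t 0 i).
    by apply/funext => s; rewrite !mxE.
  by have := is_deriveB (xd i) (is_derive_cst (x t 0 i) t 1); rewrite subr0.
have qd := is_derive_dot sub sub.
have qd0 : is_derive t 1 (fun s => B * dot (x s - x t) (x s - x t)) 0.
  have := @is_deriveZ _ _ _ _ B _ _ _ qd.
  by rewrite subrr dot0l dot0r addr0 scaler0.
have rd : is_derive t 1 ((fun s => f (x s)) - (fun s => dot (G (x t)) (x s))) 0.
  apply: is_derive1_squeeze0 qd0; last by rewrite subrr dot0l mulr0.
  move=> s.
  rewrite (_ : _ - _ = f (x s) - f (x t) - dot (G (x t)) (x s - x t)); last first.
    rewrite dotBr -[LHS]/(f (x s) - dot (G (x t)) (x s) - (f (x t) - dot (G (x t)) (x t))).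
    by move: (f _) (f _) (dot _ _) (dot _ _) => a b c d; clear; ring.
  by apply: (le_trans (fG _ _)); rewrite ler_pM2l // norm_sq_le_dot.
have := is_deriveD rd dd; rewrite add0r.
by rewrite (_ : _ - _ + _ = (fun s => f (x s))) // subrK.
Qed.


Lemma finite_bound (I : finType) (P : I -> R -> Prop) :
  (forall i c d, c <= d -> P i c -> P i d) ->
  (forall i, exists c, P i c) -> exists2 c, 0 < c & forall i, P i c.
Proof.
move=> mono /choice[c Pc]; exists (1 + \sum_i `|c i|).
  by apply: ltr_pwDl => //; apply: sumr_ge0.
move=> i; apply: mono (Pc i); rewrite (bigD1 i) //=.
apply: le_trans (ler_norm _) _; rewrite addrCA lerDl addr_ge0 //.
exact: sumr_ge0.
Qed.

Lemma jap_ge1 x : 1 <= jap x.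
Proof. by rewrite -[leLHS]sqrtr1 ler_wsqrtr // lerDl enorm_sqr dotxx_ge0. Qed.

Lemma jap_gt0 x : 0 < jap x.
Proof. exact: lt_le_trans ltr01 (jap_ge1 x). Qed.

Lemma jap_sqr x : jap x ^+ 2 = 1 + dot x x.
Proof. by rewrite sqr_sqrtr enorm_sqr // addr_ge0 // dotxx_ge0. Qed.

Lemma norm_le_jap x : `|x| <= jap x.
Proof. by apply: norm_le_dot; [exact: ltW (jap_gt0 x)|rewrite jap_sqr lerDr]. Qed.

Variables (V : 'rV[R]_n -> R).

Lemma smooth_partialC : smooth V ->
  forall i j x, partial i (partial j V) x = partial j (partial i V) x.
Proof.
move=> sV i j x.
by apply: partialC => [w|w|w|w||];
  [exact: (sV [::]).2|exact: (sV [::]).2|exact: (sV [:: j]).2|exact: (sV [:: i]).2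
  |exact: (sV [:: i; j]).1|exact: (sV [:: j; i]).1].
Qed.

Lemma assumption_A1_decay : assumption_A1 V ->
  exists rho C : R, [/\ 1 < rho, 0 < C,
    forall x, `|V x| <= C * jap x `^ (- rho),
    forall x i, `|partial i V x| <= C * jap x `^ (- rho - 1) &
    forall x i j, `|partial i (partial j V) x| <= C].
Proof.
move=> [sV [rho [rho1 hA]]].
have C2 k l : partial k (partial l V) = partial l (partial k V).
  by apply/funext => x; exact: smooth_partialC.
have mono x (c d e : R) : c <= d -> c * jap x `^ e <= d * jap x `^ e.
  by move=> cd; rewrite ler_wpM2r // powR_ge0.
(* The index type [unit] serves to obtain a positive constant from [finite_bound]. *)
have [c0 c0_gt0 H0] : exists2 c, 0 < c & forall i : unit, forall x, `|V x| <= c * jap x `^ (- rho).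
  apply: finite_bound => [_ c d cd H x|_]; first exact: le_trans (H x) (mono _ _ _ _ cd).
  have [c H] := hA (fun=> 0%N); exists c => x; move: (H x).
  by rewrite mpartial0 big1 // subr0.
have [c1 c1_gt0 H1] : exists2 c, 0 < c & forall i, forall x, `|partial i V x| <= c * jap x `^ (- rho - 1).
  apply: finite_bound => [i c d cd H x|i]; first exact: le_trans (H x) (mono _ _ _ _ cd).
  have [c H] := hA (fun k => (k == i) : nat); exists c => x; move: (H x).
  by rewrite mpartial1 (bigD1 i) //= eqxx big1 // => k /negPf ->.
have [c2 c2_gt0 H2] : exists2 c, 0 < c & forall ij : 'I_n * 'I_n, forall x,
    `|partial ij.1 (partial ij.2 V) x| <= c * jap x `^ (- rho - 2).
  apply: finite_bound => [i c d cd H x|[i j]]; first exact: le_trans (H x) (mono _ _ _ _ cd).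
  have [c H] := hA (fun k => (k == i) + (k == j))%N; exists c => x; move: (H x).
  rewrite mpartial2 // big_split /= (bigD1 i) //= eqxx big1 => [|k /negPf -> //].
  by rewrite (bigD1 j) //= eqxx big1 // => k /negPf ->.
exists rho, (c0 + c1 + c2); split => //.
- by rewrite !addr_gt0.
- by move=> x; apply: le_trans (H0 tt x) (mono _ _ _ _ _); lra.
- by move=> x i; apply: le_trans (H1 i x) (mono _ _ _ _ _); lra.
move=> x i j; apply: le_trans (H2 (i, j) x) _ => /=.
apply: (@le_trans _ _ (c2 * 1)); last lra.
rewrite ler_wpM2l ?(ltW c2_gt0) // -[leRHS](powRr0 (jap x)); apply: ler_powR; first exact: jap_ge1.
lra.
Qed.

Lemma hessian_bound_lipschitz_gradient (B : R) : smooth V -> 0 < B ->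
  (forall x, `|V x| <= B) -> (forall x i, `|partial i V x| <= B) ->
  (forall x i j, `|partial i (partial j V) x| <= B) ->
  exists C, lipschitz_gradient V (grad V) C.
Proof.
move=> sV B0 VB dVB ddVB; pose N : R := n%:R.
have N0 : 0 <= N by exact: ler0n.
have lip x y i : `|partial i V y - partial i V x| <= B * N * `|y - x|.
  apply: (@box_lipschitz _ _ _ (fun j => partial j (partial i V))) => [w j|w j _].
    exact/derivableP/((sV [:: i]).2).
  exact: ddVB.
have BN0 : 0 <= B * N by rewrite mulr_ge0 // ltW.
have BNN0 : 0 <= B * N * N by rewrite mulr_ge0.
exists (B + B * N + B * N * N).
have mono (c d e : R) : c <= d -> 0 <= e -> c * e <= d * e.
  by move=> cd e0; rewrite ler_wpM2r.
split; first by clear -B0 BN0 BNN0; lra.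
split=> [x y|x y|x|x].
- apply: norm_le_coord => [|i]; first by rewrite mulr_ge0 //; clear -B0 BN0 BNN0; lra.
  rewrite !mxE; apply: le_trans (lip _ _ _) (mono _ _ _ _ _) => //.
  by clear -B0 BN0 BNN0; lra.
(* Taylor bound: [box_lipschitz] is applied to [V] minus its linear part at [x], whose partial
   derivatives are O(|y - x|) on the box. *)
- have D w i : is_derive w (delta_mx 0 i) (V - dot (grad V x)) (partial i V w - partial i V x).
    have ? : is_derive w (delta_mx 0 i) V (partial i V w) by exact/derivableP/((sV [::]).2).
    have := is_derive_dotr (grad V x) w i; rewrite mxE => ?.
    exact: is_deriveB.
  have BD w i : `|w - x| <= `|y - x| -> `|partial i V w - partial i V x| <= B * N * `|y - x|.
    by move=> wy; apply: le_trans (lip _ _ _) _; rewrite ler_wpM2l.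
  have := box_lipschitz D BD.
  rewrite -![(V - _) _]/(V _ - dot _ _) dotBr.
  rewrite (_ : V y - dot (grad V x) y - (V x - dot (grad V x) x) =
     V y - V x - (dot (grad V x) y - dot (grad V x) x)); last first.
    by move: (V _) (V _) (dot _ _) (dot _ _) => a b c d; clear; ring.
  rewrite -/N (_ : B * N * `|y - x| * N * `|y - x| = B * N * N * `|y - x| ^+ 2); last first.
    by clear; ring.
  move=> /le_trans; apply.
  by apply: mono; rewrite ?exprn_ge0 //; clear -B0 BN0 BNN0; lra.
- by apply: le_trans (VB x) _; clear -B0 BN0 BNN0; lra.
- apply: norm_le_coord => [|i]; first by clear -B0 BN0 BNN0; lra.
  by rewrite mxE; apply: le_trans (dVB x i) _; clear -B0 BN0 BNN0; lra.
Qed.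

Lemma assumption_A1_lipschitz : assumption_A1 V ->
  exists C, lipschitz_gradient V (grad V) C.
Proof.
move=> hA; have [rho [C [rho1 C0 h0 h1 h2]]] := assumption_A1_decay hA.
have le_one x e : e <= 0 -> C * jap x `^ e <= C.
  move=> e0; rewrite ger_pMr // -[leRHS](powRr0 (jap x)); apply: ler_powR => //.
  exact: jap_ge1.
apply: (hessian_bound_lipschitz_gradient hA.1 C0) => // [x|x i].
  by apply: le_trans (h0 x) (le_one _ _ _); lra.
by apply: le_trans (h1 x i) (le_one _ _ _); lra.
Qed.

(** The bound on [dot x (grad V x)] is there for the virial identity: along a trajectory the second
    derivative of |x|^2 is 2 (|v|^2 - x . grad V). *)
Lemma assumption_A1_far_field (e : R) : assumption_A1 V -> 0 < e ->
  exists2 r, 0 < r & forall x, r ^+ 2 <= dot x x ->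
    `|V x| <= e /\ `|dot x (grad V x)| <= e.
Proof.
move=> hA e0; have [rho [C [rho1 C0 h0 h1 _]]] := assumption_A1_decay hA.
pose N : R := n%:R + 1.
have N1 : 1 <= N by rewrite lerDr ler0n.
have N0 : 0 < N by exact: lt_le_trans ltr01 N1.
exists (N * C / e); first by rewrite !mulr_gt0 ?invr_gt0.
move=> x xr.
have jr : N * C / e <= jap x.
  rewrite -ler_sqr ?nnegrE ?(ltW (jap_gt0 x)) ?divr_ge0 ?mulr_ge0 ?(ltW N0) ?(ltW C0) ?(ltW e0) // jap_sqr.
  by apply: le_trans xr _; rewrite lerDr.
have key : N * (C * jap x `^ (- rho)) <= e.
  apply: (@le_trans _ _ (N * (C * jap x `^ (- 1)))).
    rewrite !ler_pM2l //; apply: ler_powR; [exact: jap_ge1|lra].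
  rewrite powR_inv1 ?(ltW (jap_gt0 x)) // mulrA ler_pdivrMr ?jap_gt0 //.
  by move: jr; rewrite ler_pdivrMr // [jap x * e]mulrC.
split.
  apply: le_trans (h0 x) (le_trans _ key); rewrite ler_peMl // mulr_ge0 ?powR_ge0 //.
  exact: ltW.
apply: le_trans (norm_dot_le _ _) (le_trans _ key).
have gx : `|grad V x| <= C * jap x `^ (- rho - 1).
  apply: norm_le_coord => [|i]; first by rewrite mulr_ge0 ?powR_ge0 // ltW.
  by rewrite mxE h1.
apply: (@le_trans _ _ (N * (jap x * (C * jap x `^ (- rho - 1))))).
  rewrite -mulrA; apply: ler_pM; rewrite ?mulr_ge0 //; first by rewrite lerDl.
  by apply: ler_pM => //; exact: norm_le_jap.
rewrite ler_pM2l // mulrCA ler_pM2l // -{1}(powRr1 (ltW (jap_gt0 x))).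
by rewrite -powRD; [rewrite addrCA subrr addr0|rewrite (gt_eqF (jap_gt0 x)) implybT].
Qed.

End Potentials.

(** * Primitives *)

Section Primitive.
Variable R : realType.

(** Integrals from [- N] are primitives on bounded windows only. Two of them differ by a constant on
    the smaller window, so normalising them at 0 glues them together. *)
Lemma continuous_primitive (f : R -> R) : continuous f ->
  exists2 F : R -> R, F 0 = 0 & forall t : R, is_derive t (1 : R) F (f t).
Proof.
move=> fc.
pose P (N x : R) := (\int[@lebesgue_measure R]_(t in `[- N, x]%classic) f t)%R.
have Pd (N x : R) : - N < x < N -> is_derive x 1 (P N) (f x).
  move=> /andP[Nx xN].
  have fi : (@lebesgue_measure R).-integrable `[- N, N] (EFin \o f).
    apply: continuous_compact_integrable; first exact: segment_compact.
    exact: continuous_subspaceT.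
  have [] := @continuous_FTC1_closed R f (- N) x N xN fi Nx (fc x).
  by move=> Pd <-; rewrite derive1E; exact: derivableP.
pose F t := P (`|t| + 1) t - P (`|t| + 1) 0.
exists F; first by rewrite /F subrr.
move=> t; set N0 := `|t| + 2.
have FE s : `|s - t| < 1 -> F s = P N0 s - P N0 0.
  move=> st.
  have sN : `|s| + 1 < N0.
    by have := ler_normD (s - t) t; rewrite subrK /N0; move: st; clear; lra.
  have D (x : R) : `|x| <= `|s| -> is_derive x (1 : R) (P (`|s| + 1) - P N0) 0.
    rewrite ler_norml => /andP[x1 x2].
    have d1 : is_derive x 1 (P (`|s| + 1)) (f x).
      by apply: Pd; apply/andP; split; move: x1 x2; clear; lra.
    have d2 : is_derive x 1 (P N0) (f x).
      by apply: Pd; apply/andP; split; move: x1 x2 sN; clear; lra.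
    by have := is_deriveB d1 d2; rewrite subrr.
  have : (P (`|s| + 1) - P N0) s = (P (`|s| + 1) - P N0) 0.
    apply/eqP; rewrite -subr_eq0 -normr_le0.
    have z (x : R) : `|(fun=> 0 : R) x| <= (0 : R) by rewrite normr0.
    have [s0|/ltW s0] := leP 0 s.
      have D' x : 0 <= x <= s -> is_derive x 1 (P (`|s| + 1) - P N0) ((fun=> 0) x).
        by move=> /andP[x0 xs]; apply: D; rewrite !ger0_norm.
      by have := derive1_norm_le_const s0 D' (fun x _ => z x); rewrite mul0r.
    have D' x : s <= x <= 0 -> is_derive x 1 (P (`|s| + 1) - P N0) ((fun=> 0) x).
      by move=> /andP[x0 xs]; apply: D; rewrite !ler0_norm // lerN2.
    by have := derive1_norm_le_const s0 D' (fun x _ => z x); rewrite mul0r distrC.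
  rewrite -![(P _ - P _) _]/(P _ _ - P _ _) /F; move: (P _ _) (P _ _) (P _ _) (P _ _).
  by clear; move=> a b c d; lra.
have d : is_derive t 1 (P N0 - cst (P N0 0)) (f t).
  have d1 : is_derive t 1 (P N0) (f t).
    by apply: Pd; rewrite /N0; have := ler_norm t; have := ler_norm (- t); rewrite normrN; lra.
  by have := is_deriveB d1 (is_derive_cst (P N0 0) t 1); rewrite subr0.
apply: near_eq_is_derive d.
near=> s; rewrite FE //.
Unshelve. all: by end_near. Qed.

(** The intervals [[u m - d m, u m + d m]] are nested, because [d m.+1 = d m - C / 2 ^+ m]; the
    limit is the supremum of their left ends. *)
Lemma geometric_cauchy (u : nat -> R) (C : R) :
  (forall m, `|u m.+1 - u m| <= C / 2 ^+ m) ->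
  exists l, forall m, `|u m - l| <= 2 * C / 2 ^+ m.
Proof.
move=> uC.
pose d m := 2 * C / 2 ^+ m.
have C0 : 0 <= C.
  by have := le_trans (normr_ge0 _) (uC 0%N); rewrite expr0 divr1.
have d0 m : 0 <= d m by rewrite divr_ge0 ?mulr_ge0 ?exprn_ge0.
have dS m : d m.+1 = d m - C / 2 ^+ m.
  rewrite /d exprS; have : (2 : R) ^+ m != 0 by rewrite expf_neq0.
  by move: (2 ^+ m) => p p0; field.
have incr m k : (m <= k)%N -> u m - d m <= u k - d k.
  elim: k => [|k IH]; first by rewrite leqn0 => /eqP ->.
  rewrite leq_eqVlt => /predU1P[->//|/IH]; rewrite dS.
  by have := uC k; rewrite ler_norml => /andP[+ _]; clear; lra.
have decr m k : (m <= k)%N -> u k + d k <= u m + d m.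
  elim: k => [|k IH]; first by rewrite leqn0 => /eqP ->.
  rewrite leq_eqVlt => /predU1P[->//|/IH]; rewrite dS.
  by have := uC k; rewrite ler_norml => /andP[_]; clear; lra.
have cross m k : u m - d m <= u k + d k.
  apply: (@le_trans _ _ (u (maxn m k) + d (maxn m k))).
    apply: (le_trans (incr m (maxn m k) _)); rewrite ?leq_maxl //.
    by have := d0 (maxn m k); lra.
  by apply: decr; rewrite leq_maxr.
pose A := [set r | exists m, r = u m - d m].
have hA : has_sup A.
  split; first by exists (u 0%N - d 0%N), 0%N.
  by exists (u 0%N + d 0%N) => _ [m ->].
exists (sup A) => m; rewrite ler_norml; apply/andP; split.
  suff : sup A <= u m + d m by rewrite -/(d m); lra.
  by apply: ge_sup => [|_ [k ->]] //; exact: hA.1.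
suff : u m - d m <= sup A by rewrite -/(d m); lra.
by apply: ub_le_sup; [exact: hA.2|exists m].
Qed.

Lemma half_pow_small (C e : R) : 0 < e -> exists m, C / 2 ^+ m < e.
Proof.
move=> e0; have [m Cm] : exists m : nat, `|C| / e < m%:R.
  by exists (Num.truncn (`|C| / e)).+1; apply: truncnS_gt; rewrite divr_ge0 // ltW.
exists m; rewrite ltr_pdivrMr ?exprn_gt0 //.
move: Cm; rewrite ltr_pdivrMr // => Cm.
apply: le_lt_trans (ler_norm C) (lt_le_trans Cm _).
by rewrite mulrC ler_pM2l // -natrX ler_nat ltnW // ltn_expl.
Qed.

End Primitive.

(** * Newton's equation *)

Section Newton.
Variables (R : realType) (n : nat).
Implicit Types (G : 'rV[R]_n -> 'rV[R]_n) (x v y w : R -> 'rV[R]_n) (s t : R).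

(** The system x' = v, v' = G(x), written by coordinates so that calculus on the line applies, and
    at a single time so that it may be required on an interval only. *)
Definition newton G x v t := forall i,
  is_derive t (1 : R) (fun s => x s 0 i) (v t 0 i) /\
  is_derive t (1 : R) (fun s => v s 0 i) (G (x t) 0 i).

Lemma newton_shift G x v s t : newton G x v (t + s) ->
  newton G (fun u => x (u + s)) (fun u => v (u + s)) t.
Proof.
by move=> H i; have [hx hv] := H i; split;
  [exact: (is_derive1_shift hx)|exact: (is_derive1_shift hv)].
Qed.

Lemma newton_opp G x v t : newton G x v (- t) ->
  newton G (fun u => x (- u)) (fun u => - v (- u)) t.
Proof.
move=> H i; have [hx hv] := H i; split.
  by rewrite mxE; exact: (is_derive1_opp hx).
have -> : (fun u => (- v (- u)) 0 i) = - (fun u => v (- u) 0 i) by apply/funext => u; rewrite mxE.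
rewrite -[G (x (- t)) 0 i]opprK; apply: is_deriveN.
exact: (is_derive1_opp hv).
Qed.

Lemma newton_ext G G' x v t : G (x t) = G' (x t) -> newton G x v t -> newton G' x v t.
Proof. by move=> E H i; have [? ?] := H i; split => //; rewrite -E. Qed.

(** * Global solutions by Picard iteration *)

Section Existence.
Variables (G : 'rV[R]_n -> 'rV[R]_n) (L : R) (a v0 : 'rV[R]_n).
Hypothesis L0 : 0 <= L.
Hypothesis GL : forall p q, `|G p - G q| <= L * `|p - q|.

Let continuous_path (x : R -> 'rV[R]_n) :=
  forall t e, 0 < e -> exists2 d, 0 < d & forall s, `|s - t| < d -> `|x s - x t| <= e.

Let is_derive_continuous_path x v : (forall t i, is_derive t (1 : R) (fun s => x s 0 i) (v t 0 i)) ->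
  continuous_path x.
Proof.
move=> xd t e e0.
have : \forall s \near t, forall i, `|x s 0 i - x t 0 i| <= e.
  apply: (@filter_forall R 'I_n (fun i s => `|x s 0 i - x t 0 i| <= e) (nbhs t) _) => i.
  have /is_derive1_continuous := xd t i.
  move=> /cvgrPdist_le /(_ _ e0); apply: filterS => s.
  by rewrite distrC.
move=> /nbhs_ballP[d /= d0 H]; exists d => // s sd.
apply: norm_le_coord => [|i]; first exact: ltW.
by rewrite !mxE; apply: H; rewrite /ball /= distrC.
Qed.

Let path_comp_continuous x i : continuous_path x -> continuous (fun t => G (x t) 0 i).
Proof.
move=> xc t; apply/cvgrPdist_le => e e0.
have L1 : 0 < L + 1 by rewrite ltr_wpDl.
have [|d d0 H] := xc t (e / (L + 1)); first exact: divr_gt0.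
apply/nbhs_ballP; exists d => // s /=; rewrite /ball /= distrC => /H h.
rewrite distrC (_ : _ - _ = (G (x s) - G (x t)) 0 i); last by rewrite !mxE.
apply: le_trans (coord_le_norm _ _) (le_trans (GL _ _) _).
apply: (@le_trans _ _ ((L + 1) * (e / (L + 1)))).
  by apply: ler_pM => //; rewrite lerDl.
by rewrite mulrCA divff ?mulr1 // gt_eqF.
Qed.

(** One Picard step acts on the position path alone, by integrating the force twice. The default
    pair given to a discontinuous path lets [choice] produce an operator [S] defined on all
    paths. *)
Let double_primitive x : exists yw : (R -> 'rV[R]_n) * (R -> 'rV[R]_n),
  continuous_path x -> [/\ yw.1 0 = a, yw.2 0 = v0 & forall t i,
    is_derive t (1 : R) (fun s => yw.1 s 0 i) (yw.2 t 0 i) /\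
    is_derive t (1 : R) (fun s => yw.2 s 0 i) (G (x t) 0 i)].
Proof.
have [xc|nxc] := pselect (continuous_path x); last by exists (x, x).
have /choice[W W_] : forall i, exists W : R -> R, W 0 = v0 0 i /\
    forall t : R, is_derive t (1 : R) W (G (x t) 0 i).
  move=> i; have [F F0 Fd] := continuous_primitive (path_comp_continuous (i := i) xc).
  exists (F + cst (v0 0 i)); split; first by rewrite -[LHS]/(F 0 + _) F0 add0r.
  by move=> t; have := is_deriveD (Fd t) (is_derive_cst (v0 0 i) t 1); rewrite addr0.
have /choice[Y Y_] : forall i, exists Y : R -> R, Y 0 = a 0 i /\
    forall t : R, is_derive t (1 : R) Y (W i t).
  move=> i; have [|F F0 Fd] := @continuous_primitive R (W i).
    by move=> t; exact: (is_derive1_continuous ((W_ i).2 t)).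
  exists (F + cst (a 0 i)); split; first by rewrite -[LHS]/(F 0 + _) F0 add0r.
  by move=> t; have := is_deriveD (Fd t) (is_derive_cst (a 0 i) t 1); rewrite addr0.
exists (fun t => \row_i Y i t, fun t => \row_i W i t) => _; split => /=.
- by apply/rowP => i; rewrite mxE (Y_ i).1.
- by apply/rowP => i; rewrite mxE (W_ i).1.
move=> t i.
have -> : (fun s => (\row_i Y i s) 0 i) = Y i by apply/funext => s; rewrite mxE.
have -> : (fun s => (\row_i W i s) 0 i) = W i by apply/funext => s; rewrite mxE.
by rewrite mxE; split; [exact: (Y_ i).2|exact: (W_ i).2].
Qed.

Lemma newton_exists : exists x v, [/\ x 0 = a, v 0 = v0 & forall t, newton G x v t].
Proof.
have /choice[S S_] := double_primitive.
(* Two integrations and the Lipschitz bound multiply the weighted norm by [L / l ^+ 2], and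
   [2 * L <= (2 * L + 1) ^+ 2] makes this at most one half. *)
pose l : R := 2 * L + 1.
have l0 : 0 < l by rewrite ltr_wpDl ?mulr_ge0.
have Lll : L / l / l <= 2^-1.
  by rewrite -mulrA -invfM ler_pdivrMr ?mulr_gt0 // /l; move: L0; nra.
have Sc x : continuous_path x -> continuous_path (S x).1.
  by move=> /S_[_ _ D]; apply: is_derive_continuous_path => t i; exact: (D t i).1.
pose E t := expR (l * `|t|).
have E1 t : 1 <= E t by rewrite -expR0 ler_expR mulr_ge0 // ltW.
have contr x y K : continuous_path x -> continuous_path y -> 
    (forall t, `|x t - y t| <= K * E t) ->
    forall t, `|(S x).1 t - (S y).1 t| <= K / 2 * E t.
  move=> xc yc xy.
  have K0 : 0 <= K.
    by have := le_trans (normr_ge0 _) (xy 0); rewrite /E normr0 mulr0 expR0 mulr1.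
  have [x0 v0' Dx] := S_ _ xc; have [y0 w0 Dy] := S_ _ yc.
  have vb i t : `|(S x).2 t 0 i - (S y).2 t 0 i| <= L * K / l * E t.
    have D s : is_derive s (1:R) ((fun u => (S x).2 u 0 i) - (fun u => (S y).2 u 0 i))
      (G (x s) 0 i - G (y s) 0 i).
      by apply: is_deriveB; [exact: (Dx s i).2|exact: (Dy s i).2].
    have DB s : `|G (x s) 0 i - G (y s) 0 i| <= L * K * E s.
      rewrite (_ : _ - _ = (G (x s) - G (y s)) 0 i); last by rewrite !mxE.
      apply: le_trans (coord_le_norm _ _) (le_trans (GL _ _) _).
      by rewrite -mulrA ler_wpM2l.
    have := exp_weight_bound l0 D DB t.
    by rewrite -![(_ - _ : R -> R) _]/(_ - _) v0' w0 subrr subr0.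
  move=> t; apply: norm_le_coord => [|i].
    by rewrite mulr_ge0 ?divr_ge0 // expR_ge0.
  have D s : is_derive s (1:R) ((fun u => (S x).1 u 0 i) - (fun u => (S y).1 u 0 i))
    ((S x).2 s 0 i - (S y).2 s 0 i).
    by apply: is_deriveB; [exact: (Dx s i).1|exact: (Dy s i).1].
  have := exp_weight_bound l0 D (vb i) t.
  rewrite -![(_ - _ : R -> R) _]/(_ - _) x0 y0 subrr subr0 !mxE => /le_trans; apply.
  rewrite ler_wpM2r ?expR_ge0 //.
  rewrite (_ : L * K / l / l = K * (L / l / l)); last by rewrite [L * K]mulrC -!mulrA.
  by rewrite ler_wpM2l.
pose X m := iter m (fun x => (S x).1) (fun=> a).
have Xc m : continuous_path (X m).
  elim: m => [t e e0|m]; last exact: Sc.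
  by exists 1 => // s _; rewrite subrr normr0 ltW.
have [K X1] : exists K, forall t, `|X 1%N t - X 0%N t| <= K * E t.
  have [x0 v0' D] := S_ _ (Xc 0%N).
  pose K1 := `|v0| + `|G a| / l.
  have K10 : 0 <= K1 by rewrite addr_ge0 // divr_ge0 // ltW.
  have vb i t : `|(S (X 0%N)).2 t 0 i| <= K1 * E t.
    have GB s : `|G (X 0%N s) 0 i| <= `|G a| * E s.
      by apply: le_trans (coord_le_norm _ _) _; rewrite ler_peMr.
    have := exp_weight_bound l0 (fun s => (D s i).2) GB t; rewrite v0' => H.
    rewrite -[X in `|X|](subrK (v0 0 i)); apply: le_trans (ler_normD _ _) _.
    rewrite /K1 mulrDl addrC; apply: lerD => //.
    by apply: le_trans (coord_le_norm _ _) _; rewrite ler_peMr.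
  exists (K1 / l) => t; apply: norm_le_coord => [|i].
    by rewrite mulr_ge0 ?divr_ge0 ?(ltW l0) // expR_ge0.
  by have := exp_weight_bound l0 (fun s => (D s i).1) (vb i) t; rewrite x0 !mxE.
have XS m t : `|X m.+1 t - X m t| <= K / 2 ^+ m * E t.
  elim: m t => [|m IH] t; first by rewrite expr0 divr1.
  have := contr _ _ _ (Xc m.+1) (Xc m) IH t.
  by rewrite exprSr invfM mulrA.
have /choice[x x_] : forall t, exists r : 'rV[R]_n, forall m, `|X m t - r| <= 2 * K / 2 ^+ m * E t.
  move=> t; have /choice[l' H] : forall i, exists l', forall m, `|X m t 0 i - l'| <= 2 * (K * E t) / 2 ^+ m.
    move=> i; apply: geometric_cauchy => m.
    rewrite -mulrAC (_ : _ - _ = (X m.+1 t - X m t) 0 i); last by rewrite !mxE.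
    exact: le_trans (coord_le_norm _ _) (XS m t).
  exists (\row_i l' i) => m; apply: norm_le_coord => [|i].
    have K0 : 0 <= K.
      by have := le_trans (normr_ge0 _) (X1 0); rewrite /E normr0 mulr0 expR0 mulr1.
    by rewrite !mulr_ge0 ?invr_ge0 ?exprn_ge0 ?expR_ge0.
  rewrite !mxE; apply: le_trans (H i m) _.
  by rewrite [2 * (K * E t)]mulrA [leLHS]mulrAC.
have xc : continuous_path x.
  move=> t e e0; have e3 : 0 < e / 3 by rewrite divr_gt0.
  have [m mE] := @half_pow_small R (2 * K * expR (l * (`|t| + 1))) _ e3.
  have [d d0 H] := Xc m t _ e3.
  exists (Num.min d 1); first by rewrite lt_min d0 ltr01.
  move=> s; rewrite lt_min => /andP[/H sd s1].
  have bd u : `|u| <= `|t| + 1 -> `|X m u - x u| <= e / 3.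
    move=> ut; apply: le_trans (x_ u m) (le_trans _ (ltW mE)).
    rewrite mulrAC ler_wpM2r ?invr_ge0 ?exprn_ge0 //.
    have K0 : 0 <= K.
      by have := le_trans (normr_ge0 _) (X1 0); rewrite /E normr0 mulr0 expR0 mulr1.
    by rewrite ler_wpM2l ?mulr_ge0 // ler_expR ler_wpM2l // ltW.
  have b1 : `|X m s - x s| <= e / 3.
    apply: bd; rewrite -[s](subrK t) addrC; apply: le_trans (ler_normD _ _) _.
    by rewrite lerD2l ltW.
  have b2 : `|X m t - x t| <= e / 3 by apply: bd; rewrite lerDl.
  rewrite (_ : x s - x t = (x s - X m s) + (X m s - X m t) + (X m t - x t)); last first.
    by rewrite [x s - _ + _]addrA subrK addrA subrK.
  apply: le_trans (ler_normD _ _) _; apply: le_trans (lerD (ler_normD _ _) b2) _.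
  rewrite distrC; move: b1 sd; move: `|_| `|_| => p q; lra.
have [x0 v0' D] := S_ _ xc.
have xE : (S x).1 = x.
  apply/funext => t; apply/eqP; rewrite -subr_eq0 -normr_le0.
  apply/ler_addgt0Pl => e e0; rewrite addr0.
  have e2 : 0 < e / 2 by rewrite divr_gt0.
  have [m mE] := @half_pow_small R (2 * K * E t) _ e2.
  have b1 : `|X m.+1 t - (S x).1 t| <= e / 2.
    have := contr (X m) x _ (Xc m) xc (fun s => x_ s m) t.
    move=> /le_trans; apply; apply: le_trans (ltW mE).
    rewrite [leRHS]mulrAC ler_wpM2r ?expR_ge0 // ler_piMr //.
      by have := le_trans (normr_ge0 _) (x_ 0 m); rewrite /E normr0 mulr0 expR0 mulr1.
    by lra.
  have b2 : `|X m.+1 t - x t| <= e / 2.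
    apply: le_trans (x_ t m.+1) _; apply: le_trans (ltW mE).
    rewrite [leRHS]mulrAC ler_wpM2r ?expR_ge0 // exprS invfM.
    have := le_trans (normr_ge0 _) (x_ 0 m); rewrite /E normr0 mulr0 expR0 mulr1.
    by rewrite mulrCA; move: (2 * K / _); move=> p; lra.
  rewrite (_ : (S x).1 t - x t = ((S x).1 t - X m.+1 t) + (X m.+1 t - x t)); last by rewrite addrA subrK.
  apply: le_trans (ler_normD _ _) _; rewrite distrC.
  by move: b1 b2; move: `|_| `|_| => p q; lra.
rewrite xE in x0 D; by exists x, (S x).2; split.
Qed.

End Existence.
End Newton.

(** * Flows *)

Section Flow.
Variables (R : realType) (n : nat).
Implicit Types (G : 'rV[R]_n -> 'rV[R]_n) (x v y w : R -> 'rV[R]_n) (a b s t : R).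
Implicit Types (p q : 'rV[R]_n * 'rV[R]_n).

(** Squared Euclidean distance in phase space; the square makes it differentiable along two
    trajectories, also where they meet. *)
Definition sdist p q := dot (p.1 - q.1) (p.1 - q.1) + dot (p.2 - q.2) (p.2 - q.2).

Lemma sdist_ge0 p q : 0 <= sdist p q.
Proof. by rewrite addr_ge0 ?dotxx_ge0. Qed.

Lemma sdist0_eq p q : sdist p q <= 0 -> p = q.
Proof.
move=> d0; case: p q d0 => [p1 p2] [q1 q2] /= d0.
have := dotxx_ge0 (p1 - q1); have := dotxx_ge0 (p2 - q2).
move: d0; rewrite /sdist /= => d0 d1 d2.
have /dotxx_eq0/subr0_eq -> : dot (p1 - q1) (p1 - q1) = 0 by lra.
by have /dotxx_eq0/subr0_eq -> : dot (p2 - q2) (p2 - q2) = 0 by lra.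
Qed.

Lemma norm1_sq_le_sdist p q : `|p.1 - q.1| ^+ 2 <= sdist p q.
Proof. by apply: le_trans (norm_sq_le_dot _) _; rewrite lerDl dotxx_ge0. Qed.

Lemma norm2_sq_le_sdist p q : `|p.2 - q.2| ^+ 2 <= sdist p q.
Proof. by apply: le_trans (norm_sq_le_dot _) _; rewrite lerDr dotxx_ge0. Qed.

Lemma sdist_le_norm p q :
  sdist p q <= n%:R * (`|p.1 - q.1| ^+ 2 + `|p.2 - q.2| ^+ 2).
Proof. by rewrite mulrDr lerD ?dotxx_le. Qed.

Section Gronwall.
Variables (G : 'rV[R]_n -> 'rV[R]_n) (L : R).
Hypothesis L0 : 0 <= L.
Hypothesis GL : forall p q : 'rV[R]_n, `|G p - G q| <= L * `|p - q|.

Let k : R := n%:R * (1 + L).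

Lemma newton_gronwall x v y w a b : a <= b ->
  (forall t, a <= t <= b -> newton G x v t) ->
  (forall t, a <= t <= b -> newton G y w t) ->
  sdist (x b, v b) (y b, w b) <= sdist (x a, v a) (y a, w a) * expR (k * (b - a)).
Proof.
move=> ab xv yw.
pose D t := sdist (x t, v t) (y t, w t).
pose dD t := 2 * dot (v t - w t) (x t - y t) + 2 * dot (G (x t) - G (y t)) (v t - w t).
apply: (@gronwall R D dD _ _ _ ab) => t tab.
- have dx i : is_derive t 1 (fun s => (x s - y s) 0 i) ((v t - w t) 0 i).
    have -> : (fun s => (x s - y s) 0 i) = (fun s => x s 0 i) - (fun s => y s 0 i).
      by apply/funext => s; rewrite !mxE.
    by rewrite !mxE; apply: is_deriveB; [exact: (xv t tab i).1|exact: (yw t tab i).1].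
  have dv i : is_derive t 1 (fun s => (v s - w s) 0 i) ((G (x t) - G (y t)) 0 i).
    have -> : (fun s => (v s - w s) 0 i) = (fun s => v s 0 i) - (fun s => w s 0 i).
      by apply/funext => s; rewrite !mxE.
    by rewrite !mxE; apply: is_deriveB; [exact: (xv t tab i).2|exact: (yw t tab i).2].
  have dDE : dD t = dot (v t - w t) (x t - y t) + dot (x t - y t) (v t - w t) +
      (dot (G (x t) - G (y t)) (v t - w t) + dot (v t - w t) (G (x t) - G (y t))).
    rewrite /dD (dotC (x t - y t)) (dotC (v t - w t) (G (x t) - G (y t))).
    by rewrite !mulr_natl !mulr2n.
  rewrite dDE; exact: is_deriveD (is_derive_dot dx dx) (is_derive_dot dv dv).
- set d := x t - y t; set e := v t - w t.
  have h1 : `|dot e d| <= n%:R * `|e| * `|d| := norm_dot_le _ _.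
  have h2 : `|dot (G (x t) - G (y t)) e| <= n%:R * (L * `|d|) * `|e|.
    apply: le_trans (norm_dot_le _ _) _; by rewrite ler_wpM2r // ler_wpM2l ?ler0n // GL.
  have h3 : `|d| ^+ 2 <= dot d d := norm_sq_le_dot _.
  have h4 : `|e| ^+ 2 <= dot e e := norm_sq_le_dot _.
  rewrite /dD /D /sdist /= -/d -/e.
  have h5 : 2 * (`|d| * `|e|) <= dot d d + dot e e.
    have : 0 <= (`|d| - `|e|) ^+ 2 := sqr_ge0 _.
    rewrite sqrrB -mulr_natl; move: h3 h4; lra.
  have h6 : k * (2 * (`|d| * `|e|)) <= k * (dot d d + dot e e).
    by apply: ler_wpM2l h5; rewrite mulr_ge0 ?addr_ge0.
  apply: le_trans h6; have := le_trans (ler_norm _) h1; have := le_trans (ler_norm _) h2.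
  rewrite /k; move: (n%:R : R) => N; move: `|d| `|e| => d' e'.
  by move: (dot _ _) (dot _ _) => A B; nra.
Qed.

Lemma newton_gronwall_abs x v y w a b s t :
  (forall t, a <= t <= b -> newton G x v t) ->
  (forall t, a <= t <= b -> newton G y w t) ->
  a <= s <= b -> a <= t <= b ->
  sdist (x t, v t) (y t, w t) <= sdist (x s, v s) (y s, w s) * expR (k * `|t - s|).
Proof.
move=> xv yw /andP[as_ sb] /andP[at_ tb].
have [st|/ltW ts] := leP s t.
  rewrite ger0_norm ?subr_ge0 //; apply: newton_gronwall => // u /andP[u1 u2].
    by apply: xv; rewrite (le_trans as_ u1) (le_trans u2).
  by apply: yw; rewrite (le_trans as_ u1) (le_trans u2).
(* Going backwards in time is going forwards along the reversed trajectories, and reversal preserves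
   [sdist]. *)
have rev x' v' : (forall t, a <= t <= b -> newton G x' v' t) ->
    forall u, - s <= u <= - t -> newton G (fun u => x' (- u)) (fun u => - v' (- u)) u.
  move=> H u /andP[u1 u2]; apply/newton_opp/H; apply/andP; split.
    by rewrite lerNr; apply: le_trans u2 _; rewrite lerN2.
  by rewrite lerNl; apply: le_trans u1; rewrite lerN2.
have st : - s <= - t by rewrite lerN2.
have := newton_gronwall st (rev _ _ xv) (rev _ _ yw).
rewrite !opprK /sdist /= ler0_norm ?subr_le0 // opprB -[- t + s]addrC.
by rewrite -!opprD !dotNl !dotNr !opprK.
Qed.

Lemma newton_flow_exists p : exists g : R -> 'rV[R]_n * 'rV[R]_n,
  g 0 = p /\ forall t, newton G (fun s => (g s).1) (fun s => (g s).2) t.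
Proof.
have [x [v [x0 v0 H]]] := newton_exists p.1 p.2 L0 GL.
by exists (fun t => (x t, v t)); split => //=; rewrite x0 v0 -surjective_pairing.
Qed.

End Gronwall.

(** Chosen among the solutions through [p]; when [G] is Lipschitz one exists by
    [newton_flow_exists], and [newton_flow] gives uniqueness. *)
Definition flow G p : R -> 'rV[R]_n * 'rV[R]_n :=
  xget (fun=> p) [set g : R -> 'rV[R]_n * 'rV[R]_n |
    g 0 = p /\ forall t, newton G (fun s => (g s).1) (fun s => (g s).2) t].

(** The force is the gradient of [f], so that the potential energy is [- f]: with [f = E - V] the
    conserved quantity is the excess of the energy over [E]. *)
Lemma newton_energy (f : 'rV[R]_n -> R) G (B : R) x v a b s t : lipschitz_gradient f G B ->
  (forall t, a <= t <= b -> newton G x v t) ->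
  a <= s <= b -> a <= t <= b ->
  2^-1 * dot (v s) (v s) - f (x s) = 2^-1 * dot (v t) (v t) - f (x t).
Proof.
move=> fG xv.
pose H t := 2^-1 * dot (v t) (v t) - f (x t).
have Hd u : a <= u <= b -> is_derive u 1 H ((fun=> 0) u).
  move=> uab.
  have d1 := is_derive_dot (fun i => (xv u uab i).2) (fun i => (xv u uab i).2).
  have d2 := is_derive_potential fG (fun i => (xv u uab i).1).
  have := is_deriveB (@is_deriveZ _ _ _ _ 2^-1 _ _ _ d1) d2.
  rewrite [dot (v u) _]dotC; set e := dot (G (x u)) (v u).
  rewrite (_ : 2^-1 *: (e + e) = e) ?subrr //.
  by rewrite /GRing.scale /=; move: e; clear => e; lra.
wlog st : s t / s <= t.
  move=> W sab tab; have [st|/ltW ts] := leP s t; first exact: W.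
  by rewrite (W t s).
move=> /andP[as_ sb] /andP[at_ tb].
have Hd' u : s <= u <= t -> is_derive u 1 H ((fun=> 0) u).
  by move=> /andP[su ut]; apply: Hd; rewrite (le_trans as_ su) (le_trans ut tb).
have Hb' u : s <= u <= t -> `|(fun=> 0 : R) u| <= (0 : R) by rewrite normr0.
have := derive1_norm_le_const st Hd' Hb'.
by rewrite mul0r normr_le0 subr_eq0 => /eqP.
Qed.

Section FlowTheory.
Variables (G : 'rV[R]_n -> 'rV[R]_n) (L : R).
Hypothesis L0 : 0 <= L.
Hypothesis GL : forall p q : 'rV[R]_n, `|G p - G q| <= L * `|p - q|.

Lemma flow0 p : flow G p 0 = p.
Proof. by have [H _] := xgetPex (fun=> p) (newton_flow_exists L0 GL p). Qed.

Lemma flow_newton p t : newton G (fun s => (flow G p s).1) (fun s => (flow G p s).2) t.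
Proof. by have [_ H] := xgetPex (fun=> p) (newton_flow_exists L0 GL p); exact: H. Qed.

Lemma flow_gronwall p q t :
  sdist (flow G p t) (flow G q t) <= sdist p q * expR (n%:R * (1 + L) * `|t|).
Proof.
have := @newton_gronwall_abs G L L0 GL _ _ _ _ (- `|t|) `|t| 0 t
  (fun s _ => flow_newton p s) (fun s _ => flow_newton q s).
rewrite -!surjective_pairing !flow0 subr0; apply.
  by rewrite oppr_le0 !normr_ge0.
by rewrite -ler_norml.
Qed.

(** Uniqueness requires the equation on [[a, b]] only, so a trajectory of the capped system can be
    identified with one of the Hamiltonian flow as long as [V <= E0] along it. *)
Lemma newton_flow x v a b c t : (forall t, a <= t <= b -> newton G x v t) ->
  a <= c <= b -> a <= t <= b -> (x t, v t) = flow G (x c, v c) (t - c).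
Proof.
move=> xv cab tab; apply: sdist0_eq.
have := @newton_gronwall_abs G L L0 GL x v _ _ a b c t xv
  (fun s _ => newton_shift (flow_newton (x c, v c) (s + - c))) cab tab.
rewrite -!surjective_pairing subrr flow0 => /le_trans; apply.
by rewrite /sdist !subrr !dot0l addr0 mul0r.
Qed.

Lemma flowD p s t : flow G p (s + t) = flow G (flow G p s) t.
Proof.
have := @newton_flow (fun s => (flow G p s).1) (fun s => (flow G p s).2)
  (- (`|s| + `|t|)) (`|s| + `|t|) s (s + t) (fun s _ => flow_newton p s).
rewrite -!surjective_pairing [s + t - s]addrAC subrr add0r; apply.
  by rewrite -ler_norml lerDl.
by rewrite -ler_norml ler_normD.
Qed.

Lemma flowK p t : flow G (flow G p t) (- t) = p.
Proof. by rewrite -flowD subrr flow0. Qed.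

Lemma flow_reverse p t :
  flow G (p.1, - p.2) t = ((flow G p (- t)).1, - (flow G p (- t)).2).
Proof.
have := @newton_flow (fun s => (flow G p (- s)).1) (fun s => - (flow G p (- s)).2)
  (- `|t|) `|t| 0 t (fun s _ => newton_opp (flow_newton p (- s))).
rewrite oppr0 flow0 addr0 => <- //; first by rewrite oppr_le0 normr_ge0.
by rewrite -ler_norml.
Qed.

End FlowTheory.
End Flow.

(** * Integral curves of the Hamiltonian field *)

Section IntegralCurves.
Variables (R : realType) (n : nat) (V : 'rV[R]_n -> R).

Lemma newton_integral_curve (x v : R -> 'rV[R]_n) :
  (forall t, newton (fun q => - grad V q) x v t) -> integral_curve V (fun t => (x t, v t)).
Proof.
move=> H t; rewrite /hamiltonian_field /=.
have vec (y : R -> 'rV[R]_n) (dy : 'rV[R]_n) :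
    (forall i, is_derive t (1 : R) (fun s => y s 0 i) (dy 0 i)) ->
    (h^-1 *: (y (h *: 1 + t) - y t)) @[h --> 0^'] --> dy.
  move=> yd; have dd : derivable y t 1.
    by apply/derivable_mxP => i j; rewrite (ord1 i); case: (yd j).
  have -> : dy = 'D_1 y t; last exact: dd.
  by rewrite derive_mx //; apply/rowP => j; rewrite mxE; case: (yd j).
have h1 := vec x _ (fun i => (H t i).1).
have h2 := vec v (- grad V (x t)) (fun i => (H t i).2).
have hc : (h^-1 *: ((x (h *: 1 + t), v (h *: 1 + t)) - (x t, v t))) @[h --> 0^'] -->
    (v t, - grad V (x t)) by exact: (cvg_pair h1 h2).
apply: DeriveDef; first by apply/cvg_ex; exists (v t, - grad V (x t)).
exact/cvg_lim.
Qed.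

Lemma bounded_orbit_zero (E0 M : R) (g : R -> 'rV[R]_n * 'rV[R]_n) :
  assumption_A3 V E0 -> integral_curve V g -> symbol V (g 0) = E0 ->
  (forall t, `|(g t).1| <= M /\ `|(g t).2| <= M) -> g 0 = (0, 0).
Proof.
move=> hA3 gc gE gM.
have gb t : `|g t| <= M by have [? ?] := gM t; rewrite /Num.Def.normr /= ge_max; apply/andP.
suff : trapped_set V E0 (g 0) by rewrite hA3.
split => //; exists g; split; first by split.
- move=> /cvgryPge /(_ (M + 1)) [A [_ /(_ (A + 1))]] /=.
  by rewrite ltrDl ltr01 => /(_ isT); have := gb (A + 1); lra.
- move=> /cvgryPge /(_ (M + 1)) [A [_ /(_ (A - 1))]] /=.
  by rewrite gtrDl oppr_lt0 ltr01 => /(_ isT); have := gb (A - 1); lra.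
Qed.

End IntegralCurves.

(** * Discrete geodesics *)

Lemma half_scale_double (R : realType) (D : R) : 2^-1 *: (D + D) = D.
Proof. by rewrite /GRing.scale /=; lra. Qed.

Section DiscreteGeodesics.
Variables (R : realType) (n : nat).
Variables (f : 'rV[R]_n -> R) (G : 'rV[R]_n -> 'rV[R]_n) (B d : R) (a b : 'rV[R]_n).
Hypothesis fG : lipschitz_gradient f G B.
Hypothesis d0 : 0 < d.
Hypothesis fd : forall x, d <= f x.
Hypothesis ab : a <> b.
Variable m : nat.
Let K := m.+1.
Implicit Types x y : nat -> 'rV[R]_n.

(* [kin x * pot x] is a discrete squared Jacobi length; its critical points solve
   the discrete Newton equation with time step [Num.sqrt (kin x / pot x)]. *)
Let kin x : R := \sum_(j < K) 2^-1 * dot (x j.+1 - x j) (x j.+1 - x j).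
Let pot x : R := \sum_(j < K) f (x j).
Let path x := x 0%N = a /\ forall k, (K <= k)%N -> x k = b.

Let kin_ge0 x : 0 <= kin x.
Proof. by apply: sumr_ge0 => i _; rewrite mulr_ge0 // dotxx_ge0. Qed.

Let pot_ge x : K%:R * d <= pot x.
Proof. by rewrite mulr_natl -[X in _ *+ X]card_ord -sumr_const ler_sum. Qed.

Let pot_gt0 x : 0 < pot x.
Proof. by apply: lt_le_trans (pot_ge x); rewrite mulr_gt0. Qed.

Let pot_le x : pot x <= K%:R * B.
Proof.
have [_ [_ _ fB _]] := fG.
rewrite mulr_natl -[X in _ *+ X]card_ord -sumr_const ler_sum // => i _.
by apply: le_trans (fB _); exact: ler_norm.
Qed.

Let straight j : 'rV[R]_n := a + ((minn j K)%:R / K%:R) *: (b - a).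

Let straight_path : path straight.
Proof.
split; first by rewrite /straight min0n mul0r scale0r addr0.
by move=> k Kk; rewrite /straight (minn_idPr Kk) divff ?pnatr_eq0 // scale1r addrC subrK.
Qed.

Let kin_straight : kin straight = dot (b - a) (b - a) / (2 * K%:R).
Proof.
have K0 : K%:R != 0 :> R by rewrite pnatr_eq0.
rewrite /kin (eq_bigr (fun=> 2^-1 * (K%:R^-1 * (K%:R^-1 * dot (b - a) (b - a))))).
  rewrite sumr_const card_ord -[LHS]mulr_natr; move: (dot _ _) => D.
  by move: (K%:R) K0 => k k0; field.
move=> i _; rewrite /straight; have iK := ltn_ord i.
rewrite (minn_idPl (ltnW iK)) (minn_idPl iK) opprD addrACA subrr add0r -scalerBl.
by rewrite -mulrBl -natrB // subSnn mul1r dotZl dotZr.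
Qed.

Let path_bound x : path x -> kin x * pot x <= kin straight * pot straight ->
  forall k, `|x k| <= `|a| + `|b| + K%:R * (1 + 2 * (kin straight * pot straight / (K%:R * d))).
Proof.
move=> [x0 xK] hx k.
(* Coercivity: since [pot x] is at least [K * d], a bound on the product bounds [kin x], hence every
   step of the path. *)
set A := kin straight * pot straight / (K%:R * d).
have Kd : 0 < K%:R * d by rewrite mulr_gt0.
have A0 : 0 <= A by rewrite divr_ge0 ?mulr_ge0 // ltW.
have kA : kin x <= A.
  rewrite ler_pdivlMr //; apply: le_trans hx; rewrite ler_wpM2l //.
have step j : (j < K)%N -> `|x j.+1 - x j| <= 1 + 2 * A.
  move=> jK; have : `|x j.+1 - x j| ^+ 2 <= 2 * A.
    apply: le_trans (norm_sq_le_dot _) _.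
    rewrite -ler_pdivrMl //; apply: le_trans kA.
    by rewrite /kin (bigD1 (Ordinal jK)) //= lerDl sumr_ge0 // => i _; rewrite mulr_ge0 // dotxx_ge0.
  move: `|_| (normr_ge0 (x j.+1 - x j)) => u u0 H; nra.
have [Kk|kK] := leqP K k.
  rewrite xK //; rewrite addrAC lerDr addr_ge0 // mulr_ge0 // addr_ge0 // mulr_ge0 //.
have {kK} kK := ltnW kK.
have : `|x k| <= `|a| + k%:R * (1 + 2 * A).
  elim: k kK => [|k IH] kK; first by rewrite x0 mul0r addr0.
  rewrite -(subrK (x k) (x k.+1)); apply: le_trans (ler_normD _ _) _.
  have := step _ kK; have := IH (ltnW kK); rewrite -natr1.
  by move: `|_| `|_| `|_| => p q r; lra.
move=> /le_trans; apply; rewrite -addrA lerD2l ler_wpDl // ler_wpM2r ?ler_nat //.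
by rewrite addr_ge0 // mulr_ge0.
Qed.

(* The first row of [vec_mx u] is ignored. *)
Let of_vec (u : 'rV[R]_(K * n)) (k : nat) : 'rV[R]_n :=
  if (k == 0)%N then a else
  if (insub k : option 'I_K) is Some i then row i (vec_mx u) else b.

Let of_vec_lip u u' k : `|of_vec u k - of_vec u' k| <= `|u - u'|.
Proof.
rewrite /of_vec; case: ifP => _; first by rewrite subrr normr0.
case: insub => [i|]; last by rewrite subrr normr0.
apply: norm_le_coord => // j; rewrite !mxE.
have := coord_le_norm (u - u') (mxvec_index i j).
by rewrite !mxE.
Qed.

Let of_vec_cont k : continuous (of_vec ^~ k).
Proof.
move=> u; apply/(@cvgrPdist_le _ _ _ (nbhs u)) => e e0; apply/nbhs_ballP; exists e => // u'.
rewrite -ball_normE /= => uu'; apply: le_trans (of_vec_lip _ _ _) (ltW uu').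
Qed.

Let path_of_vec u : path (of_vec u).
Proof.
split => // k Kk; rewrite /of_vec; case: eqP => [k0|_]; first by rewrite k0 in Kk.
by rewrite insubF // ltnNge Kk.
Qed.

Let to_vec x : 'rV[R]_(K * n) := mxvec (\matrix_(i < K) x i).

Let to_vecK x : path x -> of_vec (to_vec x) =1 x.
Proof.
move=> [x0 xK] k; rewrite /of_vec /to_vec; case: eqP => [->//|_].
case: insubP => [i _ <-|]; last by rewrite -leqNgt => /xK.
by rewrite mxvecK rowK.
Qed.

Let to_vec_bound x M : 0 <= M -> (forall k, `|x k| <= M) -> `|to_vec x| <= M.
Proof.
move=> M0 xM; apply: norm_le_coord => // k.
case/mxvec_indexP: k => i j; rewrite mxvecE mxE.
exact: le_trans (coord_le_norm _ _) (xM _).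
Qed.

Lemma lipschitz_gradient_continuous : continuous f.
Proof.
have [B0 [_ fT _ fG']] := fG.
move=> x; apply/(@cvgrPdist_le _ _ _ (nbhs x)) => e e0.
pose c := n%:R * B + B + 1.
have c0 : 0 < c by rewrite ltr_wpDl // addr_ge0 ?mulr_ge0 // ltW.
apply/nbhs_ballP; exists (Num.min 1 (e / c)); first by rewrite /= lt_min ltr01 divr_gt0.
move=> y; rewrite -ball_normE /= distrC lt_min => /andP[y1 ye].
rewrite distrC -(subrK (dot (G x) (y - x)) (f y - f x)).
apply: le_trans (ler_normD _ _) _.
apply: (@le_trans _ _ (B * `|y - x| ^+ 2 + n%:R * B * `|y - x|)).
  apply: lerD (fT _ _) _; apply: le_trans (norm_dot_le _ _) _.
  by rewrite ler_wpM2r // ler_wpM2l ?ler0n.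
apply: (@le_trans _ _ (c * `|y - x|)); last first.
  by rewrite -ler_pdivlMl // mulrC; exact: ltW.
have : B * `|y - x| ^+ 2 <= B * `|y - x| by rewrite ler_pM2l // expr2 ler_piMr // ltW.
have := normr_ge0 (y - x); rewrite /c.
by move: `|_| => u; move: (n%:R * B) => q; nra.
Qed.

Lemma sum_continuous (T : topologicalType) (I : finType) (g : I -> T -> R) :
  (forall i, continuous (g i)) -> continuous (fun u => \sum_i g i u).
Proof. by move=> gc; apply: continuous_big => [|i _]; [exact: add_continuous|exact: gc]. Qed.

Lemma continuous_dotxx : continuous (fun x : 'rV[R]_n => dot x x).
Proof.
apply: (@sum_continuous _ 'I_n (fun i (x : 'rV[R]_n) => x 0 i * x 0 i)) => i x.
have cx : {for x, continuous (fun y : 'rV[R]_n => y 0 i)} by exact: coord_continuous.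
exact: (continuousM cx cx).
Qed.

Let minimizer : exists2 x, path x & forall y, path y -> kin x * pot x <= kin y * pot y.
Proof.
pose M := `|a| + `|b| + K%:R * (1 + 2 * (kin straight * pot straight / (K%:R * d))).
have M0 : 0 <= M.
  by rewrite !addr_ge0 // mulr_ge0 // addr_ge0 // mulr_ge0 // divr_ge0 ?mulr_ge0 // ltW.
pose F u := kin (of_vec u) * pot (of_vec u).
have pc : continuous (fun u => pot (of_vec u)).
  apply: (@sum_continuous _ 'I_K (fun j u => f (of_vec u j))) => j v.
  have := @continuous_comp _ _ _ _ _ _ (@of_vec_cont j v) (lipschitz_gradient_continuous (x := of_vec v j)).
  exact.
have kc : continuous (fun u => kin (of_vec u)).
  apply: (@sum_continuous _ 'I_K (fun j u => 2^-1 * dot (of_vec u j.+1 - of_vec u j) (of_vec u j.+1 - of_vec u j))) => j v.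
  have c1 := continuousB (@of_vec_cont j.+1 v) (@of_vec_cont j v).
  have c2 := @continuous_comp _ _ _ _ _ _ c1 (continuous_dotxx (x := of_vec v j.+1 - of_vec v j)).
  exact: (continuousM (@cst_continuous _ _ (2^-1 : R) v) c2).
have Fc : continuous F by move=> u; exact: (continuousM (kc u) (pc u)).
have cpt : compact [set u : 'rV[R]_(K * n) | `|u| <= M].
  apply: bounded_closed_compact.
    by exists M; split; [exact: num_real | move=> r Mr u /= uM; exact: le_trans uM (ltW Mr)].
  by apply: (@closed_comp _ _ (fun u : 'rV[R]_(K * n) => `|u|) [set r : R | r <= M]);
    [move=> u _; exact: norm_continuous | exact: closed_le].
have [] := EVT_min_rV _ cpt (continuous_subspaceT Fc).
  by exists 0; rewrite /= normr0.
move=> u _ umin.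
have FE y : path y -> F (to_vec y) = kin y * pot y.
  move=> /to_vecK yE; rewrite /F /kin /pot; congr (_ * _).
    by apply: eq_bigr => i _; rewrite !yE.
  by apply: eq_bigr => i _; rewrite yE.
have ust : F u <= kin straight * pot straight.
  rewrite -FE //; apply: umin; rewrite inE /=; apply: to_vec_bound => // k.
  exact: path_bound.
exists (of_vec u) => // y yp; rewrite -/(F u).
have [yst|/ltW yst] := leP (kin y * pot y) (kin straight * pot straight); last first.
  exact: le_trans ust yst.
rewrite -FE //; apply: umin; rewrite inE /=; apply: to_vec_bound => // k.
exact: path_bound.
Qed.

(** Only the point of index [k.+1] is varied, along the defect [e] of the equation itself;
    stationarity of [kin * pot] in that direction then reads [dot e e = 0]. *)
Let euler_lagrange x : path x -> (forall y, path y -> kin x * pot x <= kin y * pot y) ->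
  forall k, (k.+1 < K)%N ->
  pot x *: ((x k.+2 - x k.+1) - (x k.+1 - x k)) = kin x *: G (x k.+1).
Proof.
move=> xp xmin k kK.
pose e := pot x *: ((x k.+2 - x k.+1) - (x k.+1 - x k)) - kin x *: G (x k.+1).
suff : dot e e = 0 by move=> /dotxx_eq0 /subr0_eq.
pose eta j : 'rV[R]_n := if j == k.+1 then e else 0.
pose y (s : R) j := x j + s *: eta j.
have yp s : path (y s).
  case: xp => x0 xK; split; first by rewrite /y /eta /= scaler0 addr0.
  move=> j Kj; rewrite /y /eta xK //; case: eqP => [jk|_]; last by rewrite scaler0 addr0.
  by move: Kj; rewrite jk leqNgt kK.
have yd (s : R) j i : is_derive s (1:R) (fun s => y s j 0 i) (eta j 0 i).
  have -> : (fun s => y s j 0 i) = cst (x j 0 i) + (fun s : R => eta j 0 i * s).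
    by apply/funext => u; rewrite !mxE -[RHS]/(x j 0 i + eta j 0 i * u) [_ * u]mulrC.
  have h : is_derive s (1:R) (fun s : R => eta j 0 i * s) (eta j 0 i).
    by apply: is_derive_eq; rewrite /GRing.scale /= mulr1.
  by have := is_deriveD (is_derive_cst (x j 0 i) s 1) h; rewrite add0r.
have y0 j : y 0 j = x j by rewrite /y scale0r addr0.
have dd (s : R) j : is_derive s (1:R) (fun s => 2^-1 * dot (y s j.+1 - y s j) (y s j.+1 - y s j))
    (dot (y s j.+1 - y s j) (eta j.+1 - eta j)).
  have sub i : is_derive s (1:R) (fun s => (y s j.+1 - y s j) 0 i) ((eta j.+1 - eta j) 0 i).
    have -> : (fun s => (y s j.+1 - y s j) 0 i) = (fun s => y s j.+1 0 i) - (fun s => y s j 0 i).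
      by apply/funext => u; rewrite mxE [X in _ + X]mxE.
    by rewrite [X in is_derive _ _ _ X]mxE [X in is_derive _ _ _ (_ + X)]mxE; exact: is_deriveB.
  have := @is_deriveZ _ _ _ _ 2^-1 _ _ _ (is_derive_dot sub sub).
  rewrite [dot (eta _ - _) _]dotC; set D := dot _ _.
  by rewrite half_scale_double.
have kd (s : R) : is_derive s (1:R) (fun s => kin (y s)) (\sum_(j < K) dot (y s j.+1 - y s j) (eta j.+1 - eta j)).
  have -> : (fun s => kin (y s)) = \sum_(j < K) (fun s => 2^-1 * dot (y s j.+1 - y s j) (y s j.+1 - y s j)).
    by apply/funext => u; rewrite fct_sumE.
  by apply: is_derive_sum => j; exact: dd.
have pd (s : R) : is_derive s (1:R) (fun s => pot (y s)) (\sum_(j < K) dot (G (y s j)) (eta j)).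
  have -> : (fun s => pot (y s)) = \sum_(j < K) (fun s => f (y s j)).
    by apply/funext => u; rewrite fct_sumE.
  by apply: is_derive_sum => j; exact: (is_derive_potential (x := fun s => y s j) fG (yd s j)).
have yE : y 0 = x by apply/funext.
have FD s := is_deriveM (kd s) (pd s).
have min0 : is_derive (0:R) (1:R) ((fun s => kin (y s)) * (fun s => pot (y s))) 0.
  apply: (@derive1_at_min R _ (-1) 1 0) => //.
  - by rewrite in_itv /= ltrN10 ltr01.
  - by move=> t _; rewrite -![(_ * _ : R -> R) _]/(_ * _) yE; exact: xmin.
have E : kin x *: (\sum_(j < K) dot (G (x j)) (eta j)) +
  pot x *: \sum_(j < K) dot (x j.+1 - x j) (eta j.+1 - eta j) = 0.
  by case: (FD 0) => _; case: min0 => _ ->; rewrite yE.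
have S1 : \sum_(j < K) dot (G (x j)) (eta j) = dot (G (x k.+1)) e.
  rewrite (bigD1 (Ordinal kK)) //= /eta eqxx big1 ?addr0 // => j jk.
  by rewrite (negPf (jk : val j != k.+1)) dot0r.
have S2 : \sum_(j < K) dot (x j.+1 - x j) (eta j.+1 - eta j) =
    dot (x k.+1 - x k) e - dot (x k.+2 - x k.+1) e.
  under eq_bigr do rewrite dotBr.
  rewrite sumrB; congr (_ - _).
    rewrite (bigD1 (Ordinal (ltnW kK))) //= /eta eqxx big1 ?addr0 // => j jk.
    by rewrite eqSS (negPf (jk : val j != k)) dot0r.
  rewrite (bigD1 (Ordinal kK)) //= /eta eqxx big1 ?addr0 // => j jk.
  by rewrite (negPf (jk : val j != k.+1)) dot0r.
have -> : dot e e = pot x * (dot (x k.+2 - x k.+1) e - dot (x k.+1 - x k) e) -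
    kin x * dot (G (x k.+1)) e by rewrite -dotBl -!dotZl -dotBl.
have {}E : kin x * dot (G (x k.+1)) e +
    pot x * (dot (x k.+1 - x k) e - dot (x k.+2 - x k.+1) e) = 0 by rewrite -S1 -S2.
by rewrite -[LHS]opprK -[RHS]oppr0; congr (- _); rewrite -[RHS]E opprB -mulrN opprB.
Qed.

(** Two features allow the passage to the limit: the bound on the total time [h * K] does not depend
    on the number of steps, and the discrete energies average to zero. *)
Lemma discrete_geodesic : exists (h : R) (x v : nat -> 'rV[R]_n),
  [/\ 0 < h, h * K%:R <= B * dot (b - a) (b - a) / d ^+ 2 + 1, x 0%N = a /\ x K = b,
    (forall k, (k < K)%N -> x k.+1 = x k + h *: v k) /\
    (forall k, (k.+1 < K)%N -> v k.+1 = v k + h *: G (x k.+1)) &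
    \sum_(j < K) (2^-1 * dot (v j) (v j) - f (x j)) = 0].
Proof.
have [B0 _] := fG.
have [x xp xmin] := minimizer.
have P0 := pot_gt0 x.
have kin0 : 0 < kin x.
  rewrite lt_neqAle kin_ge0 andbT eq_sym; apply/eqP => /eqP.
  rewrite psumr_eq0 => [/allP z|i _]; last by rewrite mulr_ge0 // dotxx_ge0.
  have E j : (j <= K)%N -> x j = a.
    elim: j => [_|j IH jK]; first exact: xp.1.
    have := z (Ordinal jK); rewrite mem_index_enum => /(_ isT) /=.
    rewrite mulf_eq0 invr_eq0 pnatr_eq0 /= => /eqP/dotxx_eq0/subr0_eq ->.
    exact/IH/ltnW.
  by apply: ab; rewrite -(E K (leqnn _)) xp.2.
(* This time step turns the Euler-Lagrange equation into Newton's, and makes the total kinetic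
   energy equal to [pot x], whence the vanishing mean. *)
pose h := Num.sqrt (kin x / pot x).
have h0 : 0 < h by rewrite sqrtr_gt0 divr_gt0.
have h2 : h ^+ 2 = kin x / pot x by rewrite sqr_sqrtr // ltW // divr_gt0.
have hN : h != 0 by rewrite gt_eqF.
exists h, x, (fun k => h^-1 *: (x k.+1 - x k)).
have KR0 : (0 : R) < K%:R by rewrite ltr0n.
split => //; last 3 first.
- by split; [exact: xp.1|exact: xp.2].
- split=> k kK; first by rewrite scalerA divff // scale1r addrC subrK.
  have EL := euler_lagrange xp xmin kK.
  apply/eqP; rewrite [X in _ == X]addrC -subr_eq -scalerBr; apply/eqP.
  have -> : x k.+2 - x k.+1 - (x k.+1 - x k) = h ^+ 2 *: G (x k.+1).
    by rewrite h2 mulrC -scalerA -EL scalerA mulVf ?scale1r // gt_eqF.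
  by rewrite scalerA expr2 mulKf.
- rewrite sumrB; have -> : \sum_(i < K) 2^-1 * dot (h^-1 *: (x i.+1 - x i)) (h^-1 *: (x i.+1 - x i)) = (h ^+ 2)^-1 * kin x.
    rewrite mulr_sumr; apply: eq_bigr => i _; rewrite dotZl dotZr expr2 invfM.
    by move: (dot _ _) => D; ring.
  rewrite h2 invf_div -mulrA mulVf ?gt_eqF // mulr1; exact: subrr.
(* The straight path bounds [kin x * pot x], and [K * d <= pot x] turns this into a bound on
   [K ^+ 2 * (kin x / pot x)]. The final [+ 1] comes from [u <= u ^+ 2 + 1]. *)
have hK2 : (h * K%:R) ^+ 2 <= B * dot (b - a) (b - a) / d ^+ 2.
  rewrite exprMn h2 ler_pdivlMr ?exprn_gt0 //.
  have h1 : kin x * pot x <= dot (b - a) (b - a) * B.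
    apply: le_trans (xmin _ straight_path) _; rewrite kin_straight.
    apply: (@le_trans _ _ (dot (b - a) (b - a) / (2 * K%:R) * (K%:R * B))).
      by rewrite ler_wpM2l // divr_ge0 ?dotxx_ge0.
    have -> : dot (b - a) (b - a) / (2 * K%:R) * (K%:R * B) = 2^-1 * (dot (b - a) (b - a) * B).
      by field; rewrite pnatr_eq0.
    have : 0 <= dot (b - a) (b - a) * B by rewrite mulr_ge0 ?dotxx_ge0 // ltW.
    by move: (_ * B) => D; lra.
  have h3 : (K%:R * d) ^+ 2 <= pot x ^+ 2.
    by rewrite ler_sqr ?nnegrE ?pot_ge // ?mulr_ge0 // ltW.
  rewrite (_ : kin x / pot x * K%:R ^+ 2 * d ^+ 2 = (kin x / pot x) * (K%:R * d) ^+ 2); last by rewrite exprMn [RHS]mulrA.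
  apply: (@le_trans _ _ (kin x / pot x * pot x ^+ 2)).
    by rewrite ler_wpM2l // divr_ge0 // ltW.
  by rewrite expr2 mulrA divfK ?gt_eqF // [B * _]mulrC.
have : 0 <= h * K%:R by rewrite mulr_ge0 // ltW.
by move: hK2; move: (h * K%:R) (_ / _) => u w; nra.
Qed.

End DiscreteGeodesics.

(** * Euler scheme *)

Section NewtonTaylor.
Variables (R : realType) (n : nat).
Variables (f : 'rV[R]_n -> R) (G : 'rV[R]_n -> 'rV[R]_n) (B : R).
Hypothesis fG : lipschitz_gradient f G B.

Lemma lipschitz_gradient_lip (x y : 'rV[R]_n) : `|G x - G y| <= B * `|x - y|.
Proof. by case: fG => _ []. Qed.

Lemma lipschitz_gradient_ge0 : 0 <= B.
Proof. by case: fG => /ltW. Qed.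

Let GL := lipschitz_gradient_lip.
Let B0 := lipschitz_gradient_ge0.

Section Trajectory.
Variables (x v : R -> 'rV[R]_n) (a b : R).
Hypothesis xv : forall t, a <= t <= b -> newton G x v t.

Lemma newton_velocity_lip s t : a <= s -> s <= t -> t <= b -> `|v t - v s| <= B * (t - s).
Proof.
move=> as_ st tb; apply: norm_le_coord => [|i].
  by rewrite mulr_ge0 // subr_ge0.
have D u : s <= u <= t -> is_derive u (1:R) (fun u => v u 0 i) (G (x u) 0 i).
  by move=> /andP[su ut]; apply: (xv _ i).2; rewrite (le_trans as_ su) (le_trans ut).
have := derive1_norm_le_const (c := B) st D.
rewrite !mxE; apply => u _; apply: le_trans (coord_le_norm _ _) _.
by case: fG => _ [].
Qed.

Lemma newton_position_taylor s t c w : a <= s -> s <= t -> t <= b ->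
  (forall u, s <= u <= t -> `|v u - w| <= c) ->
  `|x t - x s - (t - s) *: w| <= c * (t - s).
Proof.
move=> as_ st tb vc; apply: norm_le_coord => [|i].
  by rewrite mulr_ge0 ?subr_ge0 // (le_trans (normr_ge0 (v s - w))) // vc // lexx.
have D u : s <= u <= t -> is_derive u (1:R) ((fun u => x u 0 i) - (fun u => w 0 i * u)) (v u 0 i - w 0 i).
  move=> /andP[su ut]; apply: is_deriveB.
    by apply: (xv _ i).1; rewrite (le_trans as_ su) (le_trans ut).
  by apply: is_derive_eq; rewrite /GRing.scale /= mulr1.
have := derive1_norm_le_const (c := c) st D.
rewrite !mxE -![(_ - _ : R -> R) _]/(_ - _) (_ : _ - w 0 i * t - _ = x t 0 i - x s 0 i - (t - s) * w 0 i); last by ring.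
apply => u ust; rewrite (_ : _ - _ = (v u - w) 0 i); last by rewrite !mxE.
by apply: le_trans (coord_le_norm _ _) (vc _ ust).
Qed.

Lemma newton_velocity_taylor s t c w : a <= s -> s <= t -> t <= b ->
  (forall u, s <= u <= t -> `|G (x u) - w| <= c) ->
  `|v t - v s - (t - s) *: w| <= c * (t - s).
Proof.
move=> as_ st tb vc; apply: norm_le_coord => [|i].
  by rewrite mulr_ge0 ?subr_ge0 // (le_trans (normr_ge0 (G (x s) - w))) // vc // lexx.
have D u : s <= u <= t -> is_derive u (1:R) ((fun u => v u 0 i) - (fun u => w 0 i * u)) (G (x u) 0 i - w 0 i).
  move=> /andP[su ut]; apply: is_deriveB.
    by apply: (xv _ i).2; rewrite (le_trans as_ su) (le_trans ut).
  by apply: is_derive_eq; rewrite /GRing.scale /= mulr1.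
have := derive1_norm_le_const (c := c) st D.
rewrite !mxE -![(_ - _ : R -> R) _]/(_ - _) (_ : _ - w 0 i * t - _ = v t 0 i - v s 0 i - (t - s) * w 0 i); last by ring.
apply => u ust; rewrite (_ : _ - _ = (G (x u) - w) 0 i); last by rewrite !mxE.
by apply: le_trans (coord_le_norm _ _) (vc _ ust).
Qed.

Lemma newton_position_lip s t M : a <= s -> s <= t -> t <= b ->
  (forall u, s <= u <= t -> `|v u| <= M) -> `|x t - x s| <= M * (t - s).
Proof.
move=> as_ st tb vM; have := @newton_position_taylor s t M 0 as_ st tb.
by rewrite scaler0 subr0; apply => u /vM; rewrite subr0.
Qed.

End Trajectory.

(* [(y, w)] is the symplectic Euler scheme with time step [h]. *)
Lemma scheme_error (x v : R -> 'rV[R]_n) (h T M : R) (K : nat) (y w : nat -> 'rV[R]_n) :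
  0 < h -> h * K%:R <= T -> 0 <= M ->
  (forall t, 0 <= t <= T -> newton G x v t) ->
  (forall t, 0 <= t <= T -> `|v t| <= M) ->
  y 0%N = x 0 ->
  (forall k, (k < K)%N -> y k.+1 = y k + h *: w k) ->
  (forall k, (k.+1 < K)%N -> w k.+1 = w k + h *: G (y k.+1)) ->
  let q := (1 + B) * (1 + T) in
  let c := B * (1 + M + B * T) in
  forall k, (k < K)%N ->
    `|y k - x (h * k%:R)| + `|w k - v (h * k%:R)| <=
      (`|w 0%N - v 0| + c * h ^+ 2 * k%:R) * expR (q * (h * k%:R)) /\
    `|y k.+1 - x (h * k.+1%:R)| <= (`|w 0%N - v 0| + c * h ^+ 2 * k.+1%:R) * expR (q * (h * k.+1%:R)).
Proof.
move=> h0 hKT M0 xv vM y0 yS wS q c.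
have T0 : 0 <= T by apply: le_trans hKT; rewrite mulr_ge0 // ltW.
have c0 : 0 <= c by rewrite mulr_ge0 // !addr_ge0 // mulr_ge0.
have q1 : 1 <= q by rewrite /q; move: B0 T0; move: (B) => b b0 T0; nra.
have hk k : (k <= K)%N -> 0 <= h * k%:R <= T.
  move=> kK; apply/andP; split; first by rewrite mulr_ge0 // ltW.
  by apply: le_trans hKT; rewrite ler_pM2l // ler_nat.
have hS k : h * k.+1%:R = h * k%:R + h by rewrite -natr1 mulrDr mulr1.
have dT k : h * k.+1%:R - h * k%:R = h by rewrite hS addrAC subrr add0r.
have hT k : (k < K)%N -> h <= T.
  by move=> kK; have /andP[_] := hk k.+1 kK; rewrite hS; apply: le_trans; rewrite lerDr mulr_ge0 // ltW.
have xstep k : (k < K)%N ->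
    `|y k.+1 - x (h * k.+1%:R)| <= `|y k - x (h * k%:R)| + h * `|w k - v (h * k%:R)| + B * h ^+ 2.
  move=> kK; have /andP[t0 tT] := hk _ (ltnW kK); have /andP[_ sT] := hk _ kK.
  have ts : h * k%:R <= h * k.+1%:R by rewrite hS lerDl ltW.
  have := newton_position_taylor (c := B * h) (w := v (h * k%:R)) xv t0 ts sT.
  rewrite dT => H.
  have {}H : `|x (h * k.+1%:R) - x (h * k%:R) - h *: v (h * k%:R)| <= B * h * h.
    apply: H => u /andP[u1 u2]; apply: le_trans (newton_velocity_lip xv t0 u1 _) _.
      exact: le_trans u2 sT.
    by rewrite ler_wpM2l //; move: u2; rewrite hS; lra.
  rewrite yS // (_ : _ - _ = (y k - x (h * k%:R)) + h *: (w k - v (h * k%:R)) -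
     (x (h * k.+1%:R) - x (h * k%:R) - h *: v (h * k%:R))); last first.
    rewrite scalerBr !opprB !addrA; apply/rowP => i; rewrite !mxE; ring.
  apply: le_trans (ler_normB _ _) _; rewrite expr2 mulrA; apply: lerD H.
  by apply: le_trans (ler_normD _ _) _; rewrite normrZ gtr0_norm.
have vstep k : (k.+1 < K)%N ->
    `|w k.+1 - v (h * k.+1%:R)| <= `|w k - v (h * k%:R)| + h * B * `|y k.+1 - x (h * k.+1%:R)| + B * M * h ^+ 2.
  move=> kK; have kK' := ltnW kK.
  have /andP[t0 tT] := hk _ (ltnW kK'); have /andP[_ sT] := hk _ kK'.
  have ts : h * k%:R <= h * k.+1%:R by rewrite hS lerDl ltW.
  have := newton_velocity_taylor (c := B * (M * h)) (w := G (x (h * k.+1%:R))) xv t0 ts sT.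
  rewrite dT => H.
  have {}H : `|v (h * k.+1%:R) - v (h * k%:R) - h *: G (x (h * k.+1%:R))| <= B * (M * h) * h.
    apply: H => u /andP[u1 u2]; apply: le_trans (GL _ _) _; rewrite ler_wpM2l // distrC.
    apply: le_trans (newton_position_lip xv (le_trans t0 u1) u2 sT _) _.
      move=> s /andP[s1 s2]; apply: vM; rewrite (le_trans t0 (le_trans u1 s1)).
      exact: le_trans s2 sT.
    by rewrite ler_wpM2l //; move: u1; rewrite hS; lra.
  rewrite wS // (_ : _ - _ = (w k - v (h * k%:R)) + h *: (G (y k.+1) - G (x (h * k.+1%:R))) -
     (v (h * k.+1%:R) - v (h * k%:R) - h *: G (x (h * k.+1%:R)))); last first.
    rewrite scalerBr !opprB !addrA; apply/rowP => i; rewrite !mxE; ring.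
  apply: le_trans (ler_normB _ _) _; rewrite (_ : B * M * h ^+ 2 = B * (M * h) * h); last by ring.
  apply: lerD H.
  apply: le_trans (ler_normD _ _) _; rewrite normrZ gtr0_norm // lerD2l -mulrA ler_wpM2l ?GL //.
  exact: ltW.
(* Discrete Gronwall: one step multiplies the error by at most [1 + q * h] and adds at most
   [c * h ^+ 2]. The factor [1 + T] in [q] and the term [B * T] in [c] absorb the effect of the new
   position [y k.+1] on [w k.+1]. *)
pose F k := (`|w 0%N - v 0| + c * h ^+ 2 * k%:R) * expR (q * (h * k%:R)).
have F_ge0 k : 0 <= `|w 0%N - v 0| + c * h ^+ 2 * k%:R.
  apply: addr_ge0 => //; apply: mulr_ge0 => //; apply: mulr_ge0 => //.
  exact: exprn_ge0 (ltW h0).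
have FS k e : (k < K)%N -> 0 <= e -> e <= F k -> e * (1 + q * h) + c * h ^+ 2 <= F k.+1.
  move=> kK e0 eF.
  have E1 : 1 + q * h <= expR (q * h) by exact: expR_ge1Dx.
  have E2 : 1 <= expR (q * (h * k.+1%:R)).
    rewrite -expR0 ler_expR; apply: mulr_ge0; first exact: le_trans ler01 q1.
    by rewrite mulr_ge0 // ltW.
  rewrite /F -natr1 (mulrDr (c * _)) mulr1 addrA mulrDl; apply: lerD; last first.
    rewrite natr1 ler_peMr //; apply: mulr_ge0 => //; exact: exprn_ge0 (ltW h0).
  rewrite [h * (_ + 1)]mulrDr mulr1 [q * (_ + _)]mulrDr expRD [leRHS]mulrA; apply: ler_pM => //.
  apply: addr_ge0 => //; apply: mulr_ge0; last exact: ltW.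
  exact: le_trans ler01 q1.
have main : forall k, (k < K)%N -> `|y k - x (h * k%:R)| + `|w k - v (h * k%:R)| <= F k.
  elim=> [_|k IH kK].
    by rewrite mulr0 y0 subrr normr0 add0r /F !mulr0 expR0 addr0 mulr1.
  have kK' := ltnW kK.
  have e0 : 0 <= `|y k - x (h * k%:R)| + `|w k - v (h * k%:R)| by rewrite addr_ge0.
  apply: le_trans (FS k _ kK' e0 (IH kK')).
  have := xstep k kK'; have := vstep k kK; have := hT k kK'.
  have := normr_ge0 (y k.+1 - x (h * k.+1%:R)).
  have := normr_ge0 (y k - x (h * k%:R)); have := normr_ge0 (w k - v (h * k%:R)).
  rewrite /q /c; move: `|y k.+1 - _| `|w k.+1 - _| `|y k - _| `|w k - _|.
  move: B0 h0 T0 M0; clear; move: B => b b0 h0 T0 M0 A1 W1 A W W0 A0 A10 hT H1 H2.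
  have H3 : h * b * A1 <= h * b * (A + h * W + b * h ^+ 2).
    by rewrite ler_wpM2l // mulr_ge0 // ltW.
  have H4 : h * b * (h * W) <= h * b * (T * W).
    by rewrite ler_wpM2l ?mulr_ge0 ?(ltW h0) // ler_wpM2r.
  have H5 : h * b * (b * h ^+ 2) <= T * b * (b * h ^+ 2).
    by rewrite ler_wpM2r ?mulr_ge0 ?exprn_ge0 ?(ltW h0) // ler_wpM2r.
  have P1 : 0 <= h * A by rewrite mulr_ge0 // ltW.
  have P2 : 0 <= h * T * A by rewrite !mulr_ge0 // ltW.
  have P3 : 0 <= h * T * W by rewrite !mulr_ge0 // ltW.
  have P4 : 0 <= h * b * T * A by rewrite !mulr_ge0 // ltW.
  have P5 : 0 <= h * b * W by rewrite !mulr_ge0 // ltW.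
  have P6 : 0 <= h * b * A by rewrite !mulr_ge0 // ltW.
  by lra.
move=> k kK; split; first exact: main.
have e0 : 0 <= `|y k - x (h * k%:R)| + `|w k - v (h * k%:R)| by rewrite addr_ge0.
apply: le_trans (FS k _ kK e0 (main k kK)).
have := xstep k kK; have := normr_ge0 (y k - x (h * k%:R)); have := normr_ge0 (w k - v (h * k%:R)).
rewrite /q /c; move: `|y k.+1 - _| `|y k - _| `|w k - _|.
move: B0 h0 T0 M0; clear; move: B => b b0 h0 T0 M0 A1 A W W0 A0 H.
have P0 : 0 <= h * W by rewrite mulr_ge0 // ltW.
have P1 : 0 <= h * A by rewrite mulr_ge0 // ltW.
have P2 : 0 <= h * T * A by rewrite !mulr_ge0 // ltW.
have P3 : 0 <= h * T * W by rewrite !mulr_ge0 // ltW.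
have P4 : 0 <= h * b * T * A by rewrite !mulr_ge0 // ltW.
have P4' : 0 <= h * b * T * W by rewrite !mulr_ge0 // ltW.
have P5 : 0 <= h * b * W by rewrite !mulr_ge0 // ltW.
have P6 : 0 <= h * b * A by rewrite !mulr_ge0 // ltW.
have P7 : 0 <= b * M * h ^+ 2 by rewrite !mulr_ge0 ?exprn_ge0 // ltW.
have P8 : 0 <= b * (b * T) * h ^+ 2 by rewrite !mulr_ge0 ?exprn_ge0 // ltW.
by lra.
Qed.

End NewtonTaylor.

(** * Connecting two points at a given energy *)

(** The restriction [e <= 1] lets quadratic errors be bounded by linear ones. *)
Lemma small_absorb (R : realType) (x C : R) : 0 <= C ->
  (forall e, 0 < e -> e <= 1 -> x <= C * e) -> x <= 0.
Proof.
move=> C0 H; rewrite leNgt; apply/negP => x0.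
pose e := Num.min 1 (x / (2 * (C + 1))).
have D0 : 0 < 2 * (C + 1) by lra.
have e0 : 0 < e by rewrite lt_min ltr01 divr_gt0.
have e1 : e <= 1 by rewrite ge_min lexx.
have ex : e * (2 * (C + 1)) <= x by rewrite -ler_pdivlMr // ge_min lexx orbT.
by have := H e e0 e1; nra.
Qed.

Section Connecting.
Variables (R : realType) (n : nat).
Variables (f : 'rV[R]_n -> R) (G : 'rV[R]_n -> 'rV[R]_n) (B d : R) (a b : 'rV[R]_n).
Hypothesis fG : lipschitz_gradient f G B.
Hypothesis d0 : 0 < d.
Hypothesis fd : forall x, d <= f x.
Hypothesis ab : a <> b.

Let B0 := lipschitz_gradient_ge0 fG.
Let GL := lipschitz_gradient_lip fG.

(* Some velocity of the discrete path is controlled since the kinetic energies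
   average to the values of [f]; the others follow as the force is bounded. *)
Let scheme_speed (h T : R) (K : nat) (y w : nat -> 'rV[R]_n) :
  (0 < K)%N -> 0 < h -> h * K%:R <= T ->
  (forall k, (k.+1 < K)%N -> w k.+1 = w k + h *: G (y k.+1)) ->
  \sum_(j < K) (2^-1 * dot (w j) (w j) - f (y j)) = 0 ->
  forall k, (k < K)%N -> `|w k| <= 1 + 2 * B + 2 * B * T.
Proof.
move=> K0 h0 hT wS E.
have T0 : 0 <= T by apply: le_trans hT; rewrite mulr_ge0 // ltW.
have [_ [_ _ fB GB]] := fG.
have step k : (k < K)%N -> `|w k - w 0%N| <= B * (h * k%:R).
  elim: k => [_|k IH kK]; first by rewrite subrr normr0 !mulr0.
  rewrite wS // -addrAC; apply: le_trans (ler_normD _ _) _.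
  rewrite normrZ gtr0_norm // -natr1 mulrDr mulr1 mulrDr; apply: lerD (IH (ltnW kK)) _.
  by rewrite mulrC ler_wpM2r // ltW.
have stepT k : (k < K)%N -> `|w k - w 0%N| <= B * T.
  move=> kK; apply: le_trans (step k kK) _; rewrite ler_wpM2l //; apply: le_trans hT.
  by rewrite ler_pM2l // ler_nat ltnW.
have [j jB] : exists j : 'I_K, 2^-1 * dot (w j) (w j) <= B.
  apply/not_existsP => H.
  suff : 0 < \sum_(j < K) (2^-1 * dot (w j) (w j) - f (y j)) by rewrite E ltxx.
  have pos (j : 'I_K) : 0 < 2^-1 * dot (w j) (w j) - f (y j).
    have /negP := H j; rewrite -ltNge subr_gt0 => /(le_lt_trans _); apply.
    by apply: le_trans (fB _); exact: ler_norm.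
  rewrite (bigD1 (Ordinal K0)) //=; apply: ltr_pwDl; first exact: (pos (Ordinal K0)).
  by apply: sumr_ge0 => i _; exact: ltW.
have wj : `|w j| <= 1 + 2 * B.
  apply: norm_le_dot; first by rewrite addr_ge0 ?mulr_ge0.
  by move: jB B0; move: (dot _ _) => D; nra.
move=> k kK; have s1 := stepT _ (ltn_ord j); have s2 := stepT _ kK.
rewrite (_ : w k = w j - (w j - w 0%N) + (w k - w 0%N)); last first.
  by rewrite subKr addrC subrK.
apply: le_trans (ler_normD _ _) _; apply: le_trans (lerD (ler_normB _ _) s2) _.
by move: wj s1; move: `|_| `|_| => p q; lra.
Qed.

(** Compactness is applied to the total time and the initial velocity only; the scheme then follows
    the exact flow, which gives the end point. All discrete energies are close to the constant
    energy of the limit, and they average to zero, so that constant is zero. *)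
Lemma connecting_trajectory : exists (T : R) (v0 : 'rV[R]_n),
  [/\ 0 < T, (flow G (a, v0) T).1 = b & 2^-1 * dot v0 v0 = f a].
Proof.
pose T1 := B * dot (b - a) (b - a) / d ^+ 2 + 1.
have T10 : 0 <= T1.
  by rewrite addr_ge0 // divr_ge0 ?exprn_ge0 ?mulr_ge0 ?dotxx_ge0 // ltW.
have /choice[h /choice[y /choice[w H]]] := discrete_geodesic fG d0 fd ab.
have hT m : h m * m.+1%:R <= T1 by case: (H m).
have h0 m : 0 < h m by case: (H m).
pose M := 1 + 2 * B + 2 * B * T1.
have M0 : 0 <= M by rewrite !addr_ge0 // !mulr_ge0.
have wM m k : (k < m.+1)%N -> `|w m k| <= M.
  by case: (H m) => _ _ _ [_ wS] E kK; exact: (scheme_speed _ (h0 m) (hT m) wS E).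
(* The total time, made a vector to fit [bounded_cluster]. *)
pose u m : 'rV[R]_1 := const_mx (h m * m.+1%:R).
have uM m : `|u m| <= M + T1.
  apply: norm_le_coord => [|i]; first by rewrite addr_ge0.
  rewrite mxE ger0_norm ?mulr_ge0 ?(ltW (h0 m)) //; apply: le_trans (hT m) _.
  by rewrite lerDr.
have wMT m : `|w m 0%N| <= M + T1 by apply: le_trans (wM _ _ _) _ => //; rewrite lerDl.
have [p [v0 clu]] := bounded_cluster uM wMT.
pose T := p 0 0.
have T0 : 0 <= T.
  rewrite -oppr_le0; apply: (@small_absorb _ _ 1) => // e e0 _; rewrite mul1r.
  have [j [_ uj _]] := clu e 0%N e0.
  have := coord_le_norm (u j - p) 0; rewrite !mxE -/T.
  have := mulr_ge0 (ltW (h0 j)) (ler0n R j.+1).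
  by move: uj; move: `|u j - p| (h j * _) => r s r1 s0; rewrite ler_norml => /andP[]; lra.
have TT : T <= T1.
  rewrite -subr_le0; apply: (@small_absorb _ _ 1) => // e e0 _; rewrite mul1r.
  have [j [_ uj _]] := clu e 0%N e0.
  have := coord_le_norm (u j - p) 0; rewrite !mxE -/T.
  have := hT j.
  by move: uj; move: `|u j - p| (h j * _) => r s r1 s0; rewrite ler_norml => /andP[]; lra.
pose x t := (flow G (a, v0) t).1; pose v t := (flow G (a, v0) t).2.
have xv t : newton G x v t by exact: flow_newton B0 GL _ _.
have f0 : flow G (a, v0) 0 = (a, v0) by exact: flow0 B0 GL _.
have x0 : x 0 = a by rewrite /x f0.
have v00 : v 0 = v0 by rewrite /v f0.
pose N := `|v0| + B * T1.
have N0 : 0 <= N by rewrite addr_ge0 // mulr_ge0.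
have vN t : 0 <= t <= T1 -> `|v t| <= N.
  move=> /andP[t0 tT].
  have := newton_velocity_lip fG (fun t _ => xv t) (lexx 0) t0 tT.
  rewrite subr0 v00 => Hv; rewrite -(subrK v0 (v t)) addrC; apply: le_trans (ler_normD _ _) _.
  by rewrite lerD2l; apply: le_trans Hv _; rewrite ler_wpM2l.
have xlip s t : 0 <= s -> s <= t -> t <= T1 -> `|x t - x s| <= N * (t - s).
  move=> s0 st tT; have H1 r : s <= r <= t -> `|v r| <= N.
    by move=> /andP[su ut]; apply: vN; rewrite (le_trans s0 su) (le_trans ut tT).
  exact: (newton_position_lip (fun t _ => xv t) s0 st tT H1).
pose q := (1 + B) * (1 + T1).
pose c := B * (1 + N + B * T1).
have c0 : 0 <= c by rewrite mulr_ge0 // !addr_ge0 // mulr_ge0.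
have q0 : 0 <= q by rewrite mulr_ge0 // addr_ge0.
pose Q := (1 + c * T1) * expR (q * T1).
have Q0 : 0 <= Q by rewrite mulr_ge0 ?expR_ge0 // addr_ge0 // mulr_ge0.
(* The index [m] is taken beyond [T1 / e], so that [h m <= e]; the errors on the total time and on
   the initial velocity are below [e] by the choice of a cluster point. *)
have approx e : 0 < e -> exists m,
    [/\ `|h m * m.+1%:R - T| <= e, `|y m m.+1 - x (h m * m.+1%:R)| <= Q * e &
      forall k, (k < m.+1)%N ->
      `|y m k - x (h m * k%:R)| + `|w m k - v (h m * k%:R)| <= Q * e].
  move=> e0; have [m [Nm um wm]] := clu e (Num.truncn (T1 / e)) e0.
  have he : h m <= e.
    have : h m <= T1 / m.+1%:R by rewrite ler_pdivlMr.
    move=> /le_trans; apply; rewrite ler_pdivrMr // mulrC -ler_pdivrMr //.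
    have /andP[_ /ltW H1] := truncn_itv (divr_ge0 T10 (ltW e0)).
    by apply: le_trans H1 _; rewrite ler_nat ltnS.
  have [_ _ [y0 yK] [yS wS] _] := H m.
  have SE := scheme_error fG (h0 m) (hT m) N0 (fun t _ => xv t) vN (etrans y0 (esym x0)) yS wS.
  have bd k : (k <= m.+1)%N ->
      (`|w m 0%N - v 0| + c * h m ^+ 2 * k%:R) * expR (q * (h m * k%:R)) <= Q * e.
    move=> kK; rewrite /Q [leRHS]mulrAC.
    have hk0 : 0 <= h m * k%:R by rewrite mulr_ge0 // ltW.
    have hkT : h m * k%:R <= T1.
      by apply: le_trans (hT m); rewrite ler_pM2l // ler_nat.
    apply: ler_pM; rewrite ?expR_ge0 //.
    - apply: addr_ge0 => //; apply: mulr_ge0 => //; apply: mulr_ge0 => //.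
      exact: exprn_ge0 (ltW (h0 m)).
    - rewrite v00 mulrDl mul1r; apply: lerD; first exact: ltW.
      rewrite expr2 -(mulrA c T1 e) -(mulrA c) -(mulrA (h m)); apply: ler_wpM2l => //.
      by rewrite [T1 * e]mulrC; apply: ler_pM => //; exact: ltW (h0 m).
    - by rewrite ler_expR; apply: ler_wpM2l.
  exists m; split.
  - have := coord_le_norm (u m - p) 0; rewrite !mxE -/T => /le_trans; apply; exact: ltW.
  - by have [_ /le_trans] := SE m (ltnSn m); apply; exact: bd.
  - by move=> k kK; have [/le_trans + _] := SE k kK; apply; apply: bd; exact: ltnW.
have xT : x T = b.
  apply/eqP; rewrite -subr_eq0 -normr_le0; apply: (@small_absorb _ _ (N + Q)).
    by rewrite addr_ge0.
  move=> e e0 _; have [m [mT my _]] := approx e e0.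
  have [_ _ [_ yK] _ _] := H m.
  have lip : `|x T - x (h m * m.+1%:R)| <= N * e.
    have s0 : 0 <= h m * m.+1%:R by rewrite mulr_ge0 // ltW.
    have [sT|/ltW Ts] := leP (h m * m.+1%:R) T.
      apply: le_trans (xlip _ _ s0 sT TT) _.
      by rewrite ler_wpM2l //; move: mT; rewrite ler_norml => /andP[]; move: (h m * _) => z; lra.
    rewrite distrC; apply: le_trans (xlip _ _ T0 Ts (hT m)) _.
    by rewrite ler_wpM2l //; move: mT; rewrite ler_norml => /andP[]; move: (h m * _) => z; lra.
  rewrite -(subrK (x (h m * m.+1%:R)) (x T)) -addrA; apply: le_trans (ler_normD _ _) _.
  by rewrite mulrDl; apply: lerD lip _; rewrite distrC -yK.
have Tpos : 0 < T.
  by rewrite lt_neqAle T0 andbT; apply/eqP => T0'; apply: ab; rewrite -xT -T0' x0.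
exists T, v0; split => //.
apply/eqP; rewrite -subr_eq0 -normr_le0.
set E0 := _ - _.
have energy t : 0 <= t <= T1 -> 2^-1 * dot (v t) (v t) - f (x t) = E0.
  move=> tT; rewrite /E0 -x0 -v00; apply: (newton_energy fG (fun t _ => xv t) tT).
  by rewrite lexx.
pose C := n%:R * (M + N) + (n%:R * B + B * Q).
have MN0 : 0 <= M + N by exact: addr_ge0.
have C0 : 0 <= C.
  by apply: addr_ge0; [exact: mulr_ge0|apply: addr_ge0; exact: mulr_ge0].
apply: (@small_absorb _ _ (C * Q)); first by rewrite mulr_ge0.
move=> e e0 e1; have [m [_ _ mk]] := approx e e0.
have [_ _ _ _ E] := H m.
have close k : (k < m.+1)%N -> `|2^-1 * dot (w m k) (w m k) - f (y m k) - E0| <= C * (Q * e).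
  move=> kK; have tT : 0 <= h m * k%:R <= T1.
    apply/andP; split; first by rewrite mulr_ge0 // ltW.
    by apply: le_trans (hT m); rewrite ler_pM2l // ler_nat ltnW.
  rewrite -(energy _ tT); set t := h m * k%:R.
  have := mk k kK; rewrite -/t => Hk.
  have h1 : `|y m k - x t| <= Q * e.
    by apply: le_trans Hk; rewrite lerDl.
  have h2 : `|w m k - v t| <= Q * e.
    by apply: le_trans Hk; rewrite lerDr.
  have Qe : 0 <= Q * e by rewrite mulr_ge0 // ltW.
  have k1 : `|2^-1 * dot (w m k) (w m k) - 2^-1 * dot (v t) (v t)| <= n%:R * (M + N) * (Q * e).
    rewrite -mulrBr (_ : dot (w m k) (w m k) - dot (v t) (v t) = dot (w m k + v t) (w m k - v t)); last first.
      by rewrite dotBr !dotDl [dot (v t) (w m k)]dotC; move: (dot _ _) (dot _ _) (dot _ _) => A1 A2 A3; ring.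
    rewrite normrM ger0_norm //.
    have : `|dot (w m k + v t) (w m k - v t)| <= n%:R * (M + N) * (Q * e).
      apply: le_trans (norm_dot_le _ _) _; apply: ler_pM => //.
      rewrite ler_wpM2l //; apply: le_trans (ler_normD _ _) _; apply: lerD; first exact: wM.
      exact: vN.
    by move=> /(le_trans _); apply; rewrite ler_piMl //; lra.
  have k2 : `|f (y m k) - f (x t)| <= (n%:R * B + B * Q) * (Q * e).
    have [_ [_ fT _ GB]] := fG.
    rewrite -(subrK (dot (G (x t)) (y m k - x t)) (f (y m k) - f (x t))).
    apply: le_trans (ler_normD _ _) _; rewrite addrC mulrDl; apply: lerD.
      apply: le_trans (norm_dot_le _ _) _; apply: ler_pM => //.
      by rewrite ler_wpM2l.
    apply: le_trans (fT _ _) _; rewrite -mulrA ler_wpM2l // expr2; apply: ler_pM => //.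
    by apply: le_trans h1 _; rewrite ler_piMr.
  rewrite (_ : _ - _ = (2^-1 * dot (w m k) (w m k) - 2^-1 * dot (v t) (v t)) - (f (y m k) - f (x t))); last first.
    by move: (_ * dot _ _) (_ * dot _ _) (f _) (f _) => A1 A2 A3 A4; ring.
  by apply: le_trans (ler_normB _ _) _; rewrite [leRHS]mulrDl; apply: lerD.
have : `|\sum_(j < m.+1) (2^-1 * dot (w m j) (w m j) - f (y m j) - E0)| <= m.+1%:R * (C * (Q * e)).
  apply: le_trans (ler_norm_sum _ _ _) _.
  apply: (@le_trans _ _ (\sum_(j < m.+1) (C * (Q * e)))).
    by apply: ler_sum => i _; exact: close.
  by rewrite sumr_const card_ord -[leLHS]mulr_natl.
rewrite sumrB E sub0r normrN sumr_const card_ord normrMn -[`|E0| *+ _]mulr_natl.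
by rewrite ler_pM2l // mulrA.
Qed.

End Connecting.

(** * Hamiltonian dynamics *)

Section ClusterPoints.
Variables (R : realType) (n : nat).
Implicit Types (p q : 'rV[R]_n * 'rV[R]_n).

(** Arbitrarily late terms come close to [p]. In this form no subsequence has to be extracted: the
    property is carried along by the flow, and closed conditions pass to [p]. *)
Definition cluster_point (u : nat -> 'rV[R]_n * 'rV[R]_n) p :=
  forall (e : R) N, 0 < e -> exists2 j, (N <= j)%N & sdist (u j) p < e.

Lemma bounded_cluster_point (u : nat -> 'rV[R]_n * 'rV[R]_n) (M : R) :
  (forall j, `|(u j).1| <= M /\ `|(u j).2| <= M) -> exists p, cluster_point u p.
Proof.
move=> uM.
have [p [q H]] := bounded_cluster (fun j => (uM j).1) (fun j => (uM j).2).
exists (p, q) => e N e0.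
pose d := Num.min 1 (e / (2 * (n%:R + 1))).
have D0 : 0 < 2 * (n%:R + 1) :> R by rewrite mulr_gt0 // ltr_wpDl.
have d0 : 0 < d by rewrite lt_min ltr01 divr_gt0.
have d1 : d <= 1 by rewrite ge_min lexx.
have de : d * (2 * (n%:R + 1)) <= e by rewrite -ler_pdivlMr // ge_min lexx orbT.
have [j [Nj h1 h2]] := H d N d0.
exists j => //; apply: le_lt_trans (sdist_le_norm _ _) _ => /=.
have sq (z : 'rV[R]_n) : `|z| < d -> `|z| ^+ 2 <= d.
  by move=> zd; have := normr_ge0 z; move: zd d1; move: `|z| => r; nra.
have := sq _ h1; have := sq _ h2; move: (_ ^+ 2) (_ ^+ 2) => r s rd sd.
apply: le_lt_trans (_ : n%:R * (2 * d) < e).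
  by apply: ler_wpM2l => //; move: rd sd; lra.
by apply: lt_le_trans de; lra.
Qed.

Lemma cluster_point_continuous (u : nat -> 'rV[R]_n * 'rV[R]_n) p
    (g : 'rV[R]_n * 'rV[R]_n -> R) : continuous g -> cluster_point u p ->
  forall (e : R) N, 0 < e -> exists2 j, (N <= j)%N & `|g (u j) - g p| < e.
Proof.
move=> gc up e N e0.
have /cvgrPdist_lt /(_ _ e0) /nbhs_ballP[d /= d0 H] := gc p.
have [j Nj uj] := up (d ^+ 2) N (exprn_gt0 _ d0).
exists j => //; rewrite distrC; apply: H.
have lt (z : 'rV[R]_n) : `|z| ^+ 2 < d ^+ 2 -> `|z| < d.
  by rewrite ltr_sqr ?nnegrE // ltW.
split; rewrite -ball_normE /= distrC; apply: lt; apply: le_lt_trans uj.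
  exact: norm1_sq_le_sdist.
exact: norm2_sq_le_sdist.
Qed.

Lemma cluster_point_le (u : nat -> 'rV[R]_n * 'rV[R]_n) p
    (g : 'rV[R]_n * 'rV[R]_n -> R) c : continuous g -> cluster_point u p ->
  (forall e, 0 < e -> exists N, forall j, (N <= j)%N -> g (u j) <= c + e) -> g p <= c.
Proof.
move=> gc up H; apply/ler_addgt0Pr => e e0.
have e20 : 0 < e / 2 by rewrite divr_gt0.
have [N HN] := H _ e20.
have [j /HN Nj] := cluster_point_continuous gc up N e20.
by rewrite ltr_norml => /andP[+ _]; move: Nj; move: (g _) (g _) => x y; lra.
Qed.

Lemma continuous_dot1 : continuous (fun p : 'rV[R]_n * 'rV[R]_n => dot p.1 p.1).
Proof.
move=> p.
have c1 : {for p, continuous (fun p : 'rV[R]_n * 'rV[R]_n => p.1)} by exact: cvg_fst.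
exact: (@continuous_comp _ _ _ _ (fun x : 'rV[R]_n => dot x x) p c1 (continuous_dotxx (x := p.1))).

Qed.

Lemma continuous_dot2 : continuous (fun p : 'rV[R]_n * 'rV[R]_n => dot p.2 p.2).
Proof.
move=> p.
have c1 : {for p, continuous (fun p : 'rV[R]_n * 'rV[R]_n => p.2)} by exact: cvg_snd.
exact: (@continuous_comp _ _ _ _ (fun x : 'rV[R]_n => dot x x) p c1 (continuous_dotxx (x := p.2))).

Qed.

End ClusterPoints.

Lemma lipschitz_gradient_cstB (R : realType) n (f : 'rV[R]_n -> R) G B E :
  lipschitz_gradient f G B ->
  lipschitz_gradient (fun x => E - f x) (fun x => - G x) (B + `|E|).
Proof.
move=> [B0 [h1 h2 h3 h4]]; have E0 := normr_ge0 E.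
have mono r s : 0 <= s -> r <= B * s -> r <= (B + `|E|) * s.
  by move=> s0 /le_trans; apply; rewrite ler_wpM2r // lerDl.
split; first by rewrite ltr_wpDr.
split => [x y|x y|x|x].
- by rewrite -opprD normrN; apply: mono.
- rewrite (_ : _ - _ - dot _ _ = - (f y - f x - dot (G x) (y - x))) ?normrN.
    by apply: mono; [exact: exprn_ge0|exact: h2].
  by rewrite dotNl; move: (f _) (f _) (dot _ _) => a b c; ring.
- by apply: le_trans (ler_normB _ _) _; rewrite addrC lerD.
- by rewrite normrN; apply: le_trans (h4 x) _; rewrite lerDl.
Qed.

Lemma sym_itv_self (R : realDomainType) (t : R) : - `|t| <= t <= `|t|.
Proof. by rewrite -ler_norml. Qed.

Lemma sym_itv0 (R : realDomainType) (t : R) : - `|t| <= 0 <= `|t|.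
Proof. by rewrite oppr_le0 normr_ge0. Qed.

(** * The Hamiltonian flow and its bounded orbits *)

Section Dynamics.
Variables (R : realType) (n : nat) (V : 'rV[R]_n -> R) (B : R).
Hypothesis hV : lipschitz_gradient V (grad V) B.
Implicit Types (p q : 'rV[R]_n * 'rV[R]_n).

Let G := fun x => - grad V x.

Let B0 : 0 <= B. Proof. by case: hV => /ltW. Qed.
Let GL x y : `|G x - G y| <= B * `|x - y|.
Proof. by rewrite -opprD normrN; case: hV => _ [+ _ _ _]; exact. Qed.

Let fE E := lipschitz_gradient_cstB E hV.

Definition hflow p t := flow G p t.

Lemma hflow0 p : hflow p 0 = p. Proof. exact: (flow0 B0 GL). Qed.
Lemma hflowD p s t : hflow p (s + t) = hflow (hflow p s) t. Proof. exact: (flowD B0 GL). Qed.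
Lemma hflowK p t : hflow (hflow p t) (- t) = p. Proof. exact: (flowK B0 GL). Qed.
Lemma hflow_newton p t : newton G (fun s => (hflow p s).1) (fun s => (hflow p s).2) t.
Proof. exact: (flow_newton B0 GL). Qed.
Lemma hflow_reverse p t : hflow (p.1, - p.2) t = ((hflow p (- t)).1, - (hflow p (- t)).2).
Proof. exact: (flow_reverse B0 GL). Qed.

Lemma newton_hflow (x v : R -> 'rV[R]_n) a b c t : (forall t, a <= t <= b -> newton G x v t) ->
  a <= c <= b -> a <= t <= b -> (x t, v t) = hflow (x c, v c) (t - c).
Proof. exact: (newton_flow B0 GL). Qed.

Definition growth : R := n%:R * (1 + B).

Lemma hflow_gronwall p q t :
  sdist (hflow p t) (hflow q t) <= sdist p q * expR (growth * `|t|).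
Proof. exact: (flow_gronwall B0 GL). Qed.

Lemma cluster_point_hflow u p t : cluster_point u p ->
  cluster_point (fun j => hflow (u j) t) (hflow p t).
Proof.
move=> up e N e0; set E := expR (growth * `|t|).
have E0 : 0 < E by exact: expR_gt0.
have [j Nj uj] := up (e / E) N (divr_gt0 e0 E0).
exists j => //; apply: le_lt_trans (hflow_gronwall _ _ _) _.
by rewrite -ltr_pdivlMr.
Qed.

Lemma symbolE p : symbol V p = 2^-1 * dot p.2 p.2 + V p.1.
Proof. by rewrite /symbol enorm_sqr. Qed.

Lemma hflow_symbol p t : symbol V (hflow p t) = symbol V p.
Proof.
have := @newton_energy R n _ _ _ _ _ (- `|t|) `|t| t 0 (fE 0) (fun s _ => hflow_newton p s).
move=> /(_ (sym_itv_self t) (sym_itv0 t)); rewrite !sub0r !opprK.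
by rewrite !symbolE hflow0.
Qed.

Lemma continuous_symbol : continuous (symbol V).
Proof.
have -> : symbol V = (fun p => 2^-1 * dot p.2 p.2 + V p.1) by apply/funext => p; rewrite symbolE.
move=> p.
have c1 : {for p, continuous (fun p => 2^-1 * dot p.2 p.2)}.
  exact: (continuousM (@cst_continuous _ _ (2^-1 : R) p) (@continuous_dot2 R n p)).
have c0 : {for p, continuous (fun p : 'rV[R]_n * 'rV[R]_n => p.1)} by exact: cvg_fst.
have c2 := @continuous_comp _ _ _ _ V p c0 (lipschitz_gradient_continuous hV (x := p.1)).
exact: (continuousD c1 c2).
Qed.

Lemma hflow_equilibrium t : grad V 0 = 0 -> hflow (0, 0) t = (0, 0).
Proof.
move=> g0.
have H s : newton G (fun=> 0) (fun=> 0) s.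
  move=> i; rewrite /G g0 oppr0; have -> : (0 : 'rV[R]_n) 0 i = 0 by rewrite mxE.
  by split; exact: is_derive_cst.
have := @newton_hflow (fun=> 0) (fun=> 0) (- `|t|) `|t| 0 t (fun s _ => H s).
by rewrite subr0 => /(_ (sym_itv0 t) (sym_itv_self t)) <-.
Qed.

(** Running the flow back from a state near the fixed point [(0, 0)], Gronwall keeps it near for a
    time [t0]. Contrapositively, an orbit based on a fixed sphere needs a time tending to infinity
    to come closer and closer to [(0, 0)]. *)
Lemma near_equilibrium_time (t0 r : R) : grad V 0 = 0 -> 0 < r ->
  exists2 e, 0 < e & forall p t, `|t| <= t0 -> sdist (hflow p t) (0, 0) <= e ->
    dot p.1 p.1 < r.
Proof.
move=> g0 r0; set E := expR (growth * t0).
have E0 : 0 < E by exact: expR_gt0.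
exists (r / (2 * E)); first by rewrite divr_gt0 // mulr_gt0.
move=> p t tt0 hs.
have : sdist p (0, 0) <= r / 2.
  rewrite -{1}(hflowK p t) -(hflow_equilibrium (- t) g0).
  apply: le_trans (hflow_gronwall _ _ _) _.
  apply: (@le_trans _ _ (r / (2 * E) * E)); last by rewrite invfM mulrA divfK // gt_eqF.
  apply: ler_pM; rewrite ?sdist_ge0 ?expR_ge0 // ler_expR normrN.
  by rewrite ler_wpM2l // mulr_ge0 // addr_ge0.
rewrite /sdist !subr0; have := dotxx_ge0 p.2; move: (dot _ _) (dot _ _) => x y; lra.
Qed.

Lemma hflow_velocity_bound p E M : symbol V p = E -> E <= M ->
  dot p.2 p.2 <= 2 * (M + B).
Proof.
rewrite symbolE => pE EM; have [_ [_ _ /(_ p.1) fB _]] := hV.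
by move: fB; rewrite ler_norml => /andP[]; move: pE; move: (dot _ _) (V _) => x y; lra.
Qed.

Lemma bounded_hflow_zero E0 M p : assumption_A3 V E0 -> symbol V p = E0 ->
  (forall t, dot (hflow p t).1 (hflow p t).1 <= M) -> p = (0, 0).
Proof.
move=> hA3 pE pM.
have C0 : 0 <= M by apply: le_trans (pM 0); exact: dotxx_ge0.
have D0 : 0 <= 2 * (E0 + B).
  exact: le_trans (dotxx_ge0 _) (hflow_velocity_bound pE (lexx _)).
rewrite -(hflow0 p).
apply: (@bounded_orbit_zero _ _ V E0 (1 + M + 2 * (E0 + B)) (hflow p) hA3).
- have -> : hflow p = (fun t => ((hflow p t).1, (hflow p t).2)).
    by apply/funext => t; rewrite -surjective_pairing.
  by apply: newton_integral_curve => t; exact: hflow_newton.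
- by rewrite hflow0.
move=> t; split; apply: norm_le_dot.
- by rewrite !addr_ge0.
- by apply: le_trans (pM t) _; move: C0 D0; move: (2 * _) => D; nra.
- by rewrite !addr_ge0.
- apply: le_trans (hflow_velocity_bound (etrans (hflow_symbol p t) pE) (lexx _)) _.
  by move: C0 D0; move: (2 * _) => D; nra.
Qed.

(** * Escape outside a large ball *)

Section Escape.
Variables (E0 r : R).
Hypothesis E00 : 0 < E0.
Hypothesis far : forall x, r ^+ 2 <= dot x x ->
  `|V x| <= E0 / 4 /\ `|dot x (grad V x)| <= E0 / 4.

(** An orbit moving outwards far away has |x|^2 convex, hence stays far away, hence keeps |x|^2
    convex; [convex_growth] resolves this circle. Integrating the lower bound on the second
    derivative twice gives the quadratic growth. *)
Lemma escape_forward p t : E0 <= symbol V p -> r ^+ 2 <= dot p.1 p.1 -> 0 <= dot p.1 p.2 ->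
  0 <= t -> dot p.1 p.1 + E0 * t ^+ 2 <= dot (hflow p t).1 (hflow p t).1.
Proof.
move=> pE pr pv t0.
pose q s := dot (hflow p s).1 (hflow p s).1.
pose dq s := 2 * dot (hflow p s).1 (hflow p s).2.
pose ddq s := 2 * (dot (hflow p s).2 (hflow p s).2 - dot (hflow p s).1 (grad V (hflow p s).1)).
have qd (s : R) : is_derive s (1:R) q (dq s).
  have := is_derive_dot (fun i => (hflow_newton p s i).1) (fun i => (hflow_newton p s i).1).
  by rewrite [X in X + _]dotC /dq mulr_natl mulr2n.
have dqd (s : R) : is_derive s (1:R) dq (ddq s).
  have := @is_deriveZ _ _ _ _ 2 _ _ _ (is_derive_dot (fun i => (hflow_newton p s i).1) (fun i => (hflow_newton p s i).2)).
  by rewrite /G dotNr.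
have q0 : q 0 = dot p.1 p.1 by rewrite /q hflow0.
(* Far away |v|^2 is at least 2 (E0 - E0/4), and the virial term is at most E0/4. *)
have ddq_ge s : r ^+ 2 <= q s -> 2 * E0 <= ddq s.
  move=> /far[]; rewrite !ler_norml => /andP[v1 v2] /andP[d1 d2].
  have := hflow_symbol p s; rewrite symbolE /ddq => E.
  move: pE E00; rewrite -E; move: v1 v2 d1 d2.
  by move: (dot _ _) (dot _ _) (V _) => a b c; lra.
have grow s : 0 <= s -> q 0 <= q s.
  move=> s0; apply: (@convex_growth R q dq ddq 0 s s0) => // [u _ qu|].
    apply: lt_le_trans (ddq_ge u _); first by rewrite mulr_gt0.
    by apply: le_trans qu; rewrite q0.
  by rewrite /dq hflow0 mulr_ge0.
have ddq' s : 0 <= s -> 2 * E0 <= ddq s.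
  by move=> s0; apply: ddq_ge; apply: le_trans (grow s s0); rewrite q0.
have dq_ge s : 0 <= s -> 2 * E0 * s <= dq s.
  move=> s0; have l (u : R) : 0 <= u <= s -> is_derive u (1:R) (fun u : R => 2 * E0 * u) (2 * E0).
    by move=> _; apply: is_derive_eq; rewrite /GRing.scale /= mulr1.
  have H u : 0 <= u <= s -> 2 * E0 <= ddq u by move=> /andP[u0 _]; exact: ddq'.
  have := @derive1_le_incr R _ _ _ _ 0 s s0 l (fun u _ => dqd u) H.
  have : 0 <= dq 0 by rewrite /dq hflow0 mulr_ge0.
  by rewrite mulr0; move: (dq _) (dq _) (_ * s) => a b c; lra.
have l (u : R) : 0 <= u <= t -> is_derive u (1:R) (fun u : R => E0 * u ^+ 2) (2 * E0 * u).
  by move=> _; apply: is_derive_eq; rewrite /GRing.scale /=; ring.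
have H u : 0 <= u <= t -> 2 * E0 * u <= dq u by move=> /andP[u0 _]; exact: dq_ge.
have := @derive1_le_incr R _ _ _ _ 0 t t0 l (fun u _ => qd u) H.
by rewrite q0 expr0n mulr0 subr0 lerBrDl.
Qed.

Lemma escape_backward p t : E0 <= symbol V p -> r ^+ 2 <= dot p.1 p.1 -> dot p.1 p.2 <= 0 ->
  t <= 0 -> dot p.1 p.1 + E0 * t ^+ 2 <= dot (hflow p t).1 (hflow p t).1.
Proof.
move=> pE pr pv t0.
have := @escape_forward (p.1, - p.2) (- t).
rewrite symbolE /= dotNl !dotNr !opprK -symbolE oppr_ge0 sqrrN hflow_reverse /= opprK.
by apply; rewrite ?oppr_ge0.
Qed.

End Escape.
End Dynamics.

(** * Capping the potential *)

Section Cap.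
Variables (R : realType) (e : R).
Hypothesis e0 : 0 < e.
Implicit Types (w z : R).

(* Applied to [E0 - V], [cap] keeps the dynamics where [V <= E0] and makes the
   Jacobi metric at energy [E0 + 2 e] positive everywhere. *)
Definition cap w := if 0 <= w then w else e * w / (e - w).
Definition dcap w := if 0 <= w then 1 else e ^+ 2 / (e - w) ^+ 2.

Let den w : w < 0 -> 0 < e - w.
Proof. by move=> w0; rewrite subr_gt0; exact: lt_trans w0 e0. Qed.

Lemma cap_nonneg w : 0 <= w -> cap w = w.
Proof. by rewrite /cap => ->. Qed.

Lemma dcap_nonneg w : 0 <= w -> dcap w = 1.
Proof. by rewrite /dcap => ->. Qed.

Let cap_neg w : w < 0 -> cap w = e * w / (e - w).
Proof. by rewrite /cap (leNgt 0 w) => ->. Qed.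

Let dcap_neg w : w < 0 -> dcap w = e ^+ 2 / (e - w) ^+ 2.
Proof. by rewrite /dcap (leNgt 0 w) => ->. Qed.

Lemma cap_gt w : - e < cap w.
Proof.
rewrite /cap; case: (leP 0 w) => w0; first by move: e0 w0; lra.
by rewrite ltr_pdivlMr ?den //; move: e0 w0; nra.
Qed.

Lemma cap_norm w : `|cap w| <= `|w|.
Proof.
rewrite /cap; case: (leP 0 w) => // w0; have D := den w0.
rewrite normrM normfV (gtr0_norm D) normrM (gtr0_norm e0) ler_pdivrMr //.
have := normr_ge0 w; move: e0 w0; move: `|w| => a; nra.
Qed.

Lemma dcap_ge0 w : 0 <= dcap w.
Proof. by rewrite /dcap; case: ifP => // _; rewrite divr_ge0 // sqr_ge0. Qed.

Lemma dcap_le1 w : dcap w <= 1.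
Proof.
rewrite /dcap; case: (leP 0 w) => // w0; have D := den w0.
rewrite ler_pdivrMr ?exprn_gt0 // mul1r ler_sqr ?nnegrE ?(ltW D) ?(ltW e0) //.
by rewrite lerDl oppr_ge0 ltW.
Qed.

Lemma dcap_lip w z : `|dcap w - dcap z| <= 2 / e * `|w - z|.
Proof.
have C0 : 0 < 2 / e by rewrite divr_gt0.
have one w' : w' < 0 -> 1 - dcap w' <= 2 / e * - w'.
  move=> w0; rewrite dcap_neg //; have D := den w0.
  rewrite -expr_div_n; set a := e / (e - w').
  have a1 : 1 - a <= - w' / e.
    have -> : 1 - a = - w' / (e - w') by rewrite /a; field; rewrite gt_eqF.
    by rewrite ler_pM2l ?oppr_gt0 // lef_pV2 ?posrE // lerDl oppr_ge0 ltW.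
  rewrite (_ : 2 / e * - w' = 2 * (- w' / e)); last by ring.
  by move: a1; have := sqr_ge0 (1 - a); move: (_ / e) => s; nra.
wlog wz : w z / z <= w.
  move=> W; have [zw|/ltW wz] := leP z w; first exact: W.
  by rewrite distrC [`|w - z|]distrC; exact: W.
rewrite [`|w - z|]ger0_norm ?subr_ge0 //.
have [z0|z0] := leP 0 z.
  rewrite !dcap_nonneg ?(le_trans z0 wz) // subrr normr0; apply: mulr_ge0; first exact: ltW.
  by rewrite subr_ge0.
have [w0|w0] := leP 0 w.
  rewrite (dcap_nonneg w0) ger0_norm ?subr_ge0 ?dcap_le1 //.
  by apply: le_trans (one _ z0) _; rewrite ler_pM2l // lerDr.
have Dz := den z0; have Dw := den w0.
rewrite !dcap_neg //.
pose a := e / (e - w); pose b := e / (e - z).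
have a0 : 0 < a by rewrite divr_gt0.
have b0 : 0 < b by rewrite divr_gt0.
have a1 : a <= 1 by rewrite ler_pdivrMr // mul1r lerDl oppr_ge0 ltW.
have b1 : b <= 1 by rewrite ler_pdivrMr // mul1r lerDl oppr_ge0 ltW.
rewrite -!expr_div_n -/a -/b.
have ba : b <= a.
  by rewrite /a /b ler_pM2l // lef_pV2 ?posrE // lerD2l lerN2.
have ab : a - b <= (w - z) / e.
  have -> : a - b = a * b * ((w - z) / e).
    by rewrite /a /b; field; rewrite !gt_eqF.
  rewrite ler_piMl ?divr_ge0 ?subr_ge0 ?(ltW e0) //.
  by rewrite -[leRHS]mulr1 ler_pM // ltW.
rewrite ger0_norm; last by rewrite subr_ge0 ler_sqr ?nnegrE // ltW.
rewrite (_ : 2 / e * (w - z) = 2 * ((w - z) / e)); last by ring.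
by move: ab; move: (_ / e) => s; nra.
Qed.

(** On the negative side the remainder is explicit, as [key] shows; the delicate case is that of two
    arguments on different sides of 0. *)
Lemma cap_taylor w z : `|cap z - cap w - dcap w * (z - w)| <= (z - w) ^+ 2 / e.
Proof.
have key u v : u < 0 -> v <= 0 -> e * v / (e - v) - e * u / (e - u) - e ^+ 2 / (e - u) ^+ 2 * (v - u)
    = e ^+ 2 * (v - u) ^+ 2 / ((e - u) ^+ 2 * (e - v)).
  move=> u0 v0; have Du := den u0.
  have Dv : 0 < e - v by rewrite subr_gt0; exact: le_lt_trans v0 e0.
  by field; rewrite !gt_eqF.
have key' u v : u < 0 -> v <= 0 ->
    0 <= e ^+ 2 * (v - u) ^+ 2 / ((e - u) ^+ 2 * (e - v)) <= (v - u) ^+ 2 / e.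
  move=> u0 v0; have Du := den u0; have Dv : e <= e - v by rewrite lerDl oppr_ge0.
  have Dv0 := lt_le_trans e0 Dv.
  apply/andP; split.
    by rewrite divr_ge0 // mulr_ge0 ?sqr_ge0 // ltW.
  rewrite ler_pdivrMr ?mulr_gt0 ?exprn_gt0 // [leRHS]mulrAC ler_pdivlMr //.
  have := sqr_ge0 (v - u); move: ((v - u) ^+ 2) => s s0.
  rewrite [e ^+ 2 * _]mulrC -[leLHS]mulrA; apply: ler_wpM2l => //.
  rewrite ler_pM ?sqr_ge0 ?(ltW e0) // ler_sqr ?nnegrE ?(ltW e0) ?(ltW Du) //.
  by rewrite lerDl oppr_ge0 ltW.
have [w0|w0] := leP 0 w; have [z0|z0] := leP 0 z.
- rewrite !cap_nonneg // dcap_nonneg // mul1r subrr normr0 divr_ge0 ?sqr_ge0 //.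
  exact: ltW.
- rewrite (cap_nonneg w0) (dcap_nonneg w0) cap_neg // mul1r.
  have D := den z0.
  have -> : e * z / (e - z) - w - (z - w) = z ^+ 2 / (e - z).
    by field; rewrite gt_eqF.
  rewrite ger0_norm ?divr_ge0 ?sqr_ge0 ?(ltW D) //.
  rewrite ler_pM ?sqr_ge0 ?invr_ge0 ?(ltW D) // ?lef_pV2 ?posrE // ?lerDl ?oppr_ge0 ?(ltW z0) //.
  by move: w0 z0; nra.
- rewrite (cap_nonneg z0) cap_neg // dcap_neg //.
  have K := key w 0 w0 (lexx _); have /andP[k1 k2] := key' w 0 w0 (lexx _).
  (* The increment is split at 0. The slope at [w] falls short of 1 by at most [2 / e * - w], and
     the two errors add up to [((z - w) ^+ 2 - z ^+ 2) / e]. *)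
  rewrite (_ : z - _ - _ = z * (1 - e ^+ 2 / (e - w) ^+ 2) +
    (e * 0 / (e - 0) - e * w / (e - w) - e ^+ 2 / (e - w) ^+ 2 * (0 - w))); last first.
    by rewrite mulr0 mul0r; move: (_ / _) (_ / _) => a b; ring.
  rewrite K.
  have d1 := dcap_le1 w; have := dcap_lip 0 w; rewrite (dcap_nonneg (lexx _)) dcap_neg // => d2.
  move: d1; rewrite dcap_neg // => d1.
  move: d2; rewrite ger0_norm ?subr_ge0 // sub0r normrN (ltr0_norm w0) => d2.
  have P : 0 <= z * (1 - e ^+ 2 / (e - w) ^+ 2) by rewrite mulr_ge0 // subr_ge0.
  rewrite sub0r in k1 k2; rewrite ger0_norm; last exact: (addr_ge0 P k1).
  apply: le_trans (lerD (ler_wpM2l z0 d2) k2) _.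
  rewrite (_ : _ + _ = ((z - w) ^+ 2 - z ^+ 2) / e); last by ring.
  by rewrite ler_wpM2r ?invr_ge0 ?(ltW e0) // gerBl sqr_ge0.
rewrite !cap_neg // dcap_neg // (key w z w0 (ltW z0)).
by have /andP[k1 k2] := key' w z w0 (ltW z0); rewrite (ger0_norm k1); exact: k2.
Qed.

End Cap.

Section CapPotential.
Variables (R : realType) (n : nat) (W : 'rV[R]_n -> R) (G : 'rV[R]_n -> 'rV[R]_n) (B e : R).
Hypothesis e0 : 0 < e.
Hypothesis hW : lipschitz_gradient W G B.

(** The Taylor bound serves at distance at most 1, the sup bound beyond; the result controls the
    variation of [dcap e (W x)]. *)
Lemma lipschitz_gradient_value_lip (x y : 'rV[R]_n) : `|W y - W x| <= (n%:R + 2) * B * `|y - x|.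
Proof.
have [B0 [_ fT fB GB]] := hW.
have [small|/ltW big] := leP `|y - x| 1.
  rewrite -(subrK (dot (G x) (y - x)) (W y - W x)).
  apply: le_trans (ler_normD _ _) _.
  have h1 : `|dot (G x) (y - x)| <= n%:R * B * `|y - x|.
    apply: le_trans (norm_dot_le _ _) _; apply: ler_wpM2r => //.
    by apply: ler_wpM2l => //; exact: ler0n.
  have h2 : B * `|y - x| ^+ 2 <= B * `|y - x|.
    by rewrite ler_pM2l // expr2 ler_piMr.
  have h3 : 0 <= B * `|y - x| by rewrite mulr_ge0 // ltW.
  have := le_trans (fT x y) h2.
  move=> h4; rewrite [leLHS]addrC; apply: le_trans (lerD h1 h4) _; rewrite !mulrDl lerD2l.
  by move: h3; rewrite -mulrA; lra.
apply: le_trans (ler_normB _ _) _; apply: le_trans (lerD (fB _) (fB _)) _.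
have h4 : 2 * B <= (n%:R + 2) * B by rewrite ler_wpM2r ?(ltW B0) // lerDr.
apply: (@le_trans _ _ (2 * B * `|y - x|)); first by rewrite mulrDl mul1r ler_peMr // addr_ge0 // ltW.
by rewrite ler_wpM2r.
Qed.

Lemma cap_lipschitz_gradient :
  exists C, lipschitz_gradient (fun x => 2 * e + cap e (W x)) (fun x => dcap e (W x) *: G x) C.
Proof.
have [B0 [GL fT fB GB]] := hW.
pose D := (n%:R + 2) * B.
have D0 : 0 <= D by rewrite mulr_ge0 ?addr_ge0 ?ler0n // ltW.
(* In turn: the Lipschitz constant of the new gradient, the Taylor constant, and a common sup bound
   for the function and its gradient. *)
pose C1 := 2 / e * D * B + B; pose C2 := D ^+ 2 / e + B; pose C3 := 2 * e + B.
have P1 : 0 <= 2 / e * D * B by apply: mulr_ge0; [apply: mulr_ge0 => //; apply: divr_ge0 => //; exact: ltW|exact: ltW].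
have P2 : 0 <= D ^+ 2 / e by apply: divr_ge0; [exact: exprn_ge0|exact: ltW].
have C10 : 0 < C1 by apply: ltr_wpDl.
have C20 : 0 < C2 by apply: ltr_wpDl.
have C30 : 0 < C3 by rewrite addr_gt0 // mulr_gt0.
have le1 : C1 <= C1 + C2 + C3.
  by rewrite -[leRHS]addrA lerDl; exact: (ltW (addr_gt0 C20 C30)).
have le2 : C2 <= C1 + C2 + C3.
  by rewrite [C1 + C2]addrC -[leRHS]addrA lerDl; exact: (ltW (addr_gt0 C10 C30)).
have le3 : C3 <= C1 + C2 + C3.
  by rewrite lerDr; exact: (ltW (addr_gt0 C10 C20)).
exists (C1 + C2 + C3); split; first exact: (addr_gt0 (addr_gt0 C10 C20) C30).
split => [x y|x y|x|x].
- apply: (@le_trans _ _ (C1 * `|x - y|)); last first.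
    exact: ler_wpM2r.
  rewrite (_ : _ - _ = (dcap e (W x) - dcap e (W y)) *: G x + dcap e (W y) *: (G x - G y)); last first.
    by rewrite scalerBl scalerBr addrA subrK.
  apply: le_trans (ler_normD _ _) _; rewrite !normrZ mulrDl; apply: lerD.
    rewrite (_ : 2 / e * D * B * `|x - y| = 2 / e * (D * `|x - y|) * B); last by ring.
    apply: ler_pM => //; apply: le_trans (dcap_lip e0 _ _) _.
    by rewrite ler_wpM2l ?divr_ge0 ?(ltW e0) // lipschitz_gradient_value_lip.
  rewrite ger0_norm ?dcap_ge0 //; apply: le_trans (ler_piMl _ (dcap_le1 e0 _)) (GL _ _).
  exact: normr_ge0.
- apply: (@le_trans _ _ (C2 * `|y - x| ^+ 2)); last first.
    by apply: ler_wpM2r => //; exact: exprn_ge0.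
  rewrite dotZl (_ : _ - _ - _ = (cap e (W y) - cap e (W x) - dcap e (W x) * (W y - W x)) +
      dcap e (W x) * (W y - W x - dot (G x) (y - x))); last first.
    move: (W y) (W x) (dot _ _) (cap e (W y)) (cap e (W x)) (dcap e (W x)) => a b c w z s.
    by ring.
  apply: le_trans (ler_normD _ _) _; rewrite mulrDl; apply: lerD.
    apply: le_trans (cap_taylor e0 _ _) _.
    rewrite [leRHS]mulrAC; apply: ler_wpM2r; first by rewrite invr_ge0 ltW.
    rewrite -exprMn -[leLHS]real_normK ?num_real // ler_sqr ?nnegrE //; last exact: mulr_ge0.
    exact: lipschitz_gradient_value_lip.
  rewrite normrM ger0_norm ?dcap_ge0 //; apply: le_trans (ler_piMl _ (dcap_le1 e0 _)) (fT _ _).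
  exact: normr_ge0.
- apply: (@le_trans _ _ C3); last exact: le3.
  apply: le_trans (ler_normD _ _) _; rewrite ger0_norm ?mulr_ge0 ?(ltW e0) // lerD2l.
  exact: le_trans (cap_norm e0 _) (fB _).
- apply: (@le_trans _ _ C3); last exact: le3.
  rewrite normrZ ger0_norm ?dcap_ge0 //; apply: le_trans (ler_piMl _ (dcap_le1 e0 _)) _ => //.
  apply: le_trans (GB x) _; rewrite lerDr mulr_ge0 //; exact: ltW.
Qed.

End CapPotential.

(** * The maximum is global and strict *)

Lemma inv_succ_small (R : realType) (e : R) : 0 < e ->
  exists N, forall j, (N <= j)%N -> (j.+1%:R : R)^-1 <= e.
Proof.
move=> e0; exists (Num.truncn e^-1) => j Nj.
rewrite -[leRHS]invrK lef_pV2 ?posrE ?invr_gt0 //.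
have /andP[_ /ltW H] := truncn_itv (ltW (etrans (invr_gt0 e) e0)).
by apply: le_trans H _; rewrite ler_nat ltnS.
Qed.

Lemma grad_local_max (R : realType) n (V : 'rV[R]_n -> R) :
  (forall x i, derivable V x (delta_mx 0 i)) ->
  (\forall x \near (0 : 'rV[R]_n), V x <= V 0) -> grad V 0 = 0.
Proof.
move=> dV /nbhs_ballP[e /= e0 H]; apply/rowP => i; rewrite !mxE.
have D (h : R) : is_derive h (1:R) (fun h : R => V (0 + h *: delta_mx 0 i)) (partial i V (0 + h *: delta_mx 0 i)).
  by apply: is_derive_line; exact: derivableP.
have M : is_derive (0:R) (1:R) (fun h : R => V (0 + h *: delta_mx 0 i)) 0.
  apply: (@derive1_at_max R _ (- e) e 0) => [|t _||t].
  - by rewrite ge0_cp // ltW.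
  - by case: (D t).
  - by rewrite in_itv /= oppr_lt0 e0.
  rewrite in_itv /= scale0r addr0 => te; apply: H.
  rewrite -ball_normE /= sub0r normrN add0r normrZ.
  apply: le_lt_trans (_ : `|t| < e); last by rewrite ltr_norml.
  by rewrite ler_piMr // norm_delta_le.
case: (D 0) => _; case: M => _ ->.
by rewrite scale0r addr0 => <-.
Qed.

Section ClusterEq.
Variables (R : realType) (n : nat).

Lemma cluster_point_eq (u : nat -> 'rV[R]_n * 'rV[R]_n) p
    (g : 'rV[R]_n * 'rV[R]_n -> R) c : continuous g -> cluster_point u p ->
  (forall e, 0 < e -> exists N, forall j, (N <= j)%N -> `|g (u j) - c| <= e) -> g p = c.
Proof.
move=> gc up H; apply/le_anti/andP; split.
  apply: (cluster_point_le gc up) => e /H[N HN]; exists N => j /HN.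
  by rewrite ler_norml => /andP[_]; rewrite lerBlDl.
rewrite -lerN2.
have ngc : continuous (fun q => - g q) by move=> q; exact: continuousN (gc q).
apply: (cluster_point_le ngc up) => e /H[N HN]; exists N => j /HN.
by rewrite ler_norml => /andP[+ _]; move: (g _) => y; lra.
Qed.

Lemma dot_sub_bound (x y : 'rV[R]_n) : dot x x <= 2 * dot y y + 2 * dot (x - y) (x - y).
Proof.
have := dotxx_ge0 (x - y - y).
rewrite !dotBl !dotBr (dotC y x); move: (dot x x) (dot x y) (dot y y) => a b c; lra.
Qed.

End ClusterEq.

Section GlobalMaximum.
Variables (R : realType) (n : nat) (V : 'rV[R]_n -> R) (E0 B r : R).
Hypothesis hV : lipschitz_gradient V (grad V) B.
Hypothesis E00 : 0 < E0.
Hypothesis V0 : V 0 = E0.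
Hypothesis g0 : grad V 0 = 0.
Hypothesis r0 : 0 < r.
Hypothesis far : forall x, r ^+ 2 <= dot x x ->
  `|V x| <= E0 / 4 /\ `|dot x (grad V x)| <= E0 / 4.

(* [p] is the state where a capped trajectory from the origin to [x1] leaves the
   ball of radius [d], and [b] the time it then takes to reach [V = E0]. *)
Lemma capped_trajectory (x1 : 'rV[R]_n) (d e : R) : 0 < d -> 0 < e ->
  d ^+ 2 <= dot x1 x1 -> E0 <= V x1 -> (forall x, dot x x <= d ^+ 2 -> V x <= E0) ->
  exists p a b, [/\ (0 <= a) /\ (0 <= b), dot p.1 p.1 = d ^+ 2 /\ symbol V p = E0 + 2 * e,
    sdist (hflow V p (- a)) (0, 0) = 4 * e,
    dot (hflow V p b).2 (hflow V p b).2 = 4 * e &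
    forall s, - a <= s <= b -> dot (hflow V p s).1 (hflow V p s).1 <= r ^+ 2].
Proof.
move=> d0 e0 dx1 Vx1 Vd.
have x1N0 : 0 <> x1.
  by move=> E; move: dx1; rewrite -E dot0l leNgt exprn_gt0.
have [C fC] := cap_lipschitz_gradient e0 (lipschitz_gradient_cstB E0 hV).
set f := (fun x => _ + _) in fC; set G := (fun x => _ *: _) in fC.
have fe x : e <= f x.
  by rewrite /f; have := cap_gt e0 (E0 - V x); move: (cap _ _) => c; lra.
have fV x : V x <= E0 -> f x = 2 * e + E0 - V x.
  by move=> Vx; rewrite /f cap_nonneg ?subr_ge0 // addrA.
have GV x : V x <= E0 -> G x = - grad V x.
  by move=> Vx; rewrite /G dcap_nonneg ?subr_ge0 // scale1r.
have [T [v0 [T0 xT v0E]]] := connecting_trajectory fC e0 fe x1N0.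
have C0 := lipschitz_gradient_ge0 fC.
have GL := lipschitz_gradient_lip fC.
pose x t := (flow G (0, v0) t).1; pose v t := (flow G (0, v0) t).2.
have xv t : newton G x v t by exact: (flow_newton C0 GL).
have f0 : flow G (0, v0) 0 = (0, v0) by exact: (flow0 C0 GL).
have x0 : x 0 = 0 by rewrite /x f0.
have v00 : v 0 = v0 by rewrite /v f0.
have energy t : 0 <= t <= T -> 2^-1 * dot (v t) (v t) = f (x t).
  move=> tT; have T0T : (0 : R) <= 0 <= T by rewrite lexx ltW.
  have := newton_energy fC (fun t _ => xv t) tT T0T.
  by rewrite v00 x0 v0E subrr => /eqP; rewrite subr_eq0 => /eqP.
have xd (t : R) i : is_derive t (1:R) (fun s => x s 0 i) (v t 0 i) by exact: (xv t i).1.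
have qd (t : R) := is_derive_dot (fun i => xd t i) (fun i => xd t i).
have Vd' (t : R) := is_derive_potential hV (fun i => xd t i).
(* The first exit from the ball of radius [d] supplies a base point away from the origin. *)
have [t0 /andP[t00 t0T] [qt0 qle]] : exists2 s, 0 <= s <= T & dot (x s) (x s) = d ^+ 2 /\
    forall t, 0 <= t <= s -> dot (x t) (x t) <= d ^+ 2.
  apply: (first_hitting (f := fun t => dot (x t) (x t)) (ltW T0)).
  - exact: (derive1_within_continuous (fun t _ => qd t)).
  - by rewrite x0 dot0l exprn_ge0 // ltW.
  - by rewrite /x xT.
(* Up to [tau] the potential does not exceed [E0], where capping changes nothing: the trajectory is
   a Hamiltonian one of energy [E0 + 2 * e]. *)
have [tau /andP[t0tau tauT] [Vtau Vle]] : exists2 s, t0 <= s <= T & V (x s) = E0 /\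
    forall t, t0 <= t <= s -> V (x t) <= E0.
  apply: (first_hitting (f := fun t => V (x t)) t0T).
  - exact: (derive1_within_continuous (fun t _ => Vd' t)).
  - by apply: Vd; rewrite qt0.
  - by rewrite /x xT.
have Vle' t : 0 <= t <= tau -> V (x t) <= E0.
  move=> /andP[t_0 tt]; have [tt0|/ltW tt0] := leP t t0.
    by apply/Vd/qle; rewrite t_0.
  by apply: Vle; rewrite tt0.
have xvV t : 0 <= t <= tau -> newton (fun x => - grad V x) x v t.
  by move=> tt; apply: newton_ext (xv t); exact/GV/Vle'.
have t0in : 0 <= t0 <= tau by rewrite t00.
pose p := (x t0, v t0).
have H t : 0 <= t <= tau -> (x t, v t) = hflow V p (t - t0).
  by move=> tt; exact: (newton_hflow hV xvV t0in tt).
have tau0 : 0 <= tau by exact: le_trans t00 t0tau.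
have i0 : (0 : R) <= 0 <= tau by rewrite lexx.
have itau : 0 <= tau <= tau by rewrite lexx andbT.
have Ha : hflow V p (- t0) = (0, v0) by rewrite -[- t0]add0r -H // x0 v00.
have Hb : hflow V p (tau - t0) = (x tau, v tau) by rewrite -H.
have pq : dot p.1 p.1 = d ^+ 2 by [].
have pE : symbol V p = E0 + 2 * e.
  rewrite symbolE /= energy ?t00 //= fV; last by apply: Vle'.
  by move: (V _) => y; lra.
exists p, t0, (tau - t0); split => //.
- by rewrite subr_ge0.
- rewrite Ha /sdist /= !subr0 dot0l add0r.
  have := energy 0; rewrite lexx ltW // => /(_ isT); rewrite v00 x0 fV ?V0 //.
  by move: (dot _ _) => D; lra.
- rewrite Hb /=; have := energy tau; rewrite tau0 tauT => /(_ isT); rewrite fV Vtau //.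
  by move: (dot _ _) => D; lra.
move=> s /andP[s1 s2]; rewrite leNgt; apply/negP => qs.
have zE : E0 <= symbol V (hflow V p s) by rewrite (hflow_symbol hV) pE lerDl mulr_ge0 // ltW.
(* A state outside the ball of radius [r] that moves outwards would still be far at time [tau],
   where [V = E0] exceeds [E0 / 4]; one that moves inwards would have been far at time 0, when the
   trajectory is at the origin. *)
have [zv|/ltW zv] := leP 0 (dot (hflow V p s).1 (hflow V p s).2).
  have := escape_forward hV E00 far zE (ltW qs) zv (t := tau - t0 - s).
  rewrite subr_ge0 => /(_ s2); rewrite -(hflowD hV) [s + _]addrC subrK Hb /= => q1.
  have : r ^+ 2 <= dot (x tau) (x tau).
    apply: le_trans q1; apply: le_trans (ltW qs) _; rewrite lerDl mulr_ge0 ?sqr_ge0 //.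
    exact: ltW.
  by move=> /far[+ _]; rewrite Vtau (ger0_norm (ltW E00)); move: E00; lra.
have := escape_backward hV E00 far zE (ltW qs) zv (t := - t0 - s).
rewrite subr_le0 => /(_ s1); rewrite -(hflowD hV) [s + _]addrC subrK Ha /= dot0l => q1.
have : 0 < dot (hflow V p s).1 (hflow V p s).1 + E0 * (- t0 - s) ^+ 2.
  apply: ltr_wpDr; first by rewrite mulr_ge0 ?sqr_ge0 // ltW.
  by apply: lt_trans qs; exact: exprn_gt0.
by rewrite ltNge q1.
Qed.

Hypothesis hA3 : assumption_A3 V E0.
Hypothesis Vmax : \forall x \near (0 : 'rV[R]_n), V x <= V 0.

(** The limit orbit is non-trivial, since it meets the sphere of radius [d]. It is bounded in the
    past because leaving the origin takes longer and longer, and in the future because the orbits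
    stay in the ball until time [b j], when they turn back. *)
Lemma potential_lt x1 : x1 != 0 -> V x1 < E0.
Proof.
move=> /eqP x1N0; rewrite ltNge; apply/negP => Vx1.
have q1 : 0 < dot x1 x1.
  by rewrite lt_neqAle dotxx_ge0 andbT eq_sym; apply/eqP => /dotxx_eq0.
(* The ball must leave [x1] outside its interior and lie where the maximum at the origin is known;
   the sup norm is at most the Euclidean one. *)
have [d d0 [dx1 Vd]] : exists2 d, 0 < d & d ^+ 2 <= dot x1 x1 /\ forall x, dot x x <= d ^+ 2 -> V x <= E0.
  have /nbhs_ballP[e /= e0 H] := Vmax.
  pose s := Num.sqrt (dot x1 x1); have s0 : 0 < s by rewrite sqrtr_gt0.
  exists (Num.min s (e / 2)); first by rewrite lt_min s0 divr_gt0.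
  have m0 : 0 <= Num.min s (e / 2) by rewrite le_min (ltW s0) ltW // divr_gt0.
  split.
    have ss : s ^+ 2 = dot x1 x1 by rewrite sqr_sqrtr // ltW.
    rewrite -ss; have ms : Num.min s (e / 2) <= s by rewrite ge_min lexx.
    by rewrite ler_sqr ?nnegrE ?(ltW s0).
  move=> x xm; rewrite -V0; apply: H; rewrite -ball_normE /= sub0r normrN.
  have := norm_le_dot m0 xm; rewrite le_min => /andP[_].
  by move=> /le_lt_trans; apply; move: e0; lra.
pose e j : R := j.+1%:R^-1.
have e0 j : 0 < e j by rewrite invr_gt0.
have e1 j : e j <= 1 by rewrite invf_le1 // ler1n.
have /choice[u /choice[a /choice[b H]]] : forall j, exists p a b,
    [/\ (0 <= a) /\ (0 <= b), dot p.1 p.1 = d ^+ 2 /\ symbol V p = E0 + 2 * e j,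
    sdist (hflow V p (- a)) (0, 0) = 4 * e j,
    dot (hflow V p b).2 (hflow V p b).2 = 4 * e j &
    forall s, - a <= s <= b -> dot (hflow V p s).1 (hflow V p s).1 <= r ^+ 2].
  by move=> j; exact: capped_trajectory dx1 Vx1 Vd.
have B0 : 0 < B by case: hV.
pose M := d + (1 + 2 * (E0 + 2 + B)).
have [p up] : exists p, cluster_point u p.
  apply: (@bounded_cluster_point _ _ u M) => j; have [_ [uq uE] _ _ _] := H j.
  have D0 : 0 <= 2 * (E0 + 2 + B) by move: E00 B0; lra.
  split; apply: norm_le_dot.
  - by rewrite !addr_ge0 // ltW.
  - rewrite uq ler_sqr ?nnegrE ?(ltW d0) //; last by rewrite !addr_ge0 // ltW.
    by rewrite lerDl addr_ge0.
  - by rewrite !addr_ge0 // ltW.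
  - have le2 : E0 + 2 * e j <= E0 + 2 by have := e1 j; lra.
    apply: le_trans (hflow_velocity_bound hV uE le2) _.
    by rewrite /M; move: d0 D0; move: (2 * (E0 + 2 + B)) => D; nra.
have pq : dot p.1 p.1 = d ^+ 2.
  apply: (cluster_point_eq (@continuous_dot1 R n) up) => s s0; exists 0%N => j _.
  by have [_ [-> _] _ _ _] := H j; rewrite subrr normr0 ltW.
have pE : symbol V p = E0.
  apply: (cluster_point_eq (continuous_symbol hV) up) => s s0.
  have s20 : 0 < s / 2 by rewrite divr_gt0.
  have [N HN] := inv_succ_small s20; exists N => j /HN ej.
  have [_ [_ ->] _ _ _] := H j; rewrite addrAC subrr add0r ger0_norm ?mulr_ge0 ?(ltW (e0 j)) //.
  by move: ej; rewrite -/(e j); lra.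
have bd t : dot (hflow V p t).1 (hflow V p t).1 <= 2 * r ^+ 2 + 2.
  apply: (cluster_point_le (@continuous_dot1 R n) (cluster_point_hflow hV t up)) => s s0.
  have [z z0 Hz] := near_equilibrium_time hV `|t| g0 (exprn_gt0 2 d0).
  pose k := expR (growth n B * `|t|).
  have k0 : 0 < k by exact: expR_gt0.
  have [N1 HN1] := inv_succ_small (divr_gt0 z0 (ltr0n R 4)).
  have [N2 HN2] := inv_succ_small (divr_gt0 (ltr0n R 1) (mulr_gt0 (ltr0n R 16) k0)).
  (* [N1] ensures [4 * e j <= z], for the time [a j]; [N2] ensures [16 * e j * k <= 1], for the
     comparison with the reversed orbit. *)
  exists (maxn N1 N2) => j; rewrite geq_max => /andP[/HN1 ez /HN2 ek].
  suff : dot (hflow V (u j) t).1 (hflow V (u j) t).1 <= 2 * r ^+ 2 + 2.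
    by move: s0; move: (dot _ _) => D; lra.
  have [[a0 b0] [uq uE] ua ub ur] := H j.
  (* Otherwise the base point would be within time |t| of a state close to the equilibrium, hence
     strictly inside the ball of radius [d]. *)
  have at_ : `|t| < a j.
    rewrite ltNge; apply/negP => aj.
    suff : d ^+ 2 < d ^+ 2 by rewrite ltxx.
    rewrite -{1}uq; apply: (Hz _ (- a j)); first by rewrite normrN (ger0_norm a0).
    by rewrite ua; move: ez; rewrite -/(e j); lra.
  have r20 : 0 <= r ^+ 2 by rewrite exprn_ge0 // ltW.
  have easy s' : - a j <= s' <= b j -> dot (hflow V (u j) s').1 (hflow V (u j) s').1 <= 2 * r ^+ 2 + 2.
    by move=> /ur; move: r20; move: (dot _ _) (r ^+ 2) => D q; lra.
  have [tb|/ltW bt] := leP t (b j).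
    by apply: easy; rewrite tb andbT; move: at_; rewrite ltr_norml => /andP[/ltW].
  (* At time [b j] the velocity is small, so the orbit nearly retraces its past. *)
  pose z1 := hflow V (u j) (b j); pose s1 := t - b j.
  have s10 : 0 <= s1 by rewrite subr_ge0.
  have E1 : hflow V (u j) t = hflow V z1 s1 by rewrite -(hflowD hV) [b j + _]addrC subrK.
  have E2 : (hflow V (z1.1, - z1.2) s1).1 = (hflow V (u j) (b j - s1)).1.
    by rewrite (hflow_reverse hV) /= -(hflowD hV).
  (* The retraced time [2 * b j - t] is still later than [- a j], because |t| < [a j]. *)
  have q2 : dot (hflow V (u j) (b j - s1)).1 (hflow V (u j) (b j - s1)).1 <= r ^+ 2.
    apply: ur; rewrite lerBlDr lerDl s10 andbT /s1; have := ler_norm t.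
    by move: at_ b0; move: `|t| => m; lra.
  have sd : sdist (hflow V z1 s1) (hflow V (z1.1, - z1.2) s1) <= 1.
    apply: le_trans (hflow_gronwall hV _ _ _) _.
    have -> : sdist z1 (z1.1, - z1.2) = 16 * e j.
      rewrite /sdist /= subrr dot0l add0r opprK !dotDl !dotDr ub.
      by move: (e j) => m; ring.
    apply: (@le_trans _ _ (16 * e j * k)); last first.
      by move: ek; rewrite -/(e j) ler_pdivlMr ?mulr_gt0 // mulrA [_ * 16]mulrC.
    apply: ler_wpM2l; first by rewrite mulr_ge0 // ltW.
    rewrite ler_expR; apply: ler_wpM2l.
      by rewrite mulr_ge0 // addr_ge0 // ltW.
    rewrite (ger0_norm s10); apply: le_trans (ler_norm t); rewrite /s1.
    by move: b0; lra.
  rewrite E1; apply: le_trans (dot_sub_bound _ (hflow V (z1.1, - z1.2) s1).1) _.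
  rewrite {1 2}E2; apply: lerD; first by rewrite ler_pM2l.
  rewrite -[leRHS]mulr1 ler_pM2l //; apply: le_trans sd.
  by rewrite /sdist lerDl dotxx_ge0.
have : p = (0, 0) by exact: (bounded_hflow_zero hV hA3 pE bd).
by move=> p0; move: pq; rewrite p0 /= dot0l => /esym/eqP; rewrite gt_eqF ?exprn_gt0.
Qed.

End GlobalMaximum.

(** * Trajectories ending at the origin *)

Section Incoming.
Variables (R : realType) (n : nat) (V : 'rV[R]_n -> R) (E0 B r : R).
Hypothesis hV : lipschitz_gradient V (grad V) B.
Hypothesis E00 : 0 < E0.
Hypothesis V0 : V 0 = E0.
Hypothesis g0 : grad V 0 = 0.
Hypothesis r0 : 0 < r.
Hypothesis far : forall x, r ^+ 2 <= dot x x ->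
  `|V x| <= E0 / 4 /\ `|dot x (grad V x)| <= E0 / 4.
Hypothesis Vle : forall x, V x <= E0.
Hypothesis hA3 : assumption_A3 V E0.

(* [p] is the state where a trajectory from [y] to the origin enters the ball of
   radius [r]. *)
Lemma trajectory_to_origin (y : 'rV[R]_n) (e : R) : 0 < e -> r ^+ 2 <= dot y y ->
  exists p a b, [/\ (0 <= a) /\ (0 <= b),
    [/\ dot p.1 p.1 = r ^+ 2, symbol V p = E0 + e & dot p.1 p.2 <= 0],
    (hflow V p (- a)).1 = y, sdist (hflow V p b) (0, 0) = 2 * e &
    forall s, 0 <= s <= b -> dot (hflow V p s).1 (hflow V p s).1 <= r ^+ 2].
Proof.
move=> e0 ry.
have r20 : 0 < r ^+ 2 by exact: exprn_gt0.
have yN0 : y <> 0 by move=> E; move: ry; rewrite E dot0l leNgt r20.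
have fC := lipschitz_gradient_cstB (E0 + e) hV.
have fe x : e <= E0 + e - V x by have := Vle x; move: (V x) => w; lra.
have [T [v0 [T0 xT v0E]]] := connecting_trajectory fC e0 fe yN0.
pose g := hflow V (y, v0).
have gT : (g T).1 = 0 by exact: xT.
have gE t : symbol V (g t) = E0 + e.
  by rewrite (hflow_symbol hV) symbolE /= v0E subrK.
have xd (t : R) i : is_derive t (1:R) (fun s => (g s).1 0 i) ((g t).2 0 i).
  by exact: (hflow_newton hV (y, v0) t i).1.
have qd (t : R) : is_derive t (1:R) (fun s => - dot (g s).1 (g s).1) (- (dot (g t).2 (g t).1 + dot (g t).1 (g t).2)).
  exact: (is_deriveN (is_derive_dot (fun i => xd t i) (fun i => xd t i))).
(* The ball is entered from outside, so the crossing is that of minus |x|^2 through [- r ^+ 2]. *)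
have [t1 /andP[t10 t1T] [qt1 _]] : exists2 s, 0 <= s <= T & - dot (g s).1 (g s).1 = - r ^+ 2 /\
    forall t, 0 <= t <= s -> - dot (g t).1 (g t).1 <= - r ^+ 2.
  apply: (first_hitting (f := fun t => - dot (g t).1 (g t).1) (ltW T0)).
  - exact: (derive1_within_continuous (fun t _ => qd t)).
  - by rewrite lerN2 /g (hflow0 hV).
  - by rewrite gT dot0l lerN2 ltW.
have {}qt1 : dot (g t1).1 (g t1).1 = r ^+ 2 by apply: oppr_inj.
have shift s : hflow V (g t1) s = g (t1 + s) by rewrite /g (hflowD hV).
(* An orbit that moved outwards outside the ball could no longer reach the origin at time [T]. *)
have noesc s : 0 <= s <= T -> r ^+ 2 <= dot (g s).1 (g s).1 -> dot (g s).1 (g s).2 <= 0.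
  move=> /andP[s0 sT] qs; rewrite leNgt; apply/negP => /ltW zv.
  have zE : E0 <= symbol V (g s) by rewrite gE lerDl ltW.
  have := escape_forward hV E00 far zE qs zv (t := T - s).
  rewrite subr_ge0 => /(_ sT); rewrite /g -(hflowD hV) [s + _]addrC subrK -/g gT dot0l.
  apply/negP; rewrite -ltNge; apply: ltr_pwDl; first exact: lt_le_trans qs.
  by rewrite mulr_ge0 ?sqr_ge0 // ltW.
have iT1 : 0 <= t1 <= T by rewrite t10.
exists (g t1), t1, (T - t1); split.
- by rewrite subr_ge0.
- by split => //; apply: noesc => //; rewrite qt1.
- by rewrite shift subrr /g (hflow0 hV).
- rewrite shift addrC subrK /sdist gT /= !subr0 dot0l add0r.
  by have := gE T; rewrite symbolE gT V0; move: (dot _ _) => D; lra.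
move=> s /andP[s0 sb]; rewrite shift leNgt; apply/negP => qs.
have sT : 0 <= t1 + s <= T by rewrite addr_ge0 // -lerBrDl.
have zE : E0 <= symbol V (g (t1 + s)) by rewrite gE lerDl ltW.
(* Were the orbit outside the ball after its entrance, it would be moving inwards there, hence would
   have been farther still at time [t1], against [qt1]. *)
have zv := noesc _ sT (ltW qs).
have := escape_backward hV E00 far zE (ltW qs) zv (t := - s).
rewrite oppr_le0 => /(_ s0); rewrite {2 3}/g -(hflowD hV) addrK -/g qt1.
apply/negP; rewrite -ltNge; apply: ltr_wpDr => //.
by rewrite mulr_ge0 ?sqr_ge0 // ltW.
Qed.

(** An omega-limit argument: a cluster point of the orbit at times tending to infinity has a whole
    orbit inside the same ball, since any fixed negative shift is eventually absorbed; by (A3) it is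
    the origin. *)
Lemma bounded_forward_cvg M p : symbol V p = E0 ->
  (forall t, 0 <= t -> dot (hflow V p t).1 (hflow V p t).1 <= M) ->
  forall e, 0 < e -> exists A, forall t, A <= t -> sdist (hflow V p t) (0, 0) < e.
Proof.
move=> pE pM e e0.
have [//|nA] := pselect (exists A, forall t, A <= t -> sdist (hflow V p t) (0, 0) < e).
have /choice[t Ht] : forall k : nat, exists t, k%:R <= t /\ e <= sdist (hflow V p t) (0, 0).
  move=> k; have /existsNP[t /not_implyP[kt /negP]] : ~ (forall t, k%:R <= t -> sdist (hflow V p t) (0, 0) < e).
    by move=> H; apply: nA; exists k%:R.
  by rewrite -leNgt; exists t.
pose u k := hflow V p (t k).
have t0 k : 0 <= t k by apply: le_trans (Ht k).1.
have M0 : 0 <= M by apply: le_trans (pM _ (lexx 0)); exact: dotxx_ge0.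
have uE k : symbol V (u k) = E0 by rewrite (hflow_symbol hV).
have D0 : 0 <= 2 * (E0 + B).
  exact: le_trans (dotxx_ge0 _) (hflow_velocity_bound hV pE (lexx _)).
have [q uq] : exists q, cluster_point u q.
  apply: (@bounded_cluster_point _ _ u (1 + M + 2 * (E0 + B))) => k; split; apply: norm_le_dot.
  - by rewrite !addr_ge0.
  - by apply: le_trans (pM _ (t0 k)) _; move: M0 D0; move: (2 * _) => D; nra.
  - by rewrite !addr_ge0.
  - apply: le_trans (hflow_velocity_bound hV (uE k) (lexx _)) _.
    by move: M0 D0; move: (2 * _) => D; nra.
have q0 : q = (0, 0).
  apply: (bounded_hflow_zero (M := M) hV hA3).
    apply: (cluster_point_eq (continuous_symbol hV) uq) => s s0; exists 0%N => j _.
    by rewrite uE subrr normr0 ltW.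
  move=> s; apply: (cluster_point_le (@continuous_dot1 R n) (cluster_point_hflow hV s uq)) => d d0.
  exists (Num.truncn `|s|).+1 => j Nj; rewrite -(hflowD hV); apply: le_trans (pM _ _) _; last first.
    by rewrite lerDl ltW.
  have : `|s| <= t j.
    apply: le_trans (Ht j).1; apply: ltW; apply: lt_le_trans (truncnS_gt _) _ => //.
    by rewrite ler_nat.
  by have := ler_norm (- s); rewrite normrN; lra.
have [j _] := uq e 0%N e0.
by rewrite q0 ltNge (Ht j).2.
Qed.

End Incoming.

(** * Asymptotic direction of incoming trajectories *)

Section PowerDecay.
Variable R : realType.
Implicit Types (a k s t u : R).

Lemma is_derive_powR_onem a u : u < 1 ->
  is_derive u (1:R) (fun u : R => (1 - u) `^ (- a)) (a * (1 - u) `^ (- a - 1)).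
Proof.
move=> u1; have u0 : 0 < 1 - u by rewrite subr_gt0.
have d1 : is_derive u (1:R) (fun u : R => 1 - u) (-1).
  have := is_deriveB (is_derive_cst (1:R) u 1) (is_derive_id u (1:R)).
  by rewrite sub0r.
have := @is_derive1_comp R (fun s => s `^ (- a)) (fun u : R => 1 - u) u _ _ (is_derive1_powR (- a) u0) d1.
by rewrite mulrN1 mulNr opprK.
Qed.

(** The bound does not involve [s]: it is a Cauchy estimate at minus infinity, and it costs one
    power of decay. *)
Lemma power_decay_integral (f df : R -> R) a k s t : 0 < a -> s <= t -> t <= 0 ->
  (forall u, u <= 0 -> is_derive u (1:R) f (df u)) ->
  (forall u, u <= 0 -> `|df u| <= k * (1 - u) `^ (- a - 1)) ->
  `|f t - f s| <= k / a * (1 - t) `^ (- a).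
Proof.
move=> a0 st t0 fd fk.
have k0 : 0 <= k.
  by have := le_trans (normr_ge0 _) (fk 0 (lexx 0)); rewrite subr0 powR1 mulr1.
have gd u : s <= u <= t -> is_derive u (1:R) (fun u : R => k / a * (1 - u) `^ (- a)) (k * (1 - u) `^ (- a - 1)).
  move=> /andP[_ ut]; have u1 : u < 1 by exact: le_lt_trans (le_trans ut t0) ltr01.
  have := @is_deriveZ _ _ _ _ (k / a) _ _ _ (is_derive_powR_onem a u1).
  by rewrite [_ *: _]mulrA divfK // gt_eqF.
have fd' u : s <= u <= t -> is_derive u (1:R) f (df u) by move=> /andP[_ ut]; apply: fd; exact: le_trans ut t0.
have fk' u : s <= u <= t -> `|df u| <= k * (1 - u) `^ (- a - 1) by move=> /andP[_ ut]; apply: fk; exact: le_trans ut t0.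
have := derive1_norm_le_incr st fd' gd fk'.
by move=> /le_trans; apply; rewrite gerBl mulr_ge0 ?powR_ge0 // divr_ge0 // ltW.
Qed.

Lemma powR_neg_le a s t : 0 <= a -> 0 < s -> s <= t -> t `^ (- a) <= s `^ (- a).
Proof.
move=> a0 s0 st; have t0 := lt_le_trans s0 st.
rewrite !powRN lef_pV2 ?posrE ?powR_gt0 //.
by apply: ge0_ler_powR => //; rewrite nnegrE ltW.
Qed.

Lemma power_decay_small a k e : 0 < a -> 0 < e ->
  exists A, forall t, t <= A -> k * (1 - t) `^ (- a) <= e.
Proof.
move=> a0 e0; pose c := (`|k| + 1) / e.
have c0 : 0 < c by rewrite divr_gt0 // ltr_wpDl.
pose T := c `^ a^-1; have T0 : 0 < T by exact: powR_gt0.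
exists (1 - T) => t tA; have Tt : T <= 1 - t by move: tA; lra.
have : (1 - t) `^ (- a) <= c^-1.
  apply: le_trans (powR_neg_le (ltW a0) T0 Tt) _.
  by rewrite powRN -powRrM mulVf ?gt_eqF // powRr1 // ltW.
rewrite /c invf_div => H.
apply: (@le_trans _ _ ((`|k| + 1) * (e / (`|k| + 1)))); last first.
  by rewrite mulrCA divff ?mulr1 // gt_eqF // ltr_wpDl.
apply: (@le_trans _ _ ((`|k| + 1) * (1 - t) `^ (- a))).
  apply: ler_wpM2r; first exact: powR_ge0.
  by apply: le_trans (ler_norm k) _; rewrite lerDl.
by apply: ler_wpM2l => //; rewrite addr_ge0.
Qed.

End PowerDecay.

(** * The velocity of the incoming branch *)

Section IncomingDirection.
Variables (R : realType) (n : nat) (V : 'rV[R]_n -> R) (E0 B r rho C : R).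
Hypothesis hV : lipschitz_gradient V (grad V) B.
Hypothesis E00 : 0 < E0.
Hypothesis r0 : 0 < r.
Hypothesis far : forall x, r ^+ 2 <= dot x x ->
  `|V x| <= E0 / 4 /\ `|dot x (grad V x)| <= E0 / 4.
Hypothesis rho1 : 1 < rho.
Hypothesis C0 : 0 < C.
Hypothesis VC : forall x, `|V x| <= C * jap x `^ (- rho).
Hypothesis dVC : forall x i, `|partial i V x| <= C * jap x `^ (- rho - 1).

Lemma decay_along_escape : exists2 C1, 0 < C1 & forall (x : 'rV[R]_n) t, t <= 0 ->
  E0 * t ^+ 2 <= dot x x ->
  `|grad V x| <= C1 * (1 - t) `^ (- rho - 1) /\ `|V x| <= C1 * (1 - t) `^ (- rho).
Proof.
(* Since (1 - t)^2 <= 2 (1 + t^2), this constant satisfies m (1 - t)^2 <= 1 + E0 t^2, so that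
   [jap x] is at least [k * (1 - t)]. *)
pose m := Num.min 1 E0 / 2.
have m0 : 0 < m by rewrite divr_gt0 // lt_min ltr01.
have m1 : 2 * m <= 1 by rewrite mulrC divfK // ge_min lexx.
have mE : 2 * m <= E0 by rewrite mulrC divfK // ge_min lexx orbT.
pose k := Num.sqrt m; have k0 : 0 < k by rewrite sqrtr_gt0.
have k2 : k ^+ 2 = m by rewrite sqr_sqrtr // ltW.
have jk (x : 'rV[R]_n) t : t <= 0 -> E0 * t ^+ 2 <= dot x x -> k * (1 - t) <= jap x.
  move=> t0 xt; have t1 : 0 <= 1 - t by rewrite subr_ge0 (le_trans t0).
  rewrite -ler_sqr ?nnegrE ?mulr_ge0 ?(ltW k0) ?(ltW (jap_gt0 _)) //.
  rewrite jap_sqr exprMn k2; apply: (@le_trans _ _ (1 + E0 * t ^+ 2)); last by rewrite lerD2l.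
  have h1 := sqr_ge0 (1 + t); have h2 := sqr_ge0 t.
  have h3 : 2 * m * t ^+ 2 <= E0 * t ^+ 2 by rewrite ler_wpM2r.
  have h4 : m * (1 - t) ^+ 2 <= m * (2 * (1 + t ^+ 2)).
    by rewrite ler_pM2l //; move: h1; lra.
  by move: h3 h4 m1; move: (E0 * _) => q; lra.
have c1 (s : R) : 0 < k `^ (- s) by exact: powR_gt0.
have dec (x : 'rV[R]_n) t s : 0 <= s -> t <= 0 -> E0 * t ^+ 2 <= dot x x ->
    jap x `^ (- s) <= k `^ (- s) * (1 - t) `^ (- s).
  move=> s0 t0 xt; have t1 : 0 < 1 - t by rewrite subr_gt0 (le_lt_trans t0).
  rewrite -powRM ?(ltW k0) ?(ltW t1) //; apply: powR_neg_le => //; last exact: jk.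
  exact: mulr_gt0.
exists (C * (k `^ (- (rho + 1)) + k `^ (- rho))).
  by rewrite mulr_gt0 // addr_gt0.
move=> x t t0 xt; split.
  apply: norm_le_coord => [|i].
    by rewrite mulr_ge0 ?powR_ge0 // mulr_ge0 ?(ltW C0) // addr_ge0 // ltW.
  rewrite mxE; apply: le_trans (dVC x i) _.
  rewrite -opprD -mulrA; apply: ler_wpM2l; first exact: ltW.
  have rr : 0 <= rho + 1 by move: rho1; lra.
  apply: le_trans (dec x t _ rr t0 xt) _.
  by apply: ler_wpM2r; rewrite ?powR_ge0 // lerDl ltW.
apply: le_trans (VC x) _; rewrite -mulrA; apply: ler_wpM2l; first exact: ltW.
have rr : 0 <= rho by move: rho1; lra.
apply: le_trans (dec x t _ rr t0 xt) _.
by apply: ler_wpM2r; rewrite ?powR_ge0 // lerDr ltW.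
Qed.

Variable om : 'rV[R]_n.
Hypothesis om1 : dot om om = 1.
Variables (u : nat -> 'rV[R]_n * 'rV[R]_n) (a m : nat -> R) (p : 'rV[R]_n * 'rV[R]_n).
Hypothesis uq : forall j, dot (u j).1 (u j).1 = r ^+ 2.
Hypothesis uE : forall j, E0 <= symbol V (u j) <= E0 + 1.
Hypothesis uv : forall j, dot (u j).1 (u j).2 <= 0.
Hypothesis a0 : forall j, 0 <= a j.
Hypothesis mj : forall j, j%:R <= m j.
Hypothesis ua : forall j, (hflow V (u j) (- a j)).1 = - (m j *: om).
Hypothesis up : cluster_point u p.
Hypothesis pE : symbol V p = E0.

Let c := Num.sqrt (2 * E0).

Let escape_u j t : t <= 0 -> E0 * t ^+ 2 <= dot (hflow V (u j) t).1 (hflow V (u j) t).1.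
Proof.
move=> t0; have /andP[u1 _] := uE j.
have := escape_backward hV E00 far u1 _ (uv j) t0.
rewrite uq lexx => /(_ isT); apply: le_trans; rewrite lerDr.
exact: sqr_ge0.
Qed.

Lemma escape_limit t : t <= 0 -> E0 * t ^+ 2 <= dot (hflow V p t).1 (hflow V p t).1.
Proof.
move=> t0; rewrite -lerN2.
have nc : continuous (fun q : 'rV[R]_n * 'rV[R]_n => - dot q.1 q.1).
  by move=> q; exact: continuousN (@continuous_dot1 R n q).
apply: (cluster_point_le nc (cluster_point_hflow hV t up)) => e e0.
exists 0%N => j _; rewrite -[leLHS]addr0; apply: lerD; last exact: ltW.
by rewrite lerN2 escape_u.
Qed.

Lemma incoming_direction : exists K, forall t, t <= 0 ->
  `|(hflow V p t).2 - c *: om| <= K * (1 - t) `^ (- rho).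
Proof.
have [C1 C10 dec] := decay_along_escape.
have rho0 : 0 < rho by exact: lt_trans ltr01 rho1.
have c0 : 0 < c by rewrite sqrtr_gt0 mulr_gt0.
have c2 : c ^+ 2 = 2 * E0 by rewrite sqr_sqrtr // mulr_ge0 // ltW.
have BB : 0 < B by case: hV.
pose vm := 1 + 2 * (E0 + 1 + B).
have vm0 : 0 < vm by rewrite /vm; move: E00 BB; lra.
have vmb q t : symbol V q <= E0 + 1 -> `|(hflow V q t).2| <= vm.
  move=> qE; apply: norm_le_dot; first exact: ltW.
  have := hflow_velocity_bound hV (hflow_symbol hV q t) qE.
  move=> /le_trans; apply; rewrite /vm; move: (vm0); rewrite /vm.
  have : 0 <= 2 * (E0 + 1 + B) by move: E00 BB; lra.
  by move: (2 * _) => D; nra.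
pose Cv := C1 / rho; have Cv0 : 0 < Cv by exact: divr_gt0.
(* The constant is the same for all [j]: every orbit escapes backwards at the rate given by
   [escape_u]. *)
have vel j s t : s <= t -> t <= 0 ->
    `|(hflow V (u j) t).2 - (hflow V (u j) s).2| <= Cv * (1 - t) `^ (- rho).
  move=> st t0; apply: norm_le_coord => [|i].
    by rewrite mulr_ge0 ?powR_ge0 // ltW.
  have H w : w <= 0 -> `|(- grad V (hflow V (u j) w).1) 0 i| <= C1 * (1 - w) `^ (- rho - 1).
    move=> w0; apply: le_trans (coord_le_norm _ _) _; rewrite normrN.
    by case: (dec (hflow V (u j) w).1 w w0 (escape_u j w0)).
  have := power_decay_integral rho0 st t0 (fun w _ => (hflow_newton hV (u j) w i).2) H.
  by rewrite !mxE.
pose w0 := `|om|.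
have w00 : 0 < w0.
  rewrite normr_gt0; apply/eqP => o0; move: om1; rewrite o0 dot0l => /esym/eqP.
  by rewrite oner_eq0.
have w01 : w0 <= 1 by apply: norm_le_dot => //; rewrite om1 expr1n.
have pos j s t : s <= t -> `|(hflow V (u j) t).1 - (hflow V (u j) s).1| <= vm * (t - s).
  move=> st; have := @newton_position_lip _ _ _ _ _ s t (fun z _ => hflow_newton hV (u j) z) s t vm (lexx s) st (lexx t).
  by apply => z _; apply: vmb; case/andP: (uE j).
have u1r j : `|(u j).1| <= r by apply: norm_le_dot; [exact: ltW|rewrite uq].
(* The orbit covers a sup-norm distance of at least [m j * w0 - r] at speed at most [vm], so [a j]
   tends to infinity with [m j]. *)
have a_large X : exists N, forall j, (N <= j)%N -> X <= a j.
  exists (Num.truncn ((`|vm * X + r|) / w0)).+1 => j Nj.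
  have : `|vm * X + r| / w0 <= j%:R.
    by apply: ltW; apply: lt_le_trans (truncnS_gt _) _; rewrite ?ler_nat //; rewrite divr_ge0 // ltW.
  rewrite ler_pdivrMr // => H.
  have h1 : m j * w0 <= r + vm * a j.
    have := pos j (- a j) 0; rewrite oppr_le0 => /(_ (a0 j)).
    rewrite (hflow0 hV) ua opprK opprK add0r => h.
    rewrite -[m j]ger0_norm; last exact: le_trans (ler0n _ _) (mj j).
    rewrite -normrZ -[m j *: om](addKr (u j).1); apply: le_trans (ler_normD _ _) _.
    by rewrite normrN; apply: lerD.
  have h2 : j%:R * w0 <= m j * w0 by rewrite ler_pM2r // mj.
  rewrite -(ler_pM2l vm0); have := ler_norm (vm * X + r).
  by move: H h1 h2; move: (vm * X) (vm * a j) (m j * w0) (j%:R * w0) `|vm * X + r| => z1 z2 z3 z4 z5; lra.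
(* The mean velocity of [u j] over [[- a j, t]] is the displacement divided by [tau = t + a j]. It
   differs by at most [D] from the velocity at [t], and from [(m j / tau) *: om] by at most [eta]
   once [tau] is large. The other [eta] comes from replacing [p] by [u j]. *)
have approx t eta : t <= 0 -> 0 < eta -> exists2 k, 0 <= k &
    `|(hflow V p t).2 - k *: om| <= Cv * (1 - t) `^ (- rho) + 2 * eta.
  move=> t0 eta0; set D := Cv * _.
  have [N HN] := a_large (1 - t + (r + vm * `|t|) / eta).
  have [j /HN aj uj] := cluster_point_hflow hV t up N (exprn_gt0 2 eta0).
  have q0 : 0 <= (r + vm * `|t|) / eta.
    by rewrite divr_ge0 // ?addr_ge0 ?mulr_ge0 // ltW.
  pose tau := t + a j.
  have tau0 : 0 < tau by rewrite /tau; move: aj q0; move: (_ / eta) => z; lra.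
  have tauq : r + vm * `|t| <= eta * tau.
    by rewrite [eta * tau]mulrC -ler_pdivrMr // /tau; move: aj; move: (_ / eta) => z; lra.
  have mj0 : 0 <= m j by exact: le_trans (ler0n _ _) (mj j).
  exists (m j / tau); first by rewrite divr_ge0 // ltW.
  have vv : `|(hflow V p t).2 - (hflow V (u j) t).2| <= eta.
    rewrite distrC -ler_sqr ?nnegrE ?(ltW eta0) //.
    exact: le_trans (norm2_sq_le_sdist _ _) (ltW uj).
  have xt : `|(hflow V (u j) t).1| <= r + vm * `|t|.
    have := pos j t 0 t0; rewrite (hflow0 hV) sub0r => h.
    rewrite -[(hflow _ _ _).1](subKr (u j).1) (ler0_norm t0).
    by apply: le_trans (ler_normB _ _) _; apply: lerD.
  have at_ : - a j <= t by rewrite -subr_ge0 opprK ltW.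
  have tay : `|(hflow V (u j) t).1 + m j *: om - tau *: (hflow V (u j) t).2| <= D * tau.
    have := @newton_position_taylor _ _ _ _ _ (- a j) t (fun z _ => hflow_newton hV (u j) z)
      (- a j) t D (hflow V (u j) t).2 (lexx _) at_ (lexx _).
    rewrite ua !opprK; apply => z /andP[_ zt]; rewrite distrC; exact: vel.
  rewrite (_ : _ - _ = ((hflow V p t).2 - (hflow V (u j) t).2) +
      tau^-1 *: ((hflow V (u j) t).1 - ((hflow V (u j) t).1 + m j *: om - tau *: (hflow V (u j) t).2))); last first.
    move: (gt_eqF tau0); move: (hflow V p t).2 (hflow V (u j) t).1 (hflow V (u j) t).2 (m j) => v1 x1 v2 k.
    by move=> s0; apply/rowP => i; rewrite !mxE; field; rewrite s0.
  apply: le_trans (ler_normD _ _) _; rewrite mulrDl mul1r addrCA; apply: lerD => //.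
  rewrite normrZ gtr0_norm ?invr_gt0 // mulrC ler_pdivrMr //.
  apply: le_trans (ler_normB _ _) _; rewrite mulrDl addrC; apply: lerD => //.
  exact: le_trans xt tauq.
(* The multiple [k] of [om] varies with [eta]; this bound on it does not. *)
pose km := (vm + Cv + 2) / w0.
pose S : R := n%:R * (vm + km).
have km0 : 0 <= km.
  apply: divr_ge0; last exact: ltW.
  by apply: addr_ge0 => //; exact: (addr_ge0 (ltW vm0) (ltW Cv0)).
have S0 : 0 <= S by apply: mulr_ge0; [exact: ler0n|exact: (addr_ge0 (ltW vm0) km0)].
exists (Cv + (Cv * S + 2 * C1) / c) => t t0.
have pw0 : 0 <= (1 - t) `^ (- rho) by exact: powR_ge0.
have pw1 : (1 - t) `^ (- rho) <= 1.
  have := @powR_neg_le R rho 1 (1 - t) (ltW rho0) ltr01.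
  by rewrite powR1; apply; rewrite lerDl oppr_ge0.
set P := (1 - t) `^ (- rho) in pw0 pw1 *.
rewrite -subr_le0; apply: (@small_absorb _ _ (2 + 2 * S / c)).
  by apply: addr_ge0 => //; apply: divr_ge0; [exact: mulr_ge0|exact: ltW].
move=> eta eta0 eta1.
have [k k0 vk] := approx t eta t0 eta0.
set v := (hflow V p t).2 in vk *; rewrite -/P in vk.
have vvm : `|v| <= vm by apply: vmb; rewrite pE lerDl.
have kkm : k <= km.
  rewrite ler_pdivlMr // -[X in X * _](ger0_norm k0) -normrZ.
  rewrite -[k *: om](subKr v); apply: le_trans (ler_normB _ _) _; rewrite -addrA; apply: lerD => //.
  apply: le_trans vk _; apply: lerD; last by rewrite ler_piMr.
  by rewrite ler_piMr // ltW.
have vE : `|dot v v - c ^+ 2| <= 2 * (C1 * P).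
  have [_ Vx] := dec _ t t0 (escape_limit t0).
  have := hflow_symbol hV p t; rewrite pE symbolE -/v c2 => E.
  rewrite (_ : dot v v - 2 * E0 = - (2 * V (hflow V p t).1)); last first.
    by move: E; move: (dot v v) (V _) => d y; lra.
  by rewrite normrN normrM ger0_norm // ler_pM2l.
have vk2 : `|dot v v - k ^+ 2| <= (Cv * P + 2 * eta) * S.
  have -> : dot v v - k ^+ 2 = dot (v - k *: om) (v + k *: om).
    rewrite dotBl !dotDr !dotZl !dotZr om1 (dotC om v).
    by move: (dot v v) (dot v om) => d1 d2; ring.
  apply: le_trans (norm_dot_le _ _) _; rewrite [n%:R * _]mulrC -mulrA.
  apply: ler_pM => //; rewrite /S ler_wpM2l //; apply: le_trans (ler_normD _ _) _.
  apply: lerD => //; rewrite normrZ ger0_norm //.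
  by rewrite -[leRHS]mulr1 ler_pM.
(* The energy gives |v|^2 = c^2 - 2 V, so [k ^+ 2] is close to [c ^+ 2]; as [k >= 0], dividing by
   [k + c >= c] bounds |k - c|. *)
have kc : `|k - c| * c <= (Cv * P + 2 * eta) * S + 2 * (C1 * P).
  have h : `|k ^+ 2 - c ^+ 2| <= (Cv * P + 2 * eta) * S + 2 * (C1 * P).
    rewrite (_ : k ^+ 2 - c ^+ 2 = - (dot v v - k ^+ 2) + (dot v v - c ^+ 2)); last by ring.
    by apply: le_trans (ler_normD _ _) _; rewrite normrN; apply: lerD.
  apply: le_trans h; rewrite subr_sqr normrM ler_wpM2l // ger0_norm ?addr_ge0 ?(ltW c0) //.
  by rewrite lerDr.
have fin : `|v - c *: om| <= Cv * P + 2 * eta + ((Cv * P + 2 * eta) * S + 2 * (C1 * P)) / c.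
  rewrite (_ : v - c *: om = (v - k *: om) + (k - c) *: om); last first.
    by rewrite scalerBl addrA subrK.
  apply: le_trans (ler_normD _ _) _; apply: lerD => //.
  rewrite normrZ ler_pdivlMr // mulrAC; apply: le_trans kc.
  by rewrite ler_piMr // mulr_ge0 // ltW.
rewrite lerBlDl; apply: le_trans fin _.
rewrite le_eqVlt; apply/orP; left; apply/eqP.
by field; rewrite gt_eqF.
Qed.

End IncomingDirection.

(** * Conclusion *)

Section Limits.
Variables (R : realType) (U : normedModType R) (f : R -> U) (l : U).

Lemma cvg_ninfty : (forall e, 0 < e -> exists A, forall t, t <= A -> `|f t - l| <= e) ->
  f t @[t --> -oo] --> l.
Proof.
move=> H; apply/cvgrPdist_le => e /H[A HA]; exists A; split; first exact: num_real.
by move=> t /ltW /HA; rewrite distrC.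
Qed.

Lemma cvg_pinfty : (forall e, 0 < e -> exists A, forall t, A <= t -> `|f t - l| <= e) ->
  f t @[t --> +oo] --> l.
Proof.
move=> H; apply/cvgrPdist_le => e /H[A HA]; exists A; split; first exact: num_real.
by move=> t /ltW /HA; rewrite distrC.
Qed.

End Limits.

Lemma enorm_le (R : realType) n (x : 'rV[R]_n) : enorm x <= n%:R * `|x|.
Proof.
rewrite -ler_sqr ?nnegrE ?sqrtr_ge0 ?mulr_ge0 // enorm_sqr exprMn.
apply: le_trans (dotxx_le x) _; apply: ler_wpM2r; first exact: exprn_ge0.
by rewrite -natrX ler_nat; case: (n) => // k; rewrite -[leqLHS]expn1 leq_pexp2l.
Qed.

Section Assembly.
Variables (R : realType) (n : nat) (V : 'rV[R]_n -> R) (E0 : R) (lambda : 'I_n -> R).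
Hypothesis hA1 : assumption_A1 V.
Hypothesis hA2 : assumption_A2 V E0 lambda.
Hypothesis hA3 : assumption_A3 V E0.

Let c := Num.sqrt (2 * E0).

Lemma incoming_trajectory (om : 'rV[R]_n) : dot om om = 1 ->
  exists p z, [/\ forall t, newton (fun x => - grad V x)
      (fun t => (hflow V p t).1) (fun t => (hflow V p t).2) t,
    dot z om = 0,
    forall e, 0 < e -> exists A, forall t, t <= A ->
      `|(hflow V p t).1 - (c * t) *: om - z| <= e /\ `|(hflow V p t).2 - c *: om| <= e &
    forall e, 0 < e -> exists A, forall t, A <= t -> 
      `|(hflow V p t).1| <= e /\ `|(hflow V p t).2| <= e].
Proof.
move=> om1.
have [Vmax V0 E00 _ _] := hA2.
have [B hV] := assumption_A1_lipschitz hA1.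
have [rho [C [rho1 C0 VC dVC _]]] := assumption_A1_decay hA1.
have [r r0 far] := assumption_A1_far_field hA1 (divr_gt0 E00 (ltr0n R 4)).
have g0 : grad V 0 = 0 by apply: grad_local_max => // x i; exact: (hA1.1 [::]).2.
have Vle x : V x <= E0.
  have [->|x0] := eqVneq x 0; first by rewrite V0.
  by apply: ltW; exact: (potential_lt hV E00 V0 g0 r0 far hA3 Vmax).
(* The starting points [- m j *: om] lie outside the ball of radius [r] and tend to infinity. *)
pose m j : R := j%:R + r.
have mr j : r ^+ 2 <= dot (- (m j *: om)) (- (m j *: om)).
  rewrite dotNl dotNr opprK dotZl dotZr om1 mulr1 -expr2 ler_sqr ?nnegrE ?addr_ge0 ?(ltW r0) //.
  by rewrite lerDr.
pose e j : R := j.+1%:R^-1.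
have e0 j : 0 < e j by rewrite invr_gt0.
have e1 j : e j <= 1 by rewrite invf_le1 // ler1n.
have /choice[u /choice[a /choice[b H]]] := fun j => trajectory_to_origin hV E00 V0 r0 far Vle (e0 j) (mr j).
have BB : 0 < B by case: hV.
have uq j : dot (u j).1 (u j).1 = r ^+ 2 by case: (H j) => _ [].
have uE j : symbol V (u j) = E0 + e j by case: (H j) => _ [].
have uv j : dot (u j).1 (u j).2 <= 0 by case: (H j) => _ [].
have a0 j : 0 <= a j by case: (H j) => -[].
have b0 j : 0 <= b j by case: (H j) => -[].
have uE' j : E0 <= symbol V (u j) <= E0 + 1.
  by rewrite uE lerDl ltW //= lerD2l.
have [p up] : exists p, cluster_point u p.
  have D0 : 0 <= 2 * (E0 + 1 + B) by move: E00 BB; lra.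
  apply: (@bounded_cluster_point _ _ u (r + (1 + 2 * (E0 + 1 + B)))) => j.
  have P0 : 0 <= r + (1 + 2 * (E0 + 1 + B)) by move: D0 r0; lra.
  split; apply: norm_le_dot => //.
    by rewrite uq ler_sqr ?nnegrE ?(ltW r0) // lerDl addr_ge0.
  have /andP[_ uE1] := uE' j.
  apply: le_trans (hflow_velocity_bound hV (erefl _) uE1) _.
  by move: r0 D0; move: (2 * _) => D; nra.
have pE : symbol V p = E0.
  apply: (cluster_point_eq (continuous_symbol hV) up) => s s0.
  have [N HN] := inv_succ_small s0; exists N => j /HN ej.
  by rewrite uE addrAC subrr add0r ger0_norm // ltW.
have fwd t : 0 <= t -> dot (hflow V p t).1 (hflow V p t).1 <= r ^+ 2.
  move=> t0; apply: (cluster_point_le (@continuous_dot1 R n) (cluster_point_hflow hV t up)) => s s0.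
  have [z z0 Hz] := near_equilibrium_time hV t g0 (exprn_gt0 2 r0).
  have [N HN] := inv_succ_small (divr_gt0 z0 (ltr0n R 2)).
  exists N => j /HN ez; have [_ _ _ ub ur] := H j.
  (* A fixed time [t] precedes the arrival time [b j] for large [j], so the bound valid up to [b j]
     reaches every [t >= 0] in the limit. *)
  have tb : t < b j.
    rewrite ltNge; apply/negP => bt; suff : r ^+ 2 < r ^+ 2 by rewrite ltxx.
    rewrite -{1}(uq j); apply: (Hz _ (b j)); first by rewrite ger0_norm.
    by rewrite ub; move: ez; rewrite -/(e j); lra.
  by apply: le_trans (ur t _) _; rewrite ?t0 ?ltW // ltrDl.
have cv0 := bounded_forward_cvg hV hA3 pE fwd.
have mj j : j%:R <= m j by rewrite lerDl ltW.
have ua j : (hflow V (u j) (- a j)).1 = - (m j *: om) by case: (H j).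
have [K HK] := incoming_direction hV E00 r0 far rho1 C0 VC dVC om1 uq uE' uv a0 mj ua up pE.
have c0 : 0 < c by rewrite sqrtr_gt0 mulr_gt0.
pose y t := (hflow V p t).1 - (c * t) *: om.
have yd i w : is_derive w (1:R) (fun s => y s 0 i) (((hflow V p w).2 - c *: om) 0 i).
  have -> : (fun s => y s 0 i) = (fun s => (hflow V p s).1 0 i) - (fun s : R => (c * om 0 i) * s).
    by apply/funext => s; rewrite !mxE -[RHS]/(_ - (c * om 0 i) * s) mulrAC.
  have -> : ((hflow V p w).2 - c *: om) 0 i = (hflow V p w).2 0 i - c * om 0 i by rewrite !mxE.
  apply: is_deriveB.
    exact: (hflow_newton hV p w i).1.
  by apply: is_derive_eq; rewrite /GRing.scale /= mulr1.
have rho10 : 0 < rho - 1 by rewrite subr_gt0.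
pose K1 := K / (rho - 1).
(* Integrating the [(1 - t)^(- rho)] decay of the velocity requires [rho > 1]. *)
have ylip s t : s <= t -> t <= 0 -> `|y t - y s| <= K1 * (1 - t) `^ (- (rho - 1)).
  move=> st t0; have bd i w : w <= 0 -> `|((hflow V p w).2 - c *: om) 0 i| <= K * (1 - w) `^ (- (rho - 1) - 1).
    move=> w0; apply: le_trans (coord_le_norm _ _) _; rewrite (_ : - (rho - 1) - 1 = - rho); last by ring.
    exact: HK.
  have comp i := power_decay_integral rho10 st t0 (fun w _ => yd i w) (bd i).
  apply: norm_le_coord => [|i]; last by rewrite [(y t - y s) 0 i]mxE [(- y s) 0 i]mxE; exact: comp.
  have K0 : 0 <= K.
    by have := le_trans (normr_ge0 _) (HK 0 (lexx 0)); rewrite subr0 powR1 mulr1.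
  by rewrite mulr_ge0 ?powR_ge0 // divr_ge0 // ltW.
have [z Hz] : exists z, forall t, t <= 0 -> `|y t - z| <= K1 * (1 - t) `^ (- (rho - 1)).
  pose w (k : nat) := y (- k%:R).
  have wb k : `|w k| <= `|y 0| + K1.
    have := ylip (- k%:R) 0; rewrite oppr_le0 => /(_ (ler0n _ _) (lexx 0)).
    rewrite subr0 powR1 mulr1 => h; rewrite -[w k](subKr (y 0)).
    by apply: le_trans (ler_normB _ _) _; apply: lerD.
  (* A cluster point along the integers is enough: by [ylip] it is the limit of [y] at minus
     infinity. *)
  have [z [z' Hz]] := bounded_cluster wb wb.
  exists z => t t0; apply/ler_addgt0Pr => d d0.
  have [k [Nk zk _]] := Hz d (Num.truncn `|t|).+1 d0.
  have kt : - k%:R <= t.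
    rewrite lerNl -(ler0_norm t0); apply: ltW; apply: lt_le_trans (truncnS_gt _) _ => //.
    by rewrite ler_nat.
  rewrite -(subrK (w k) (y t)) -addrA; apply: le_trans (ler_normD _ _) _.
  by apply: lerD (ylip _ _ kt t0) (ltW zk).
(* A time shift by [s] moves the limit position by [- (c * s) *: om], which removes the component of
   [z] along [om] and makes the impact parameter orthogonal to it. *)
pose s := dot z om / c.
pose q := hflow V p (- s).
have qE t : hflow V q t = hflow V p (t - s) by rewrite /q -(hflowD hV) addrC.
exists q, (z - dot z om *: om); split.
- by move=> t; exact: (hflow_newton hV).
- by rewrite dotBl dotZl om1 mulr1 subrr.
- move=> d d0.
  have [A1 HA1] := power_decay_small K1 rho10 d0.
  have rho0 : 0 < rho by exact: lt_trans ltr01 rho1.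
  have [A2 HA2] := power_decay_small K rho0 d0.
  exists (Num.min (Num.min A1 A2) 0 + s) => t; rewrite -lerBlDr !le_min => /andP[/andP[t1 t2] t0].
  rewrite qE; split; last by apply: le_trans (HK _ t0) (HA2 _ t2).
  rewrite (_ : _ - _ - _ = y (t - s) - z).
    by apply: le_trans (Hz _ t0) (HA1 _ t1).
  rewrite /y mulrBr scalerBl (_ : c * s = dot z om); last by rewrite mulrC divfK // gt_eqF.
  by move: (hflow _ _ _).1 (_ *: om) (_ *: om) => v1 v2 v3; apply/rowP => i; rewrite !mxE; ring.
move=> d d0; have [A HA] := cv0 _ (exprn_gt0 2 d0).
exists (A + s) => t; rewrite -lerBrDr => /HA /ltW h; rewrite qE; split.
  rewrite -ler_sqr ?nnegrE ?(ltW d0) //; apply: le_trans h.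
  by have := norm1_sq_le_sdist (hflow V p (t - s)) (0, 0); rewrite subr0.
rewrite -ler_sqr ?nnegrE ?(ltW d0) //; apply: le_trans h.
by have := norm2_sq_le_sdist (hflow V p (t - s)) (0, 0); rewrite subr0.
Qed.

End Assembly.

Unset Implicit Arguments.

Theorem proposition2p5 (R : realType) (n : nat) (V : 'rV[R]_n -> R) (E0 : R)
    (lambda : 'I_n -> R)
    (hn : (2 <= n)%N)
    (hA1 : assumption_A1 V)
    (hA2 : assumption_A2 V E0 lambda)
    (hA3 : assumption_A3 V E0) :
  forall omega theta : 'rV[R]_n,
    unit_sphere omega -> unit_sphere theta ->
    Lambda_incoming V E0 omega `&` Lambda_minus V !=set0 /\
    Lambda_outgoing V E0 theta `&` Lambda_plus V !=set0.
Proof.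
have sphere x : @unit_sphere R n x -> dot x x = 1.
  by move=> x1; rewrite -enorm_sqr x1 expr1n.
have small (w : 'rV[R]_n) e : 0 < e -> `|w| <= e / (n%:R + 1) -> `|enorm w - 0| <= e.
  move=> /ltW e0 we; rewrite subr0 ger0_norm ?sqrtr_ge0 //.
  have n1 : 0 < n%:R + 1 :> R by rewrite ltr_wpDl.
  apply: le_trans (enorm_le _) _; apply: (@le_trans _ _ ((n%:R + 1) * (e / (n%:R + 1)))).
    by apply: ler_pM => //; rewrite lerDl.
  by rewrite mulrCA divff ?mulr1 // gt_eqF.
have n1 : 0 < n%:R + 1 :> R by rewrite ltr_wpDl.
have pair (g : R -> 'rV[R]_n * 'rV[R]_n) t e : `|(g t).1| <= e /\ `|(g t).2| <= e -> `|g t - (0, 0)| <= e.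
  by move=> [g1 g2]; rewrite subr0 /Num.Def.normr /= ge_max g1.
move=> omega theta /sphere om1 /sphere th1; split.
- have [p [z [H zom back fwd]]] := incoming_trajectory hA1 hA2 hA3 om1.
  pose g t := ((hflow V p t).1, (hflow V p t).2).
  have gc : integral_curve V g by exact: newton_integral_curve.
  exists (g 0); split.
    exists z, g, 0; split => //; split => //.
      apply: cvg_ninfty => e e0; have [A HA] := back _ (divr_gt0 e0 n1).
      by exists A => t /HA[h _]; exact: small.
    apply: cvg_ninfty => e e0; have [A HA] := back _ (divr_gt0 e0 n1).
    by exists A => t /HA[_ h]; exact: small.
  exists g; split => //; apply: cvg_pinfty => e e0; have [A HA] := fwd e e0.
  by exists A => t /HA h; exact: pair.
(* Time reversal maps an orbit coming from the direction [- theta] to one leaving in the direction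
   [theta]; the impact parameter [z] is unchanged. *)
- have nth1 : dot (- theta) (- theta) = 1 by rewrite dotNl dotNr opprK.
  have [p [z [H zom back fwd]]] := incoming_trajectory hA1 hA2 hA3 nth1.
  pose g t := ((hflow V p (- t)).1, - (hflow V p (- t)).2).
  have gc : integral_curve V g.
    by apply: newton_integral_curve => t; exact: (newton_opp (H (- t))).
  exists (g 0); split.
    exists z, g, 0; split => //.
      by apply/eqP; rewrite -oppr_eq0 -dotNr zom.
    split => //.
      apply: cvg_pinfty => e e0; have [A HA] := back _ (divr_gt0 e0 n1).
      exists (- A) => t; rewrite lerNl => /HA[h _].
      apply: small => //.
      by move: h; rewrite mulrN scalerN scaleNr opprK.
    apply: cvg_pinfty => e e0; have [A HA] := back _ (divr_gt0 e0 n1).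
    exists (- A) => t; rewrite lerNl => /HA[_ h].
    apply: small => //.
    by move: h; rewrite scalerN opprK -[in X in _ -> X]normrN opprB opprK addrC.
  exists g; split => //; apply: cvg_ninfty => e e0; have [A HA] := fwd e e0.
  exists (- A) => t; rewrite lerNr => /HA[h1 h2]; apply: pair; split => //=.
  by rewrite normrN.
Qed.
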